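(* Let $g,n$ be integers with $2n\le g-1$ and $\rho:=4n-2-g\ge0$. For a general ribbon $C$ of genus $g$ on $\mathbb P^1$, if $W^1_{2n}(C)=\{L\in\mathrm{Pic}^{2n}(C): h^0(C,L)\ge 2\}$ is non-empty, then $W^1_{2n}(C)$ has dimension equal to $\rho=4n-2-g$.
   Context: Work over an algebraically closed field $k$ of characteristic $0$. A ribbon on $\mathbb P^1$ is a scheme $C$ with an isomorphism $\mathbb P^1\to C_{red}$ such that the ideal sheaf $\mathscr L$ of $\mathbb P^1$ in $C$ satisfies $\mathscr L^2=0$ and is (as a sheaf on $\mathbb P^1$) a line bundle. Its genus is $g=1-\chi(\mathscr O_C)$; equivalently $\mathscr L\cong\mathscr O_{\mathbb P^1}(-g-1)$. Every genus $g$ ribbon is obtained by gluing $U_1=\operatorname{Spec}k[s,\epsilon]/\epsilon^2$ and $U_2=\operatorname{Spec}k[t,\eta]/\eta^2$ via $\epsilon=t^{-g-1}\eta$, $s^{-1}=t+F(t)\eta$, with $F=\sum_{i=1}^{g-2}F_it^{-i}$, $F_i\in k$; up to isomorphism over $\mathbb P^1$ it depends only on $F$ up to a nonzero scalar. ''For a general ribbon $C$'' means: for all ribbons whose parameter $(F_1,\dots,F_{g-2})$ lies in some non-empty Zariski open subset of $\mathbb A^{g-2}$. The degree of a line bundle $L$ on $C$ is $\chi(L)-\chi(\mathscr O_C)$; if $L|_{\mathbb P^1}\cong\mathscr O_{\mathbb P^1}(n)$ then $\deg L=2n$. A degree $2n$ line bundle is given by free generators $e_i$ on $U_i$ with $e_1=(t+F\eta)^n(1+G\eta)e_2$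 on $U_1\cap U_2$, and isomorphism classes correspond bijectively to $G=\sum_{j=1}^gG_jt^{-j}$; this identifies $\mathrm{Pic}^{2n}(C)$ with $\mathbb A^g$, in which $W^1_{2n}(C)$ is a closed algebraic subset. *)

(* Defs.v *)
From HB Require Import structures.
From mathcomp Require Import all_boot all_order all_algebra.
From mathcomp Require Import boolp classical_sets.
From mathcomp Require Import mpoly.

Set Implicit Arguments.
Unset Strict Implicit.
Unset Printing Implicit Defensive.

Import GRing.Theory.
Local Open Scope classical_set_scope.
Local Open Scope ring_scope.

(* Affine space A^N is the type 'rV[k]_N of its k-points; k is algebraically
   closed in the applications, so points suffice. *)
Section Zariski.
Variables (k : fieldType) (N : nat).
Implicit Types (Z W A B U : set 'rV[k]_N).

Definition zariski_closed Z :=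
  exists S : set {mpoly k[N]},
    Z = [set x | forall f, S f -> f.@[x ord0] = 0].

Definition zariski_open U := zariski_closed (~` U).

Definition zariski_irreducible Z :=
  Z !=set0 /\
  forall A B, zariski_closed A -> zariski_closed B ->
    Z `<=` A `|` B -> Z `<=` A \/ Z `<=` B.

Definition zariski_closed_in W Z :=
  exists2 A, zariski_closed A & Z = W `&` A.

(* C 0 < C 1 < ... < C d, a chain of length d in W for the induced topology;
   the values C i for i > d are irrelevant. *)
Definition irreducible_chain W (d : nat) (C : nat -> set 'rV[k]_N) :=
  (forall i, (i <= d)%N ->
     zariski_closed_in W (C i) /\ zariski_irreducible (C i)) /\
  (forall i, (i < d)%N -> C i `<` C i.+1).

(* "dim W = d": d is the largest length of a chain; in particular W is then
   non-empty. *)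
Definition has_dimension W (d : nat) :=
  (exists C, irreducible_chain W d C) /\
  (forall e, (exists C, irreducible_chain W e C) -> (e <= d)%N).

Definition holds_generally (P : 'rV[k]_N -> Prop) :=
  exists U, [/\ zariski_open U, U !=set0 & forall x, U x -> P x].

End Zariski.

Notation dual_numbers R := {poly %/ ('X^2 : {poly R})}.

(* O(U_1) = k[s,epsilon]/(epsilon^2) and O(U_2) = k[t,eta]/(eta^2). *)
Notation chart k := (dual_numbers {poly k}).

(* O(U_1 \cap U_2) = k[t,1/t][eta]/(eta^2) is a subring of k(t)[eta]/(eta^2).
   Gluing only tests equality of elements of this subring, so the larger ring
   is used. *)
Notation overlap k := (dual_numbers {fraction {poly k}}).

Section Ribbon.
Variable k : fieldType.

Definition ratfun_t : {fraction {poly k}} := tofrac 'X.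

(* A row vector v of length m stands for \sum_(1 <= i <= m) v_i t^-i; entries
   are indexed from 0, whence the shift in the exponent. *)
Definition polar_part m (v : 'rV[k]_m) : {fraction {poly k}} :=
  \sum_(i < m) tofrac (v ord0 i)%:P * ratfun_t ^- i.+1.

Definition on_overlap : {rmorphism {fraction {poly k}} -> overlap k} :=
  qpolyC _.

Definition const_on_overlap : {rmorphism k -> overlap k} :=
  (on_overlap \o @tofrac {poly k} \o polyC).

Definition eta : overlap k := qpolyX _.

(* The k-algebra morphism k[z,e]/(e^2) -> O(U_1 \cap U_2), z |-> u, e |-> v
   (for v^2 = 0), evaluated at f = f_0(z) + f_1(z) e. *)
Definition chart_eval (u v : overlap k) (f : chart k) : overlap k :=
  let ev (p : {poly k}) :=
    (map_poly const_on_overlap p).[u] in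
  ev (f : {poly {poly k}})`_0 + ev (f : {poly {poly k}})`_1 * v.

(* The ribbon of genus g with parameter F : 'rV_(g - 2) is the gluing of U_1
   and U_2 along epsilon = t^(-g-1) eta, s^-1 = t + F(t) eta. *)
Section Gluing.
Variables (g : nat) (F : 'rV[k]_(g - 2)).

Definition s_inverse : overlap k :=
  on_overlap ratfun_t + on_overlap (polar_part F) * eta.

Definition restrict1 : chart k -> overlap k :=
  chart_eval s_inverse^-1 (on_overlap (ratfun_t ^- g.+1) * eta).

Definition restrict2 : chart k -> overlap k :=
  chart_eval (on_overlap ratfun_t) eta.

(* For the line bundle with free generators e_i on U_i and e_1 = u e_2 on the
   overlap, the pair (x_1, x_2) stands for the sections x_1 e_1 and x_2 e_2. *)
Definition global_sections (u : overlap k) : set (chart k * chart k) :=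
  [set x | restrict1 x.1 * u = restrict2 x.2].

Definition linearly_independent r (x : 'I_r -> chart k * chart k) :=
  forall c : 'I_r -> k,
    \sum_(i < r) (c i)%:P *: x i = 0 -> forall i, c i = 0.

(* h^0 >= r; constants of k act through k[s] and k[t], of which O(U_1) and
   O(U_2) are algebras. *)
Definition h0_ge (u : overlap k) (r : nat) :=
  exists2 x : 'I_r -> chart k * chart k,
    forall i, global_sections u (x i) & linearly_independent x.

(* The line bundle of degree 2n with parameter G in A^g = Pic^{2n}(C). *)
Definition transition (n : nat) (G : 'rV[k]_g) : overlap k :=
  s_inverse ^+ n * (1 + on_overlap (polar_part G) * eta).

(* W1 n is W^1_{2n}(C). *)
Definition W1 (n : nat) : set 'rV[k]_g :=
  [set G | h0_ge (transition n G) 2].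

End Gluing.
End Ribbon.

Arguments on_overlap {k}.
Arguments const_on_overlap {k}.

(* Main.v *)
(* A section of the bundle with parameter [G] amounts to a polynomial [c] of degree at most [n] such
   that [F(t^j c') + G(t^j c) = 0] for all [j < g - n], where [F] and [G] act on polynomials through
   their coefficients.  Hence two sections [c1 = h m1], [c2 = h m2], with [m1] and [m2] coprime, force
   [F] to kill [h (m1' m2 - m1 m2') t^i] for [i < g - n - deg m1], and conversely.

   The Wronski map [(h, m1, m2) |-> h (m1' m2 - m1 m2')] on monic polynomials is homogeneous for
   positive weights and has, once completed by the coefficient of [t^(deg m2)] in [m1], a trivial zero
   fibre in characteristic 0, so it is finite.  For general [F] all Hankel determinants of [F] are
   nonzero, so the Wronskians killed by [F] form an affine space of known dimension, and a linear
   system recovers [G] from the pencil.  Counting over the degrees of [h], [m1], [m2] gives the upper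
   bound; dimensions are bounded through the growth of the space of functions of degree at most [D].

   For the lower bound take [h = 1], [deg m1 = n], [deg m2 = n - 1].  A flag of affine subspaces of the
   Wronskians killed by [F] lifts along the finite Wronski map to a chain of irreducible closed sets
   of pencils (going up), and this chain is transported to [W1] by the birational correspondence
   between pencils and line bundles.  That both directions of the correspondence are defined at the
   bottom of the chain, for general [F], follows by taking a norm along the Wronski map from the
   explicit pencil [<t^n, t^(n-1) + 1>] with [F_(n-1)] the only nonzero coefficient of [F]. *)

Require Import Defs.
From HB Require Import structures.
From mathcomp Require Import all_boot all_order all_algebra.
From mathcomp Require Import boolp classical_sets.
From mathcomp Require Import mpoly.
From mathcomp Require Import ring zify.
Set Implicit Arguments.
Unset Strict Implicit.
Unset Printing Implicit Defensive.
Import GRing.Theory.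
Local Open Scope classical_set_scope.
Local Open Scope ring_scope.

(** * Sections of line bundles on ribbons *)

(** Dimension is the length of chains, so the two bounds need different tools. An upper bound is a
    count: a chain of length d yields E^d independent functions of degree O(E), and growth passes
    through finite unions, rational images and finite covers, which is all that the stratification
    needs. A lower bound needs an actual chain, and lifting a flag along a finite map gives no
    control over which points of the fibres are met. Hence the bottom of the flag is a single
    Wronskian, and every pencil above it has to be good; a norm turns this into a nonvanishing
    condition on the Wronskian. For the norm to be a polynomial, pencils and ribbons are put into
    one affine space: that F kills the Wronskian is a linear recurrence for F whose characteristic
    polynomial is the Wronskian, so the first e = 2n-2 coefficients of F are free and the other s =
    g-2n follow, as e+s = g-2. Read instead for the Wronskian with F fixed, the same equations have
    a Hankel matrix: if it is invertible, s of the e lower coefficients are determined by the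
    others, so the flag has length e-s = 4n-2-g. *)

Section DualNumbers.
Variable A : comNzRingType.
Local Notation D := {poly %/ ('X^2 : {poly A})}.

Definition dual (a b : A) : D := in_qpoly 'X^2 (a%:P + b *: 'X).

Lemma dual_val a b : dual a b = a%:P + b *: 'X :> {poly A}.
Proof.
rewrite in_qpoly_small // mk_monic_Xn size_polyXn.
apply: leq_trans (_ : 2 < 3)%N => //; rewrite ltnS.
rewrite (leq_trans (size_polyD _ _)) // geq_max size_polyC.
by rewrite (leq_trans (size_scale_leq _ _)) ?size_polyX ?andbT //; case: eqP.
Qed.

Lemma dual_coef0 a b : (dual a b : {poly A})`_0 = a.
Proof. by rewrite dual_val coefD coefC coefZ coefX /= mulr0 addr0. Qed.

Lemma dual_coef1 a b : (dual a b : {poly A})`_1 = b.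
Proof. by rewrite dual_val coefD coefC coefZ coefX /= mulr1 add0r. Qed.

Lemma dualK (x : D) : x = dual (x : {poly A})`_0 (x : {poly A})`_1.
Proof.
apply: val_inj; move: (dual_val (x : {poly A})`_0 (x : {poly A})`_1) => /= ->.
apply/polyP => i.
rewrite coefD coefC coefZ coefX; case: i => [|[|i]]; rewrite ?mulr0 ?addr0 ?add0r ?mulr1 //.
have sz : size (mk_monic ('X^2 : {poly A})) = 3 by rewrite mk_monic_Xn size_polyXn.
by rewrite nth_default //; have := leq_trans (size_mk_monic x) (eq_leq sz); rewrite ltnS => /leq_trans; apply.
Qed.

Lemma dual_inj a b c d : dual a b = dual c d -> a = c /\ b = d.
Proof.
move=> e; split.
  by have := congr1 (fun x : D => (x : {poly A})`_0) e; rewrite !dual_coef0.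
by have := congr1 (fun x : D => (x : {poly A})`_1) e; rewrite !dual_coef1.
Qed.

Lemma dual_eq a b c d : a = c -> b = d -> dual a b = dual c d.
Proof. by move=> -> ->. Qed.

Lemma dualD a b c d : dual a b + dual c d = dual (a + c) (b + d).
Proof. by rewrite /dual -linearD /= polyCD scalerDl addrACA. Qed.

Lemma dual0 : dual 0 0 = 0.
Proof. by rewrite /dual polyC0 scale0r addr0 linear0. Qed.

Lemma dualC a : qpolyC 'X^2 a = dual a 0.
Proof.
by apply: val_inj; move: (dual_val a 0) => /= ->; rewrite scale0r addr0.
Qed.

Lemma dualX : qpolyX ('X^2 : {poly A}) = dual 0 1.
Proof. by rewrite /dual polyC0 add0r scale1r. Qed.

Lemma dualM a b c d : dual a b * dual c d = dual (a * c) (a * d + b * c).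
Proof.
have sq0 : in_qpoly 'X^2 'X^2 = 0 :> D.
  by apply: val_inj; rewrite /= mk_monic_Xn Pdiv.RingMonic.rmodpp ?monicXn.
rewrite /dual -!in_qpolyM.
rewrite (_ : (a%:P + b *: 'X) * (c%:P + d *: 'X) =
   ((a * c)%:P + (a * d + b * c) *: 'X) + (b * d) *: 'X^2); last first.
  rewrite -!mul_polyC !polyCD !polyCM expr2; ring.
by rewrite linearD /= linearZ /= sq0 scaler0 addr0.
Qed.

Lemma dual1 : dual 1 0 = 1.
Proof. by rewrite -dualC. Qed.

Lemma dualXn a b n : dual a b ^+ n = dual (a ^+ n) (n%:R * a ^+ n.-1 * b).
Proof.
elim: n => [|n IHn]; first by rewrite [LHS]expr0 expr0 !mul0r dual1.
rewrite [dual a b ^+ _]exprS IHn dualM -exprS; congr dual.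
case: n {IHn} => [|n] /=; first by rewrite expr0 !mulr1 mul1r !mul0r mulr0 add0r.
by rewrite !exprS; ring.
Qed.

End DualNumbers.

(* Stated over an abstract field: [field] diverges on [{fraction {poly k}}]. *)
Section AbstractField.
Variable E : fieldType.

Lemma cancel_factor (v p x y : E) : y != 0 -> v / y * p * (x * y) = v * x * p.
Proof. by move=> y0; field. Qed.

Lemma dual_inv_coef (x p : E) : x != 0 -> x * (- p * x^-1 ^+ 2) + p * x^-1 = 0.
Proof. by move=> y0; field. Qed.

Lemma deriv_rev_monomial (i m x y z : E) : x != 0 -> z != 0 ->
  i * y / z = (i + m) * (y * x * z) / z * (z * x)^-1 -
    y * x * z * (z ^+ 2)^-1 * (m * x^-1).
Proof. by move=> x0 z0; field; rewrite x0 z0. Qed.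

End AbstractField.

Section LaurentPolynomials.
Variable k : fieldType.
Local Notation K := {fraction {poly k}}.
Local Notation t := (ratfun_t k).

Definition constK : {rmorphism k -> K} := (@tofrac {poly k} \o polyC).

Lemma ratfun_t_neq0 : t != 0.
Proof. by rewrite tofrac_eq0 polyX_eq0. Qed.

Lemma tofrac_horner (p : {poly k}) : tofrac p = (map_poly constK p).[t].
Proof.
elim/poly_ind: p => [|p c IH]; first by rewrite !rmorph0 horner0.
by rewrite rmorphD rmorphM /= IH rmorphD rmorphM /= map_polyX map_polyC hornerMXaddC.
Qed.

Lemma horner_dual (p : {poly k}) (x y : K) :
  (map_poly const_on_overlap p).[dual x y] =
  dual (map_poly constK p).[x] ((map_poly constK p^`()).[x] * y).
Proof.
elim/poly_ind: p => [|p c IH].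
  by rewrite deriv0 !rmorph0 !horner0 mul0r dual0.
rewrite rmorphD rmorphM /= map_polyX map_polyC hornerMXaddC IH.
rewrite rmorphD rmorphM /= map_polyX map_polyC hornerMXaddC.
rewrite [X in _ + X = _](_ : _ = dual (constK c) 0); last by rewrite -dualC.
rewrite dualM dualD; congr dual.
rewrite derivD derivM derivX derivC mulr1 !addr0 rmorphD rmorphM /= map_polyX.
by rewrite hornerD hornerMX; ring.
Qed.

(** The reciprocal polynomial t^n p(1/t), which passes between the coordinates s = 1/t and t of the
    reduced line. *)
Definition rev_poly n (p : {poly k}) := \poly_(i < n.+1) p`_(n - i).

Lemma rev_polyE n (p : {poly k}) : (size p <= n.+1)%N ->
  (map_poly constK p).[t^-1] * t ^+ n = tofrac (rev_poly n p).
Proof.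
move=> sp; rewrite tofrac_horner (@horner_coef_wide _ n.+1); last first.
  by rewrite (leq_trans (size_poly _ _)).
rewrite (@horner_coef_wide _ n.+1) ?(leq_trans (size_poly _ _)) //.
rewrite mulr_suml (reindex_inj rev_ord_inj) /=; apply: eq_bigr => i _.
rewrite !coef_map /= coef_poly subSS; have := ltn_ord i; rewrite ltnS => il.
rewrite il -mulrA; congr (_ * _).
rewrite -[in t ^+ n](subnK il) exprD mulrA -exprMn mulVf ?ratfun_t_neq0 //.
by rewrite expr1n mul1r.
Qed.

(** The residue pairing: the coefficient of t^-1 in [polar_part v] times p. The coefficient of
    t^-(j+1) is then the pairing with t^j p. *)
Definition pair m (v : 'rV[k]_m) (p : {poly k}) : k := \sum_(i < m) v ord0 i * p`_i.

Lemma polar_partM m (v : 'rV[k]_m) (p : {poly k}) N : (m <= N)%N ->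
  polar_part v * tofrac p * t ^+ N =
  tofrac (\sum_(i < m) (v ord0 i)%:P * 'X^(N - i.+1) * p).
Proof.
move=> mN; rewrite rmorph_sum /= /polar_part !mulr_suml; apply: eq_bigr => i _.
rewrite !rmorphM /= rmorphXn /=.
have iN : (i.+1 <= N)%N by apply: leq_trans mN.
rewrite -[in t ^+ N](subnK iN) exprD.
by rewrite cancel_factor // expf_neq0 // ratfun_t_neq0.
Qed.

Lemma coef_polar m (v : 'rV[k]_m) (p : {poly k}) N j : (m <= N)%N -> (j < N)%N ->
  (\sum_(i < m) (v ord0 i)%:P * 'X^(N - i.+1) * p)`_(N - j.+1) = pair v ('X^j * p).
Proof.
move=> mN jN; rewrite coef_sum; apply: eq_bigr => i _.
rewrite -mulrA coefCM; congr (_ * _); rewrite !coefXnM.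
have iN : (i < N)%N by apply: leq_trans mN.
case: (ltnP i j) => ij; first by rewrite ifT //; lia.
by rewrite ifF; [congr (p`_ _); lia | lia].
Qed.

End LaurentPolynomials.

Section PolynomialSections.
Variable k : fieldType.
Local Notation K := {fraction {poly k}}.
Local Notation t := (ratfun_t k).
Local Notation atK p x := ((map_poly (constK k) p).[x]).
Variables (g n : nat) (F : 'rV[k]_(g - 2)) (G : 'rV[k]_g).
Hypothesis ng : (n <= g)%N.

Lemma on_overlapE (x : K) : on_overlap x = dual x 0.
Proof. exact: dualC. Qed.

Lemma etaE : Defs.eta k = dual 0 1.
Proof. exact: dualX. Qed.

Lemma s_inverseE : s_inverse F = dual t (polar_part F).
Proof.
by rewrite /s_inverse !on_overlapE etaE dualM dualD; apply: dual_eq; ring.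
Qed.

Lemma s_inverseV : (s_inverse F)^-1 = dual t^-1 (- polar_part F * t^-1 ^+ 2).
Proof.
apply: mulr1_eq; rewrite s_inverseE dualM -dual1 mulfV ?ratfun_t_neq0 //.
by apply: dual_eq; rewrite // dual_inv_coef // ratfun_t_neq0.
Qed.

Lemma restrict1E f : restrict1 F f =
  dual (atK (f : {poly {poly k}})`_0 t^-1)
    (atK ((f : {poly {poly k}})`_0)^`() t^-1 * (- polar_part F * t^-1 ^+ 2)
     + atK (f : {poly {poly k}})`_1 t^-1 * t^-1 ^+ g.+1).
Proof.
rewrite /restrict1 /chart_eval s_inverseV !horner_dual on_overlapE etaE.
by rewrite !dualM dualD; apply: dual_eq; rewrite !(mulr0, addr0, mulr1) // !exprVn addrC.
Qed.

Lemma restrict2E f : restrict2 f =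
  dual (tofrac ((f : {poly {poly k}})`_0)) (tofrac ((f : {poly {poly k}})`_1)).
Proof.
rewrite /restrict2 /chart_eval on_overlapE etaE !horner_dual.
by rewrite !dualM dualD -!tofrac_horner; apply: dual_eq; ring.
Qed.

Lemma transitionE : transition F n G =
  dual (t ^+ n) (n%:R * t ^+ n.-1 * polar_part F + t ^+ n * polar_part G).
Proof.
rewrite /transition s_inverseE dualXn on_overlapE etaE.
by rewrite -dual1 !dualM dualD dualM; apply: dual_eq; ring.
Qed.

Lemma global_sectionsE x : global_sections F (transition F n G) x <->
  let a := (x.1 : {poly {poly k}})`_0 in let b := (x.1 : {poly {poly k}})`_1 in
  let c := (x.2 : {poly {poly k}})`_0 in let d := (x.2 : {poly {poly k}})`_1 in
  atK a t^-1 * t ^+ n = tofrac c /\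
  atK a t^-1 * (n%:R * t ^+ n.-1 * polar_part F + t ^+ n * polar_part G) +
  (atK a^`() t^-1 * (- polar_part F * t^-1 ^+ 2) + atK b t^-1 * t^-1 ^+ g.+1) * t ^+ n
   = tofrac d.
Proof.
rewrite /global_sections /= restrict1E restrict2E transitionE dualM; split.
  by case/dual_inj.
by case=> -> ->.
Qed.

Lemma size_rev_poly (p : {poly k}) m : (size (rev_poly m p) <= m.+1)%N.
Proof. exact: size_poly. Qed.

Lemma rev_polyK (p : {poly k}) m : (size p <= m.+1)%N -> rev_poly m (rev_poly m p) = p.
Proof.
move=> sp; apply/polyP => i; rewrite !coef_poly !ltnS leq_subr; case: (leqP i m) => im.
  by rewrite subKn.
by rewrite nth_default ?(leq_trans sp im).
Qed.

Lemma tofrac_inj : injective (@tofrac {poly k}).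
Proof. by move=> x y /eqP; rewrite tofrac_eq => /eqP. Qed.

(* [c] is the polynomial with [c(t) = t^n a(1/t)]. *)
Lemma chart_change (a c : {poly k}) : atK a t^-1 * t ^+ n = tofrac c <->
  (size c <= n.+1)%N /\ a = rev_poly n c.
Proof.
split=> [e|[sc ->]]; last by rewrite rev_polyE ?size_rev_poly // rev_polyK.
(* The degree of a is not yet bounded by n, so it is reversed at the safe length N; divisibility by
   'X^(size a) then kills its coefficients above n. *)
pose N := (n + size a)%N.
have sa : (size a <= N.+1)%N by rewrite /N; lia.
have eN : rev_poly N a = 'X^(size a) * c.
  by apply: tofrac_inj; rewrite -rev_polyE // rmorphM rmorphXn /= -e exprD; ring.
have s_a : (size a <= n.+1)%N.
  apply/leq_sizeP => j nj; case: (ltnP j (size a)) => ja; last by rewrite nth_default.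
  have := congr1 (fun p : {poly k} => p`_(N - j)) eN.
  rewrite coef_poly coefXnM ltnS leq_subr subKn; last by rewrite /N; lia.
  by move=> ->; rewrite ifT // /N; lia.
have ce : c = rev_poly n a by apply: tofrac_inj; rewrite -e rev_polyE.
by rewrite ce size_rev_poly rev_polyK.
Qed.

(** The chain rule for c = t^n a(1/t), where a is the reciprocal of c; both sides are linear in c,
    so monomials suffice. *)
Lemma deriv_rev (c : {poly k}) : (size c <= n.+1)%N ->
  tofrac c^`() = n%:R * t ^+ n * t^-1 * atK (rev_poly n c) t^-1
     - t ^+ n * t^-1 ^+ 2 * atK (rev_poly n c)^`() t^-1.
Proof.
move=> sc.
have lin i : (i <= n)%N -> tofrac ('X^i : {poly k})^`() = n%:R * t ^+ n * t^-1 * atK 'X^(n - i) t^-1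
     - t ^+ n * t^-1 ^+ 2 * atK ('X^(n - i))^`() t^-1.
  move=> il; rewrite !derivXn !rmorphMn /= !map_polyXn !rmorphXn /= hornerXn hornerMn hornerXn.
  rewrite -/t; have t0 := ratfun_t_neq0 k.
  case: (ltnP i n) => iln; last first.
    have -> : i = n by lia.
    rewrite subnn mulr0n mulr0 subr0 expr0 mulr1 -mulr_natl.
    by case: (n) => [|n']; [rewrite !mulr0n !mul0r | rewrite exprSr !mulrA mulfK].
  have -> : (n - i = (n - i).-1.+1)%N by lia.
  rewrite /= -[_ *+ i]mulr_natl -[_ *+ _.+1]mulr_natl.
  have -> : t ^+ n = t ^+ i * t ^+ (n - i).-1 * t by rewrite -exprD -exprSr; congr (_ ^+ _); lia.
  have nE : n%:R = i%:R + (n - i).-1.+1%:R :> K by rewrite -natrD; congr _%:R; lia.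
  rewrite nE.
  have -> : i%:R * t ^+ i.-1 = i%:R * t ^+ i * t^-1 :> K.
    by case: (i) => [|i']; [rewrite !mulr0n !mul0r | rewrite exprSr !mulrA mulfK].
  rewrite !exprVn exprS; have tm0 : t ^+ (n - i).-1 != 0 by rewrite expf_neq0.
  move: (t ^+ (n - i).-1) tm0 (t ^+ i) ((n - i).-1.+1%:R : K) (i%:R : K) => x x0 y m l.
  by rewrite [LHS](@deriv_rev_monomial _ l m x y _ x0 t0).
have ec : c = \sum_(i < n.+1) c`_i *: 'X^i.
  rewrite -poly_def; apply/polyP => i; rewrite coef_poly; case: ltnP => // il.
  by rewrite nth_default ?(leq_trans sc il).
have er : rev_poly n c = \sum_(i < n.+1) c`_i *: 'X^(n - i).
  rewrite /rev_poly poly_def (reindex_inj rev_ord_inj) /=; apply: eq_bigr => i _.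
  by rewrite subSS subKn // -ltnS.
rewrite er {1}ec !linear_sum /= !rmorph_sum /= !horner_sum !mulr_sumr -sumrB; apply: eq_bigr => i _.
rewrite !derivZ -!mul_polyC !rmorphM /= !map_polyC !hornerM !hornerC /=.
rewrite lin; last by rewrite -ltnS.
ring.
Qed.

(** The coefficients of t^-1, ..., t^-(g-n) in F c' + G c vanish. Exponents from 0 on can be
    absorbed by d, those up to n-g-1 by b, and only these g-n lie in between. *)
Definition pair_sec (c : {poly k}) :=
  forall j, (j < g - n)%N -> pair F ('X^j * c^`()) + pair G ('X^j * c) = 0.

(** Multiplication by t^N, with N large enough for b, turns the Laurent identity into one of
    polynomials, where coefficients can be compared. *)
Lemma laurentE (b c d : {poly k}) N : (g < N)%N -> (size b <= N - g + n)%N ->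
  (polar_part F * tofrac c^`() + polar_part G * tofrac c
    + atK b t^-1 * (t ^+ n * t^-1 ^+ g.+1) = tofrac d) <->
  ((\sum_(i < g - 2) (F ord0 i)%:P * 'X^(N - i.+1) * c^`())
   + (\sum_(i < g) (G ord0 i)%:P * 'X^(N - i.+1) * c)
   + rev_poly (N - g.+1 + n) b = 'X^N * d).
Proof.
move=> gN sb.
have -> : (polar_part F * tofrac c^`() + polar_part G * tofrac c
    + atK b t^-1 * (t ^+ n * t^-1 ^+ g.+1) = tofrac d) <->
  ((polar_part F * tofrac c^`() + polar_part G * tofrac c
    + atK b t^-1 * (t ^+ n * t^-1 ^+ g.+1)) * t ^+ N = t ^+ N * tofrac d).
  split=> [->|]; first by rewrite mulrC.
  by rewrite mulrC; apply: mulfI; rewrite expf_neq0 // ratfun_t_neq0.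
rewrite !mulrDl !polar_partM //; [|lia|lia].
have -> : atK b t^-1 * (t ^+ n * t^-1 ^+ g.+1) * t ^+ N = tofrac (rev_poly (N - g.+1 + n) b).
  rewrite -rev_polyE; last by lia.
  rewrite -mulrA; congr (_ * _); rewrite -mulrA exprD mulrC; congr (_ * _).
  rewrite -[in t ^+ N](subnK gN) exprD mulrCA -exprMn mulVf ?ratfun_t_neq0 //.
  by rewrite expr1n mulr1.
rewrite -!rmorphD -rmorphXn -rmorphM; split=> [/tofrac_inj //|->//].
Qed.

Lemma laurent_sec (b c d : {poly k}) :
  polar_part F * tofrac c^`() + polar_part G * tofrac c
    + atK b t^-1 * (t ^+ n * t^-1 ^+ g.+1) = tofrac d -> pair_sec c.
Proof.
have gN : (g < g.+1 + size b)%N by lia.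
have sb : (size b <= g.+1 + size b - g + n)%N by lia.
move/(laurentE c d gN sb) => e j jg.
have := congr1 (fun p : {poly k} => p`_((g.+1 + size b) - j.+1)) e.
rewrite /= !coefD !coef_polar; try lia.
rewrite coef_poly coefXnM ifF; last by lia.
by rewrite ifT ?addr0 //; lia.
Qed.

Lemma sec_laurent (c : {poly k}) : pair_sec c ->
  exists b d, polar_part F * tofrac c^`() + polar_part G * tofrac c
    + atK b t^-1 * (t ^+ n * t^-1 ^+ g.+1) = tofrac d.
Proof.
move=> sc.
(* T is t^(g+1) (F c' + G c). Its coefficients up to n give b, those from g+1 on give d, and the gap
   vanishes by hypothesis. *)
pose T := (\sum_(i < g - 2) (F ord0 i)%:P * 'X^(g.+1 - i.+1) * c^`())
   + (\sum_(i < g) (G ord0 i)%:P * 'X^(g.+1 - i.+1) * c).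
have T0 i : (n < i)%N -> (i < g.+1)%N -> T`_i = 0.
  move=> ni ig; have -> : i = (g.+1 - (g - i).+1)%N by lia.
  by rewrite coefD !coef_polar; try lia; apply: sc; lia.
exists (- rev_poly n (take_poly n.+1 T)), (drop_poly g.+1 T).
apply/(@laurentE _ _ _ g.+1) => //.
  by rewrite size_polyN (leq_trans (size_poly _ _)) //; lia.
rewrite subnn add0n -/T.
have -> : rev_poly n (- rev_poly n (take_poly n.+1 T)) = - take_poly n.+1 T.
  rewrite -[in RHS](@rev_polyK (take_poly n.+1 T) n) ?size_take_poly //.
  by apply/polyP => i; rewrite coefN [LHS]coef_poly [in RHS]coef_poly coefN; case: ifP; rewrite ?oppr0.
apply/polyP => i; rewrite coefB coef_take_poly coefXnM coef_drop_poly.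
case: ltnP => ing; case: ltnP => ig; rewrite ?subrr ?subr0 ?subnK //; first by lia.
by apply: T0.
Qed.

(** Since n <= g, the left side has only negative exponents and the right side none. Hence a section
    is determined by its component c. *)
Lemma laurent_kernel (b d : {poly k}) :
  atK b t^-1 * (t ^+ n * t^-1 ^+ g.+1) = tofrac d -> b = 0 /\ d = 0.
Proof.
have gN : (g < g.+1 + size b)%N by lia.
have sb : (size b <= g.+1 + size b - g + n)%N by lia.
move=> e; have := (laurentE 0 d gN sb).1.
rewrite deriv0 !rmorph0 !mulr0 !add0r => /(_ e).
rewrite !big1 ?add0r; try by move=> i _; rewrite mulr0.
move=> e1.
have d0 : d = 0.
  apply/polyP => i; rewrite coef0.
  have := congr1 (fun p : {poly k} => p`_(i + (g.+1 + size b))) e1.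
  rewrite coefXnM ifF ?addnK; last by lia.
  by move <-; rewrite nth_default // (leq_trans (size_poly _ _)) //; lia.
split=> //; rewrite -(@rev_polyK b (g.+1 + size b - g.+1 + n)); last by lia.
by rewrite e1 d0 mulr0; apply/polyP => i; rewrite !coef_poly !coef0 if_same.
Qed.

Definition dep_free (c1 c2 : {poly k}) :=
  forall x y, x *: c1 + y *: c2 = 0 -> x = 0 /\ y = 0.

(** The term n t^(n-1) of the transition function and the term in a' of the change of coordinate
    combine into c', by [deriv_rev]. *)
Lemma section_eq (a b c : {poly k}) : (size c <= n.+1)%N -> a = rev_poly n c ->
  atK a t^-1 * (n%:R * t ^+ n.-1 * polar_part F + t ^+ n * polar_part G) +
  (atK a^`() t^-1 * (- polar_part F * t^-1 ^+ 2) + atK b t^-1 * t^-1 ^+ g.+1) * t ^+ n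
  = polar_part F * tofrac c^`() + polar_part G * tofrac c
    + atK b t^-1 * (t ^+ n * t^-1 ^+ g.+1).
Proof.
move=> sc ea.
have ec : tofrac c = atK a t^-1 * t ^+ n by symmetry; apply/chart_change.
rewrite deriv_rev // -ea ec.
have -> : n%:R * t ^+ n.-1 = n%:R * t ^+ n * t^-1 :> K.
  by case: (n) => [|n']; [rewrite !mulr0n !mul0r | rewrite exprSr !mulrA mulfK ?ratfun_t_neq0].
move: (atK a _) (atK b _) (atK _^`() _) (polar_part F) (polar_part G) => A B A' f h.
move: (t ^+ n) (t^-1 ^+ g.+1) (t^-1) (n%:R : K) => x y z m; ring.
Qed.

Lemma global_sectionsP x : global_sections F (transition F n G) x <->
  let a := (x.1 : {poly {poly k}})`_0 in let b := (x.1 : {poly {poly k}})`_1 in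
  let c := (x.2 : {poly {poly k}})`_0 in let d := (x.2 : {poly {poly k}})`_1 in
  [/\ (size c <= n.+1)%N, a = rev_poly n c &
   polar_part F * tofrac c^`() + polar_part G * tofrac c
    + atK b t^-1 * (t ^+ n * t^-1 ^+ g.+1) = tofrac d].
Proof.
rewrite global_sectionsE; cbv zeta; rewrite chart_change; split.
  by case=> -[sc ea] <-; split=> //; rewrite (section_eq _ sc ea).
by case=> sc ea <-; split=> //; rewrite (section_eq _ sc ea).
Qed.

Lemma chart_combination (l m : k) (f h : chart k) i :
  ((l%:P *: f + m%:P *: h : chart k) : {poly {poly k}})`_i =
  l *: (f : {poly {poly k}})`_i + m *: (h : {poly {poly k}})`_i.
Proof. by rewrite poly_of_qpolyD !poly_of_qpolyZ coefD !coefZ !mul_polyC. Qed.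

Lemma chart_eq0 (f : chart k) :
  (f : {poly {poly k}})`_0 = 0 -> (f : {poly {poly k}})`_1 = 0 -> f = 0.
Proof. by move=> e0 e1; rewrite (dualK f) e0 e1 dual0. Qed.

Lemma W1P : W1 F n G <-> exists c1 c2 : {poly k},
  [/\ (size c1 <= n.+1)%N, (size c2 <= n.+1)%N, pair_sec c1, pair_sec c2 &
      dep_free c1 c2].
Proof.
split.
  case=> x xs xi; pose i0 : 'I_2 := ord0; pose i1 : 'I_2 := lift ord0 ord0.
  pose co i := (((x i).2 : chart k) : {poly {poly k}})`_0.
  have [s0 a0 e0] := (global_sectionsP _).1 (xs i0).
  have [s1 a1 e1] := (global_sectionsP _).1 (xs i1).
  exists (co i0), (co i1); split=> //; try exact: laurent_sec e0; try exact: laurent_sec e1.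
  move=> l m lm0.
  have rev_lin p q : rev_poly n (l *: p + m *: q) = l *: rev_poly n p + m *: rev_poly n q.
    apply/polyP => i; rewrite coefD !coefZ !coef_poly coefD !coefZ.
    by case: ifP => //; rewrite !mulr0 addr0.
  have tz (a : k) (p : {poly k}) : tofrac (a *: p) = constK k a * tofrac p.
    by rewrite -mul_polyC rmorphM.
  have az (a : k) (p : {poly k}) : atK (a *: p) t^-1 = constK k a * atK p t^-1.
    by rewrite -mul_polyC rmorphM /= map_polyC hornerM hornerC.
  (* A relation between the components c extends to the whole sections, because what remains of the
     gluing equation falls under [laurent_kernel]. *)
  have xz : l%:P *: x i0 + m%:P *: x i1 = 0.
    have := congr2 (fun u v => constK k l * u + constK k m * v) e0 e1.
    rewrite -!tz -rmorphD /= => e.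
    have /laurent_kernel [b0 d0] : atK (l *: (((x i0).1 : chart k) : {poly {poly k}})`_1
         + m *: (((x i1).1 : chart k) : {poly {poly k}})`_1) t^-1
       * (t ^+ n * t^-1 ^+ g.+1) = tofrac (l *: (((x i0).2 : chart k) : {poly {poly k}})`_1
         + m *: (((x i1).2 : chart k) : {poly {poly k}})`_1).
      rewrite -e rmorphD hornerD !az.
      have e2 : polar_part F * (constK k l * tofrac (co i0)^`() + constK k m * tofrac (co i1)^`())
         + polar_part G * (constK k l * tofrac (co i0) + constK k m * tofrac (co i1)) = 0.
        by rewrite -!tz -!rmorphD -!derivZ -derivD lm0 deriv0 rmorph0 !mulr0 addr0.
      rewrite -[LHS]add0r -e2 /co; ring.
    have eC : (x i0).1 = (x i0).1 :> chart k by [].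
    apply/eqP; rewrite -pair_eqE /pair_eq /=; apply/andP; split; apply/eqP/chart_eq0;
      rewrite chart_combination //.
    by rewrite a0 a1 -rev_lin [_ + _]lm0; apply/polyP => i; rewrite coef_poly !coef0 if_same.
  have := xi (fun i => if i == i0 then l else m).
  rewrite big_ord_recl big_ord1 /= => /(_ xz) h.
  by split; [exact: (h i0)|exact: (h i1)].
case=> c1 [c2 [s1 s2 p1 p2 fr]].
have [b1 [d1 e1]] := sec_laurent p1; have [b2 [d2 e2]] := sec_laurent p2.
pose mk c b d : chart k * chart k := (dual (rev_poly n c) b, dual c d).
exists (fun i : 'I_2 => if i == ord0 then mk c1 b1 d1 else mk c2 b2 d2).
  by move=> i; case: ifP => _; apply/global_sectionsP; rewrite /= !dual_coef0 !dual_coef1.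
move=> c; rewrite big_ord_recl big_ord1 /= => h.
have h2 : (c ord0)%:P *: dual c1 d1 + (c (lift ord0 ord0))%:P *: dual c2 d2 = 0 :> chart k
  := congr1 snd h.
have := congr1 (fun u : chart k => (u : {poly {poly k}})`_0) h2.
rewrite chart_combination !dual_coef0 coef0 => /fr [c0 c1'].
by case=> -[|[|i]] il //; [rewrite -[RHS]c0 | rewrite -[RHS]c1']; congr c; apply: val_inj.
Qed.

End PolynomialSections.

(** * Growth and chains of irreducible closed sets *)

Lemma leq_expl m n e : (m <= n)%N -> (m ^ e <= n ^ e)%N.
Proof. by move=> mn; case: e => // e; rewrite leq_exp2r. Qed.

Section MpolyFacts.
Variable k : fieldType.

Lemma msize_mul n (p q : {mpoly k[n]}) a b :
  (msize p <= a.+1)%N -> (msize q <= b.+1)%N -> (msize (p * q) <= (a + b).+1)%N.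
Proof.
have [->|p0] := eqVneq p 0; first by rewrite mul0r msize0.
have [->|q0] := eqVneq q 0; first by rewrite mulr0 msize0.
move=> sp sq; rewrite msizeM_proper ?mulf_neq0 ?mleadc_eq0 //; lia.
Qed.

Lemma msize_exp n (p : {mpoly k[n]}) e d :
  (msize p <= d.+1)%N -> (msize (p ^+ e) <= (d * e).+1)%N.
Proof.
move=> sp; elim: e => [|e IH]; first by rewrite expr0 msize1 muln0.
by rewrite exprS mulnS msize_mul.
Qed.

Lemma msize_sum_bound n (I : Type) (r : seq I) (P : pred I) (f : I -> {mpoly k[n]}) d :
  (forall i, P i -> (msize (f i) <= d)%N) -> (msize (\sum_(i <- r | P i) f i) <= d)%N.
Proof.
move=> h; apply: (big_ind (fun p : {mpoly k[n]} => msize p <= d)%N) => //.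
  by rewrite msize0.
by move=> p q sp sq; rewrite (leq_trans (msizeD_le _ _)) // geq_max sp sq.
Qed.

(* [homogenize f psi delta D = delta^D f(psi/delta)] for [D >= deg f]. *)
Definition homogenize N M (psi : 'I_N -> {mpoly k[M]}) (delta : {mpoly k[M]}) D
    (f : {mpoly k[N]}) : {mpoly k[M]} :=
  \sum_(m <- msupp f) f@_m *: (delta ^+ (D - mdeg m) * \prod_i psi i ^+ m i).

Lemma homogenizeE N M (psi : 'I_N -> {mpoly k[M]}) delta D f (x : 'I_N -> k) y :
  (msize f <= D.+1)%N -> (forall i, x i * delta.@[y] = (psi i).@[y]) ->
  (homogenize psi delta D f).@[y] = delta.@[y] ^+ D * f.@[x].
Proof.
move=> sf e; rewrite [f.@[x]]mevalE mulr_sumr /homogenize rmorph_sum /=.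
apply: eq_big_seq => m mf; rewrite mevalZ mevalM rmorphXn rmorph_prod /=.
under eq_bigr do rewrite rmorphXn /= -e exprMn.
rewrite big_split /= prodrXr -mdegE.
have mD : (mdeg m <= D)%N by have := msize_mdeg_lt mf; lia.
rewrite -[in X in _ = X](subnK mD) exprD; ring.
Qed.

Lemma msize_homogenize N M (psi : 'I_N -> {mpoly k[M]}) delta D f E :
  (msize f <= D.+1)%N -> (msize delta <= E.+1)%N -> (forall i, msize (psi i) <= E.+1)%N ->
  (msize (homogenize psi delta D f) <= (D * E).+1)%N.
Proof.
move=> sf sd sp; rewrite /homogenize big_seq; apply: msize_sum_bound => m mf.
rewrite (leq_trans (msizeZ_le _ _)) //.
have mD : (mdeg m <= D)%N by have := msize_mdeg_lt mf; lia.
rewrite -{2}(subnK mD) mulnDl; apply: msize_mul; first by rewrite mulnC msize_exp.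
rewrite mdegE big_distrl /=.
elim/big_ind2: _ => [|p a q b|i _]; first by rewrite msize1.
  exact: msize_mul.
by rewrite mulnC msize_exp.
Qed.

End MpolyFacts.

Section Growth.
Variable k : fieldType.

(* The functions on [S] that are polynomials of degree at most [D] in the coordinates [X]
   span a space of dimension [O(D^d)]. *)
Definition growth (T : Type) (S : set T) N (X : T -> 'I_N -> k) (d : nat) :=
  exists C : nat, forall D : nat, exists (I : finType) (phi : I -> T -> k),
    (#|I| <= C * D.+1 ^ d)%N /\
    forall f : {mpoly k[N]}, (msize f <= D.+1)%N ->
      exists c : I -> k, forall p, S p -> f.@[X p] = \sum_i c i * phi i p.

Lemma growth_mono (T : Type) (S : set T) N (X : T -> 'I_N -> k) d e :
  (d <= e)%N -> growth S X d -> growth S X e.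
Proof.
move=> de [C h]; exists C => D; have [I [phi [cI hI]]] := h D.
exists I, phi; split=> //; apply: leq_trans cI _; rewrite leq_mul2l.
by rewrite leq_pexp2l ?orbT.
Qed.

(** Along a rational map of degree E with denominator [delta], a function of degree D pulls back to
    one of degree D E divided by [delta]^D; this only multiplies the constant by (E+1)^d. *)
Lemma growth_image (T1 T2 : Type) (S1 : set T1) (S2 : set T2) N M
    (X1 : T1 -> 'I_N -> k) (X2 : T2 -> 'I_M -> k)
    (psi : 'I_N -> {mpoly k[M]}) (delta : {mpoly k[M]}) d :
  (forall p, S1 p -> exists2 q, S2 q & delta.@[X2 q] != 0 /\
      forall i, X1 p i * delta.@[X2 q] = (psi i).@[X2 q]) ->
  growth S2 X2 d -> growth S1 X1 d.
Proof.
move=> img [C h].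
have [q qP] : exists q : T1 -> T1 -> T2 -> Prop, True by exists (fun _ _ _ => True).
case: (pselect (exists t : T1, S1 t)) => [[t0 St0]|S0]; last first.
  exists 0%N => D; exists 'I_0, (fun _ _ => 0); split; first by rewrite card_ord.
  by move=> f _; exists (fun=> 0) => p Sp; case: S0; exists p.
have [q0 _ _] := img _ St0.
have {img} /choice [q1 img] : forall p, exists q, S1 p -> [/\ S2 q, delta.@[X2 q] != 0 &
      forall i, X1 p i * delta.@[X2 q] = (psi i).@[X2 q]].
  move=> p; case: (pselect (S1 p)) => [/img [q' Sq [dq eq]]|nS]; last by exists q0.
  by exists q'.
pose E := maxn (msize delta) (\max_i msize (psi i)).
have sd : (msize delta <= E.+1)%N by rewrite /E; lia.
have sp i : (msize (psi i) <= E.+1)%N.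
  by have := leq_bigmax (F := fun i => msize (psi i)) i; rewrite /E; lia.
exists (C * E.+1 ^ d)%N => D; have [I [phi [cI hI]]] := h (D * E)%N.
exists I, (fun i p => phi i (q1 p) / delta.@[X2 (q1 p)] ^+ D); split.
  apply: leq_trans cI _; rewrite -mulnA leq_mul2l -expnMn leq_expl ?orbT //.
  by rewrite mulSn mulnS; lia.
move=> f sf; have [c hc] := hI _ (msize_homogenize sf sd sp).
exists c => p Sp; have [Sq dq eq] := img p Sp.
have dq0 : delta.@[X2 (q1 p)] ^+ D != 0 by rewrite expf_neq0.
apply: (mulfI dq0); rewrite -(homogenizeE sf eq) hc // mulr_sumr.
apply: eq_bigr => i _; move: (delta.@[_] ^+ D) dq0 => w w0; by field.
Qed.

(** The spanning functions may be arbitrary, not just polynomial, so each family can be cut off to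
    its own piece of a disjoint decomposition and the families put side by side. *)
Lemma growth_bigcup (T : Type) (J : finType) (S : J -> set T) N (X : T -> 'I_N -> k) d :
  (forall j, growth (S j) X d) -> growth [set p | exists j, S j p] X d.
Proof.
move=> gS; have [C h] := choice gS; exists (\sum_j C j)%N => D.
have hI0 j : exists Iphi : {I : finType & I -> T -> k},
    (#|tag Iphi| <= C j * D.+1 ^ d)%N /\
    forall f : {mpoly k[N]}, (msize f <= D.+1)%N ->
      exists c : tag Iphi -> k, forall p, S j p -> f.@[X p] = \sum_i c i * tagged Iphi i p.
  by have [I [phi hphi]] := h j D; exists (existT (fun I : finType => I -> T -> k) I phi).
pose I j := tag (projT1 (cid (hI0 j))); pose phi j : I j -> T -> k := tagged (projT1 (cid (hI0 j))).
have hI j := projT2 (cid (hI0 j)); rewrite -/(I _) -/(phi _) in hI.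
(* Disjointness: a point is assigned to the first member that contains it. *)
pose first p j := S j p /\ forall j', S j' p -> (enum_rank j <= enum_rank j')%N.
have ex1 p : (exists j, S j p) -> exists j, first p j.
  case=> j Sj; have Pj : `[< S j p >] by apply/asboolP.
  have [j0 /asboolP Sj0 mn] := @arg_minnP _ j (fun j => `[< S j p >]) (fun j => enum_rank j : nat) Pj.
  by exists j0; split=> // j' Sj'; apply: mn; apply/asboolP.
have uniq1 p j j' : first p j -> first p j' -> j = j'.
  case=> Sj mj [Sj' mj']; apply: enum_rank_inj; apply: val_inj; apply/eqP.
  by rewrite eqn_leq mj // mj'.
exists {j : J & I j}, (fun ji p => if `[< first p (tag ji) >] then phi (tag ji) (tagged ji) p else 0).
split.
  rewrite card_tagged sumnE big_map big_distrl /= [X in (X <= _)%N](_ : _ = \sum_j #|I j|)%N.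
    by apply: leq_sum => j _; have [] := hI j.
  by rewrite -[RHS]big_enum.
move=> f sf.
have hc0 j : exists c : I j -> k, forall p, S j p -> f.@[X p] = \sum_i c i * phi j i p.
  by have [_ H] := hI j; apply: H.
pose c j := projT1 (cid (hc0 j)); have hc j : forall p, S j p -> f.@[X p] = \sum_i c j i * phi j i p
  := projT2 (cid (hc0 j)).
exists (fun ji => c (tag ji) (tagged ji)) => p /ex1 [j [Sj mj]].
rewrite (hc j p Sj).
rewrite -(sig_big_dep (I := J) (J := I) xpredT (fun _ => xpredT)
  (fun j i => c j i * (if `[< first p j >] then phi j i p else 0))) /=.
rewrite (bigD1 j) //= [X in _ + X]big1 ?addr0.
  by apply: eq_bigr => i _; rewrite ifT //; apply/asboolP.
move=> j' j'j; apply: big1 => i _; rewrite ifF ?mulr0 //; apply/negbTE/asboolP => fj'.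
by move/eqP: j'j; apply; apply: (@uniq1 p).
Qed.

End Growth.

(** * Growth of hypersurfaces and finite covers, and the bound on chains *)

Section ChainsAndGrowth.
Variable k : fieldType.

Definition spans (T : Type) (S : set T) (I : finType) (phi : I -> T -> k) (u : T -> k) :=
  exists c : I -> k, forall p, S p -> u p = \sum_i c i * phi i p.

Lemma spans_sum (T : Type) (S : set T) (I : finType) (phi : I -> T -> k)
   (J : eqType) (r : seq J) (a : J -> k) (u : J -> T -> k) :
  (forall j, j \in r -> spans S phi (u j)) ->
  spans S phi (fun p => \sum_(j <- r) a j * u j p).
Proof.
elim: r => [|j r IH] h.
  by exists (fun=> 0) => p _; rewrite big_nil big1 // => i _; rewrite mul0r.
have [c1 h1] := h j (mem_head _ _).
have [|c2 h2] := IH; first by move=> j' j'r; apply: h; rewrite in_cons j'r orbT.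
exists (fun i => a j * c1 i + c2 i) => p Sp.
rewrite big_cons h1 // h2 // mulr_sumr -big_split; apply: eq_bigr => i _ /=; ring.
Qed.

Lemma growth_spans (T : Type) (S : set T) N (X : T -> 'I_N -> k) d C :
  (forall D, exists (I : finType) (phi : I -> T -> k),
    (#|I| <= C * D.+1 ^ d)%N /\
    forall m : 'X_{1..N}, (mdeg m <= D)%N -> spans S phi (fun p => \prod_i X p i ^+ m i)) ->
  growth S X d.
Proof.
move=> h; exists C => D; have [I [phi [cI hI]]] := h D; exists I, phi; split=> // f sf.
have [|c hc] := @spans_sum _ S I phi _ (msupp f) (fun m => f@_m) (fun m p => \prod_i X p i ^+ m i).
  by move=> m mf; apply: hI; have := msize_mdeg_lt mf; lia.
by exists c => p Sp; rewrite -hc // mevalE.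
Qed.

Lemma mdeg_le N (m : 'X_{1..N}) i : (m i <= mdeg m)%N.
Proof. by rewrite mdegE (bigD1 i) //= leq_addr. Qed.

Lemma growth_full (T : Type) (S : set T) N (X : T -> 'I_N -> k) : growth S X N.
Proof.
apply: (@growth_spans _ _ _ _ _ 1) => D.
exists {ffun 'I_N -> 'I_D.+1}, (fun (e : {ffun 'I_N -> 'I_D.+1}) p => \prod_i X p i ^+ e i); split.
  by rewrite card_ffun !card_ord mul1n.
move=> m mD; exists (fun e : {ffun 'I_N -> 'I_D.+1} => (e == [ffun i => inord (m i)])%:R) => p _.
rewrite (bigD1 [ffun i => inord (m i)]) //= eqxx mul1r [X in _ + X]big1 ?addr0.
  apply: eq_bigr => i _; rewrite ffunE inordK // ltnS (leq_trans (mdeg_le _ _)) //.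
by move=> e /negbTE ->; rewrite mul0r.
Qed.

(** A monomial divisible by the leading monomial [tau] of q is rewritten by q = 0 into smaller ones,
    without raising the degree since the order refines it. The other monomials have an exponent
    below that of [tau], so bounded independently of D, and N exponents at most D. *)
Lemma growth_hypersurface (T : Type) (S : set T) N (X : T -> 'I_N.+1 -> k) (q : {mpoly k[N.+1]}) :
  q != 0 -> (forall p, S p -> q.@[X p] = 0) -> growth S X N.
Proof.
move=> q0 Sq; pose tau := mlead q.
pose tm := (mdeg tau).+1.
apply: (@growth_spans _ _ _ _ _ (N.+1 * tm)%N) => D.
exists ('I_N.+1 * 'I_tm * {ffun 'I_N -> 'I_D.+1})%type.
exists (fun (e : 'I_N.+1 * 'I_tm * {ffun 'I_N -> 'I_D.+1}) p =>
    X p e.1.1 ^+ e.1.2 * \prod_j X p (lift e.1.1 j) ^+ e.2 j); split.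
  by rewrite !card_prod card_ffun !card_ord.
move=> m; elim/(well_founded_induction (@ltom_wf N.+1)): m => m IH mD.
case: (boolP [forall i, tau i <= m i]%N) => [/forallP le|]; last first.
  rewrite negb_forall => /existsP [i]; rewrite -ltnNge => mi.
  have itm : (m i < tm)%N by rewrite ltnS (leq_trans (ltnW mi)) // mdeg_le.
  pose e : 'I_N.+1 * 'I_tm * {ffun 'I_N -> 'I_D.+1} :=
    (i, Ordinal itm, [ffun j => inord (m (lift i j))]).
  exists (fun e' => (e' == e)%:R) => p _.
  rewrite (bigD1 e) //= eqxx mul1r [X in _ + X]big1 ?addr0; last by move=> e' /negbTE ->; rewrite mul0r.
  rewrite (bigD1_ord i) //=; congr (_ * _); apply: eq_bigr => j _.
  by rewrite ffunE inordK // ltnS (leq_trans (mdeg_le _ _)).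
pose m' : 'X_{1..N.+1} := (m - tau)%MM.
have em : m = (m' + tau)%MM.
  by apply/mnmP => i; rewrite mnmDE mnmBE subnK //; exact: le.
have tq : tau \in msupp q by apply: mlead_supp.
have lc : q@_tau != 0 by rewrite mleadc_eq0.
have [|c hc] := @spans_sum _ S _ (fun (e : 'I_N.+1 * 'I_tm * {ffun 'I_N -> 'I_D.+1}) p =>
    X p e.1.1 ^+ e.1.2 * \prod_j X p (lift e.1.1 j) ^+ e.2 j)
   _ (rem tau (msupp q)) (fun m1 => - (q@_m1 / q@_tau)) (fun m1 p => \prod_i X p i ^+ (m' + m1)%MM i).
  move=> m1; rewrite mem_rem_uniq ?msupp_uniq // inE => /andP[nm1 m1q].
  have lt1 : (m1 < tau)%O by rewrite Order.POrderTheory.lt_neqAle nm1 /= msupp_le_mlead.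
  apply: IH; first by rewrite em ltmc_add2r.
  rewrite (leq_trans _ mD) // em !mdegD leq_add2l.
  by apply: lemc_mdeg; apply: Order.POrderTheory.ltW.
exists c => p Sp; rewrite -hc //=.
have := Sq p Sp; rewrite mevalE (perm_big _ (perm_to_rem tq)) big_cons /= => e.
have spl m1 : \prod_i X p i ^+ (m' + m1)%MM i = \prod_i X p i ^+ m' i * \prod_i X p i ^+ m1 i.
  by rewrite -big_split; apply: eq_bigr => i _; rewrite mnmDE exprD.
rewrite em spl; under [RHS]eq_bigr do rewrite spl.
have -> : \prod_i X p i ^+ tau i = - (\sum_(m1 <- rem tau (msupp q)) q@_m1 * \prod_i X p i ^+ m1 i) / q@_tau.
  by apply: (mulfI lc); rewrite [RHS]mulrC divfK //; apply/eqP; rewrite -addr_eq0; apply/eqP.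
rewrite mulNr mulrN mulr_suml mulr_sumr -sumrN; apply: eq_bigr => m1 _.
by field.
Qed.

Definition msubst M M' (v : 'I_M' -> {mpoly k[M]}) (a : {mpoly k[M']}) : {mpoly k[M]} :=
  mmap (@mpolyC M k) v a.

HB.instance Definition _ M M' (v : 'I_M' -> {mpoly k[M]}) :=
  GRing.RMorphism.copy (msubst v) (mmap (@mpolyC M k) v).

Lemma msubstE M M' (v : 'I_M' -> {mpoly k[M]}) a x :
  (msubst v a).@[x] = a.@[fun j => (v j).@[x]].
Proof.
rewrite /msubst /mmap rmorph_sum /= [RHS]mevalE; apply: eq_bigr => m _.
rewrite mevalM mevalC rmorph_prod /=; congr (_ * _).
by apply: eq_bigr => i _; rewrite rmorphXn.
Qed.

(* [k[x]] is a finite module over [k[v]], with control of degrees. *)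
Definition finite_over M M' (v : 'I_M' -> {mpoly k[M]}) :=
  exists (J : finType) (B : J -> {mpoly k[M]}) (C : nat),
  forall D (f : {mpoly k[M]}), (msize f <= D.+1)%N ->
  exists a : J -> {mpoly k[M']}, (forall j, msize (a j) <= (C * D).+1)%N /\
    f = \sum_j msubst v (a j) * B j.

(** Each f is a combination of the module generators with coefficients of degree at most C D in v,
    so the products of the given spanning functions with the generators span. *)
Lemma growth_finite (T : Type) (S : set T) M M' (v : 'I_M' -> {mpoly k[M]})
   (X : T -> 'I_M -> k) d : finite_over v ->
  growth S (fun p j => (v j).@[X p]) d -> growth S X d.
Proof.
move=> [J [B [C fin]]] [C' gr]; exists (#|J| * (C' * C.+1 ^ d))%N => D.
have [I [phi [cI hI]]] := gr (C * D)%N.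
exists (J * I)%type, (fun ji p => phi ji.2 p * (B ji.1).@[X p]); split.
  rewrite card_prod -mulnA leq_mul2l -mulnA -expnMn (leq_trans cI) ?orbT //.
  by rewrite leq_mul2l leq_expl ?orbT // mulSn mulnS; lia.
move=> f sf; have [a [sa ->]] := fin D f sf.
have hc0 j : exists c : I -> k, forall p, S p ->
  (a j).@[fun j => (v j).@[X p]] = \sum_i c i * phi i p by apply: hI.
have [c hc] := choice hc0.
exists (fun ji => c ji.1 ji.2) => p Sp.
rewrite rmorph_sum /= -(pair_big xpredT xpredT (fun j i => c j i * (phi i p * (B j).@[X p]))) /=.
apply: eq_bigr => j _; rewrite mevalM msubstE hc // mulr_suml.
by apply: eq_bigr => i _; rewrite mulrA.
Qed.

Definition indep N (S : set 'rV[k]_N) (I : finType) (p : I -> {mpoly k[N]}) :=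
  forall c : I -> k, (forall x : 'rV_N, S x -> \sum_i c i * (p i).@[x ord0] = 0) ->
  forall i, c i = 0.

Lemma indep_card N (S : set 'rV[k]_N) (I J : finType) (p : I -> {mpoly k[N]}) (phi : J -> 'rV_N -> k) :
  indep S p -> (forall i, spans S phi (fun x => (p i).@[x ord0])) -> (#|I| <= #|J|)%N.
Proof.
move=> ind /choice [c hc]; rewrite leqNgt; apply/negP => lt.
pose A := \matrix_(i < #|I|, j < #|J|) c (enum_val i) (enum_val j).
have : kermx A != 0.
  rewrite -mxrank_eq0 mxrank_ker subn_eq0 -ltnNge.
  by rewrite (leq_ltn_trans (rank_leq_col _)).
case/rowV0Pn => u /sub_kermxP uA; apply/negP; rewrite negbK; apply/eqP/rowP => i.
rewrite mxE -[i]enum_valK; move: (enum_val i) => {}i.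
apply: (ind (fun i => u ord0 (enum_rank i))) => x Sx.
under eq_bigr do rewrite hc // mulr_sumr.
rewrite exchange_big big1 //= => j _.
have := congr1 (fun w : 'rV_#|J| => w ord0 (enum_rank j)) uA.
rewrite !mxE => e; under eq_bigr do rewrite mulrA.
rewrite -mulr_suml [X in X * _](_ : _ = 0) ?mul0r // -[RHS]e.
rewrite [RHS](reindex (@enum_rank I)) /=; last exact: onW_bij (@enum_rank_bij I).
by apply: eq_bigr => i' _; rewrite mxE !enum_rankK.
Qed.

(** Irreducible sets are used through this property and its converse below: the polynomial functions
    on them form a domain. *)
Lemma irreducible_integral N (Y : set 'rV[k]_N) (f h : {mpoly k[N]}) :
  zariski_irreducible Y -> (forall x, Y x -> (f * h).@[x ord0] = 0) ->
  (forall x, Y x -> f.@[x ord0] = 0) \/ (forall x, Y x -> h.@[x ord0] = 0).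
Proof.
move=> [_ irr] e.
pose V (q : {mpoly k[N]}) : set 'rV[k]_N := [set x | q.@[x ord0] = 0].
have Vc q : zariski_closed (V q).
  exists [set q]; rewrite /V; apply/seteqP; split=> x /=; first by move=> qx ? ->.
  by apply.
have [] := irr (V f) (V h) (Vc f) (Vc h); [|by left|by right].
move=> x Yx; have := e x Yx; rewrite mevalM => /eqP; rewrite mulf_eq0.
by case/orP => /eqP; [left|right].
Qed.

Lemma integral_irreducible N (Y : set 'rV[k]_N) : Y !=set0 ->
  (forall f h : {mpoly k[N]}, (forall x, Y x -> (f * h).@[x ord0] = 0) ->
    (forall x, Y x -> f.@[x ord0] = 0) \/ (forall x, Y x -> h.@[x ord0] = 0)) ->
  zariski_irreducible Y.
Proof.
move=> Y0 h; split=> // A B [SA ->] [SB ->] YAB.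
apply: contrapT => /not_orP[/existsNP [a /not_implyP[Ya nA]] /existsNP [b /not_implyP[Yb nB]]].
move: nA => /= /existsNP[f /not_implyP[Sf fa]]; move: nB => /= /existsNP[q /not_implyP[Sq qb]].
have [x Yx|h1|h1] := h f q; last 2 first.
- by apply: fa; exact: h1.
- by apply: qb; exact: h1.
by rewrite mevalM; case: (YAB x Yx) => [/(_ f Sf) ->|/(_ q Sq) ->]; rewrite ?mul0r ?mulr0.
Qed.

(** In a relation on Y, restriction to X, where q vanishes, leaves the terms free of q and kills
    their coefficients. The rest is divisible by q, which cancels on the irreducible Y. *)
Lemma indep_powers N (X Y : set 'rV[k]_N) (q : {mpoly k[N]}) (I : finType) (p : I -> {mpoly k[N]}) :
  X `<=` Y -> zariski_irreducible Y -> (forall x, X x -> q.@[x ord0] = 0) ->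
  ~ (forall x, Y x -> q.@[x ord0] = 0) -> indep X p ->
  forall E, indep Y (fun ij : I * 'I_E => p ij.1 * q ^+ ij.2).
Proof.
move=> XY Yirr qX qY ind E.
suff h : forall c : I -> nat -> k,
   (forall x, Y x -> \sum_i \sum_(j < E) c i j * (p i * q ^+ j).@[x ord0] = 0) ->
   forall i j, (j < E)%N -> c i j = 0.
  move=> c hc [i j].
  have := h (fun i j => if insub j is Some o then c (i, o) else 0) _ i j (ltn_ord j).
  rewrite valK; apply=> x Yx; rewrite -[RHS](hc x Yx).
  rewrite [RHS](eq_bigr (fun ij : I * 'I_E => c (ij.1, ij.2) * (p ij.1 * q ^+ ij.2).@[x ord0])); last by case.
  rewrite -(pair_big xpredT xpredT (fun i j => c (i, j) * (p i * q ^+ (j : 'I_E)).@[x ord0])) /=.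
  by apply: eq_bigr => i' _; apply: eq_bigr => j' _; rewrite valK.
elim: E => [|E IH] c hc i j //.
have c0 : forall i, c i 0%N = 0.
  apply: (ind (fun i => c i 0%N)) => x Xx; rewrite -[RHS](hc x (XY _ Xx)).
  apply: eq_bigr => i' _; rewrite big_ord_recl expr0 mulr1 big1 ?addr0 // => j' _.
  by rewrite mevalM rmorphXn /= qX // exprS mul0r !mulr0.
case: j => [|j] jE; first exact: c0.
apply: (IH (fun i j => c i j.+1)) => //.
have [|//|h2] := @irreducible_integral _ _ q (\sum_i \sum_(j < E) c i j.+1 *: (p i * q ^+ j)) Yirr.
  move=> x Yx; rewrite -[RHS](hc x Yx) mulr_sumr rmorph_sum /=; apply: eq_bigr => i' _.
  rewrite big_ord_recl c0 mul0r add0r mulr_sumr rmorph_sum /=; apply: eq_bigr => j' _.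
  by rewrite -scalerAr mevalZ /bump leq0n add1n exprS mulrCA.
move=> x /h2; rewrite rmorph_sum /= => e; rewrite -[RHS]e; apply: eq_bigr => i' _.
by rewrite rmorph_sum /=; apply: eq_bigr => j' _; rewrite mevalZ.
Qed.

(** Each step of the chain supplies a function q vanishing on the smaller member only; its powers
    below E multiply the number of independent functions by E and add O(E) to their degree. *)
Lemma chain_indep N (W : set 'rV[k]_N) e C : irreducible_chain W e C ->
  exists K, forall E, exists (I : finType) (p : I -> {mpoly k[N]}),
   [/\ #|I| = (E ^ e)%N, forall i, (msize (p i) <= (E * K).+1)%N & indep (C e) p].
Proof.
elim: e => [|e IH] [irr sub].
  exists 0%N => E; exists unit, (fun=> 1); split=> //; first by rewrite card_unit expn0.
    by move=> _; rewrite msize1.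
  move=> c hc []; have [_ [[x Cx] _]] := irr 0%N (leqnn _).
  by have := hc x Cx; rewrite (big_pred1 tt) ?meval1 ?mulr1 //; case.
have [|K hK] := IH; first by split=> i ie; [apply: irr|apply: sub]; lia.
have [[A [SA eA] eC] _] := irr e (leqnSn e); have [[A' _ eC'] irrY] := irr e.+1 (leqnn _).
have [sXY nYX] := sub e (ltnSn e).
have [y /not_implyP[Yy nXy]] : exists y, ~ (C e.+1 y -> C e y) by apply/existsNP.
have Wy : W y by move: Yy; rewrite eC' => -[].
have [q [Sq qy]] : exists q, SA q /\ q.@[y ord0] <> 0.
  apply: contrapT => nq; apply: nXy; rewrite eC eA; split=> // q Sq /=.
  by apply: contrapT => qy; apply: nq; exists q.
exists (K + msize q)%N => E; have [I [p [cI sp ind]]] := hK E.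
exists (I * 'I_E)%type, (fun ij : I * 'I_E => p ij.1 * q ^+ ij.2); split.
- by rewrite card_prod cI card_ord -expnSr.
- case=> i j /=; rewrite mulnDr; apply: msize_mul; first exact: sp.
  apply: leq_trans (msize_exp (d := msize q) _ _) _; first by lia.
  by rewrite ltnS mulnC leq_mul2r ltnW ?orbT.
- apply: indep_powers ind _ => //; last by move/(_ y Yy).
  by move=> x; rewrite eC eA => -[_ /(_ q Sq)].
Qed.

Lemma chain_length N (W : set 'rV[k]_N) d e C :
  growth W (fun x : 'rV_N => x ord0) d -> irreducible_chain W e C -> (e <= d)%N.
Proof.
move=> [A gr] ch; have [K hK] := chain_indep ch; rewrite leqNgt; apply/negP => de.
have Ce : C e `<=` W by have [[B _ ->] _] := ch.1 e (leqnn e); case=> x [].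
(* Chosen so that A (E K + 1)^d <= A (K + 1)^d E^d < E^(d+1). *)
pose E := (A * K.+1 ^ d).+1.
have [I [p [cI sp ind]]] := hK E; have [J [phi [cJ hJ]]] := gr (E * K)%N.
have := @indep_card _ _ I J p phi ind.
have h : forall i, spans (C e) phi (fun x : 'rV_N => (p i).@[x ord0]).
  by move=> i; have [c hc] := hJ (p i) (sp i); exists c => x /Ce Wx; exact: hc.
move=> /(_ h); rewrite cI => cIJ.
have h1 : (E ^ d.+1 <= E ^ e)%N by rewrite leq_pexp2l.
have h2 : (A * (E * K).+1 ^ d <= A * K.+1 ^ d * E ^ d)%N.
  by rewrite -mulnA -expnMn leq_mul2l leq_expl ?orbT // /E mulSn mulnS; lia.
have : (E ^ d.+1 <= A * K.+1 ^ d * E ^ d)%N.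
  by apply: leq_trans h1 (leq_trans cIJ (leq_trans cJ h2)).
by rewrite expnS leq_mul2r expn_eq0 /= ltnn.
Qed.

End ChainsAndGrowth.

(** * Ideals avoiding a multiplicative set *)

Section IntegralRing.
Variables (D : comNzRingType).
Hypothesis ax : GRing.integral_domain_axiom D.

(** The structure [idomainType] includes units and inverses; on a quotient by a prime ideal they are
    chosen classically. *)
Definition integral_unit : {pred D} := fun x => `[< exists y, y * x = 1 >].
Definition integral_inv (x : D) : D :=
  if pselect (exists y, y * x = 1) is left h then projT1 (cid h) else x.

Lemma integral_mulVx : {in integral_unit, left_inverse 1 integral_inv *%R}.
Proof.
move=> x /asboolP h; rewrite /integral_inv; case: pselect => // h'.
exact: projT2 (cid h').
Qed.

Lemma integral_unitPl x y : y * x = 1 -> integral_unit x.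
Proof. by move=> e; apply/asboolP; exists y. Qed.

Lemma integral_inv_out : {in [predC integral_unit], integral_inv =1 id}.
Proof.
move=> x /negP nh; rewrite /integral_inv; case: pselect => // h.
by case: nh; apply/asboolP.
Qed.

Definition integral_ring & GRing.integral_domain_axiom D : Type := D.
Local Notation E := (integral_ring ax).
HB.instance Definition _ := GRing.ComNzRing.on E.
HB.instance Definition _ := GRing.ComNzRing_hasMulInverse.Build E
  integral_mulVx integral_unitPl integral_inv_out.
HB.instance Definition _ := GRing.ComUnitRing_isIntegral.Build E ax.
Definition integral_domain : idomainType := E.
End IntegralRing.

Section Ideals.
Local Open Scope quotient_scope.
Local Open Scope ring_scope.
Variable R : comNzRingType.

Definition is_ideal (I : set R) :=
  I 0 /\ forall a x y, I x -> I y -> I (a * x + y).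

Lemma ideal_mul I a x : is_ideal I -> I x -> I (a * x).
Proof. by move=> [I0 h] Ix; rewrite -[_ * _]addr0; apply: h. Qed.

Lemma ideal_add I x y : is_ideal I -> I x -> I y -> I (x + y).
Proof. by move=> [I0 h] Ix Iy; rewrite -[x]mul1r; apply: h. Qed.

Lemma ideal_sum I (J : Type) (r : seq J) (P : pred J) (f : J -> R) : is_ideal I ->
  (forall j, P j -> I (f j)) -> I (\sum_(j <- r | P j) f j).
Proof.
by move=> [I0 h] If; apply: big_ind => // x y Ix Iy; apply: ideal_add.
Qed.

Definition ideal_adjoin (I : set R) (f : R) : set R :=
  [set x | exists i r, I i /\ x = i + r * f].

Lemma ideal_adjoinP I f : is_ideal I -> is_ideal (ideal_adjoin I f).
Proof.
move=> Ii; have [I0 h] := Ii; split; first by exists 0, 0; rewrite mul0r addr0.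
move=> a _ _ [i [r [Ir ->]]] [j [s [Is ->]]]; exists (a * i + j), (a * r + s).
by split; [apply: h|ring].
Qed.

Lemma ideal_adjoin_sub I f : I `<=` ideal_adjoin I f.
Proof. by move=> x Ix; exists x, 0; rewrite mul0r addr0. Qed.

Lemma ideal_adjoin_mem I f : is_ideal I -> ideal_adjoin I f f.
Proof. by move=> [I0 _]; exists 0, 1; rewrite mul1r add0r. Qed.

(** An ideal maximal among those that contain J and no power of f is prime: if x and y lie outside,
    adjoining each of them captures a power of f, and the product of these powers lies in the ideal
    as soon as x y does. *)
Lemma prime_avoiding (J : set R) f : is_ideal J -> (forall N, ~ J (f ^+ N)) ->
  exists I, [/\ is_ideal I, J `<=` I, ~ I f, ~ I 1 & forall x y, I (x * y) -> I x \/ I y].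
Proof.
move=> Ji nf.
(* Stated for the union with J, so that the empty chain, whose union is empty, satisfies it as
   well. *)
pose P (A : set R) := is_ideal (A `|` J) /\ forall N, ~ (A `|` J) (f ^+ N).
have [F FP tot|A [[Ai Af] Amax]] := @Zorn_bigcup R P.
  have [->|/set0P[X0 FX0]] := eqVneq F set0.
    by rewrite /P bigcup_set0 set0U; split.
  have sub X : F X -> X `|` J `<=` \bigcup_(X in F) X `|` J.
    by move=> FX x [Xx|Jx]; [left; exists X|right].
  have two x y : (\bigcup_(X in F) X `|` J) x -> (\bigcup_(X in F) X `|` J) y ->
    exists2 X, F X & (X `|` J) x /\ (X `|` J) y.
    move=> [[X FX Xx]|Jx] [[Y FY Yy]|Jy].
    - have [XY|YX] := tot _ _ FX FY.
        by exists Y => //; split; left=> //; apply: XY.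
      by exists X => //; split; left=> //; apply: YX.
    - by exists X => //; split; [left|right].
    - by exists Y => //; split; [right|left].
    - by exists X0 => //; split; right.
  split; first split.
  - by apply: (sub _ FX0); have [[]] := FP _ FX0.
  - move=> a x y Ux Uy; have [X FX [Xx Xy]] := two x y Ux Uy.
    by apply: (sub _ FX); have [[_ h] _] := FP _ FX; apply: h.
  - move=> N UN; have [X FX [XN _]] := two _ _ UN UN.
    by have [_ h] := FP _ FX; apply: (h N).
pose I := A `|` J.
have step x : ~ I x -> exists N, ideal_adjoin I x (f ^+ N).
  move=> nx; apply: contrapT => nN.
  have JI : ideal_adjoin I x `|` J = ideal_adjoin I x.
    apply/seteqP; split=> y; last by left.
    by case=> // Jy; apply: ideal_adjoin_sub; right.
  apply: (Amax (ideal_adjoin I x)).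
    split; first by move=> y Ay; apply: ideal_adjoin_sub; left.
    by move=> /(_ x (ideal_adjoin_mem _ Ai)) Ax; apply: nx; left.
  rewrite /P JI; split; first exact: ideal_adjoinP.
  by move=> N hN; apply: nN; exists N.
exists I; split=> //.
- by right.
- by move=> If; apply: (Af 1%N); rewrite expr1.
- by move=> I1; apply: (Af 0%N); rewrite expr0.
- move=> x y Ixy; apply: contrapT => /not_orP[nx ny].
  have [N [i [r [Ii eN]]]] := step x nx; have [M [j [s [Ij eM]]]] := step y ny.
  apply: (Af (N + M)%N); rewrite exprD eN eM -/I.
  have -> : (i + r * x) * (j + s * y) = (j + s * y) * i + ((r * x) * j + ((r * s) * (x * y) + 0)).
    by ring.
  apply: Ai.2 => //; apply: Ai.2 => //; apply: Ai.2 => //; exact: Ai.1.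
Qed.

(** Nilpotency of f modulo J can thus be tested by morphisms to integral domains. *)
Lemma domain_avoiding (J : set R) f : is_ideal J -> (forall N, ~ J (f ^+ N)) ->
  exists (D : idomainType) (phi : {rmorphism R -> D}),
    (forall x, J x -> phi x = 0) /\ phi f != 0.
Proof.
move=> Ji nf; have [I [[I0 Ih] JI If I1 Ip]] := prime_avoiding Ji nf.
pose S : {pred R} := fun x => `[< I x >].
have Sid : idealr_closed S.
  split; first exact/asboolP; first by apply/negP => /asboolP.
  by move=> a x y /asboolP Ix /asboolP Iy; apply/asboolP/Ih.
pose m1 := isIdealr.Build R S Sid.
pose Sideal : idealr R := HB.pack S m1.
have Sprime : prime_idealr_closed S.
  by move=> x y /asboolP /Ip [] h; apply/orP; [left|right]; apply/asboolP.
pose m2 := isPrimeIdealrClosed.Build R S Sprime.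
pose P : prime_idealr R := HB.pack S m1 m2.
pose Q := {ideal_quot P}.
exists (integral_domain (@Quotient.rquot_IdomainAxiom R P)).
have piE x : (\pi_Q x == 0 :> Q) = (x \in S).
  by rewrite -(rmorph0 (\pi_Q : {rmorphism R -> Q})) -Quotient.idealrBE subr0.
exists (\pi_Q : {rmorphism R -> Q}); split.
  by move=> x Jx; apply/eqP; apply: etrans (piE x) _; apply/asboolP/JI.
by apply/negP => h; apply: If; apply/asboolP; move: h; rewrite -[X in is_true X -> _]/(\pi_Q f == 0 :> Q) piE.
Qed.

End Ideals.

(** * Weighted homogeneous maps *)

Section Weights.
Variables (k : fieldType) (M : nat) (wt : 'I_M -> nat).

Definition wdeg (m : 'X_{1..M}) := (\sum_i m i * wt i)%N.

(* The morphism [x_i |-> T^(wt i) x_i]: [f] is homogeneous of weight [d] when it is multiplied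
   by [T^d]. *)
Definition grading (f : {mpoly k[M]}) : {poly {mpoly k[M]}} :=
  mmap (polyC \o @mpolyC M k) (fun i => ('X_i)%:P * 'X^(wt i)) f.

HB.instance Definition _ := GRing.RMorphism.copy grading
  (mmap (polyC \o @mpolyC M k) (fun i => ('X_i)%:P * 'X^(wt i))).

Definition weighted d (f : {mpoly k[M]}) := grading f = f%:P * 'X^d.

Lemma gradingX m : grading 'X_[m] = ('X_[m])%:P * 'X^(wdeg m).
Proof.
rewrite /grading mmapX /mmap1; under eq_bigr do rewrite exprMn -exprM -rmorphXn.
rewrite big_split /= prodrXr -rmorph_prod -mpolyXE_id; congr (_ * _ ^+ _).
by apply: eq_bigr => i _; rewrite mulnC.
Qed.

Lemma coef_grading f d : (grading f)`_d =
  \sum_(m <- msupp f) (f@_m * (wdeg m == d)%:R) *: 'X_[m].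
Proof.
rewrite {1}[f]mpolyE rmorph_sum coef_sum; apply: eq_bigr => m _.
rewrite -mul_mpolyC rmorphM /= gradingX /grading mmapC /= coefCM coefCM coefXn.
by rewrite mul_mpolyC eq_sym; case: eqP => _; rewrite ?mulr1 ?mulr0 ?scaler0 ?scale0r.
Qed.

Lemma weightedM d e f h : weighted d f -> weighted e h -> weighted (d + e) (f * h).
Proof. by rewrite /weighted rmorphM /= => -> ->; rewrite polyCM exprD; ring. Qed.

Lemma weightedD d f h : weighted d f -> weighted d h -> weighted d (f + h).
Proof. by rewrite /weighted rmorphD /= => -> ->; rewrite polyCD; ring. Qed.

Lemma weightedN d f : weighted d f -> weighted d (- f).
Proof. by rewrite /weighted rmorphN /= => ->; rewrite polyCN; ring. Qed.

Lemma weighted0 d : weighted d 0.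
Proof. by rewrite /weighted rmorph0 mul0r. Qed.

Lemma weightedC (c : k) : weighted 0 c%:MP.
Proof. by rewrite /weighted /grading mmapC mulr1. Qed.

Lemma weightedX i : weighted (wt i) 'X_i.
Proof. by rewrite /weighted /grading mmapX mmap1U. Qed.

Lemma weighted_sum d (I : Type) (r : seq I) (P : pred I) (f : I -> {mpoly k[M]}) :
  (forall i, P i -> weighted d (f i)) -> weighted d (\sum_(i <- r | P i) f i).
Proof.
move=> h; elim/big_ind: _; [exact: weighted0 | | exact: h].
by move=> p q; apply: weightedD.
Qed.

Variables (M' : nat) (v : 'I_M' -> {mpoly k[M]}) (wv : 'I_M' -> nat).
Hypothesis wv_gt0 : forall j, (0 < wv j)%N.
Hypothesis v_weighted : forall j, weighted (wv j) (v j).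
(** The zero fibre is tested on points in all integral domains rather than in k alone; with
    [domain_avoiding], the variables are then nilpotent modulo the ideal of the v j without a
    Nullstellensatz. *)
Hypothesis v_trivial_zero : forall (D : idomainType) (phi : {rmorphism {mpoly k[M]} -> D}),
  (forall j, phi (v j) = 0) -> forall i, phi 'X_i = 0.

Let J : set {mpoly k[M]} := [set f | exists u, f = \sum_j v j * u j].

Let J_ideal : is_ideal J.
Proof.
split; first by exists (fun=> 0); rewrite big1 // => j _; rewrite mulr0.
move=> a _ _ [u ->] [w ->]; exists (fun j => a * u j + w j).
by rewrite mulr_sumr -big_split; apply: eq_bigr => j _ /=; ring.
Qed.

Let nilpotent : exists N, forall i, J ('X_i ^+ N).
Proof.
have h i : exists N, J ('X_i ^+ N).
  apply: contrapT => /forallNP nJ.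
  have [D [phi [phiJ]]] := domain_avoiding J_ideal nJ.
  rewrite v_trivial_zero ?eqxx // => j; apply: phiJ.
  exists (fun j' => (j' == j)%:R); rewrite (bigD1 j) //= eqxx mulr1 big1 ?addr0 //.
  by move=> j' /negbTE ->; rewrite mulr0.
have [N hN] := choice h; exists (\sum_i N i)%N => i.
by rewrite (bigD1 i) //= addnC exprD; apply: ideal_mul.
Qed.

(** Graded Nakayama: the monomials with all exponents below N generate. Any other monomial lies in
    the ideal of the v j, with cofactors that can be taken homogeneous of smaller weight, and
    induction on the weight applies. *)
Lemma weighted_finite : finite_over v.
Proof.
have [N hN] := nilpotent.
pose B (e : {ffun 'I_M -> 'I_N}) : {mpoly k[M]} := 'X_[[multinom (e i : nat) | i < M]].
pose good w f := exists a : {ffun 'I_M -> 'I_N} -> {mpoly k[M']},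
  (forall e, msize (a e) <= w.+1)%N /\ f = \sum_e msubst v (a e) * B e.
have good_mono w w' f : (w <= w')%N -> good w f -> good w' f.
  by move=> ww' [a [sa ->]]; exists a; split=> // e; rewrite (leq_trans (sa e)).
have good0 w : good w 0.
  exists (fun=> 0); split=> [e|]; first by rewrite msize0.
  by rewrite big1 // => e _; rewrite rmorph0 mul0r.
have goodD w f h : good w f -> good w h -> good w (f + h).
  move=> [a [sa ->]] [b [sb ->]]; exists (fun e => a e + b e); split.
    by move=> e; rewrite (leq_trans (msizeD_le _ _)) // geq_max sa sb.
  by rewrite -big_split; apply: eq_bigr => e _; rewrite rmorphD mulrDl.
have goodZ w c f : good w f -> good w (c *: f).
  move=> [a [sa ->]]; exists (fun e => c *: a e); split.
    by move=> e; rewrite (leq_trans (msizeZ_le _ _)).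
  rewrite scaler_sumr; apply: eq_bigr => e _.
  by rewrite -!mul_mpolyC rmorphM /= /msubst mmapC mulrA.
have good_sum w (I : Type) (r : seq I) (P : pred I) (f : I -> {mpoly k[M]}) :
  (forall i, P i -> good w (f i)) -> good w (\sum_(i <- r | P i) f i).
  by move=> h; apply: (big_ind (good w)) => //; apply: goodD.
have good_v w j f : good w f -> good w.+1 (v j * f).
  move=> [a [sa ->]]; exists (fun e => 'X_j * a e); split.
    by move=> e; apply: (@msize_mul _ _ _ _ 1 w); rewrite ?msizeX ?mdeg1.
  rewrite mulr_sumr; apply: eq_bigr => e _.
  by rewrite rmorphM /= {2}/msubst mmapX mmap1U mulrA.
have good_mon w : forall m, wdeg m = w -> good w 'X_[m].
  elim/ltn_ind: w => w IH m mw.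
  have good_coef d u : (d < w)%N -> good d (grading u)`_d.
    move=> dw; rewrite coef_grading; apply: good_sum => m' _.
    case: eqP => [e|_]; last by rewrite mulr0 scale0r.
    by apply: goodZ; apply: IH.
  case: (boolP [forall i, m i < N]%N) => [/forallP lt|].
    exists (fun e => (e == [ffun i => Ordinal (lt i)])%:R%:MP); split.
      by move=> e; rewrite msizeC; case: (_ != 0).
    rewrite (bigD1 [ffun i => Ordinal (lt i)]) //= eqxx [msubst v _](_ : _ = 1); last first.
      by rewrite /msubst mmapC /= mulr1n mpolyC1.
    rewrite mul1r [X in _ + X]big1 ?addr0; last first.
      by move=> e /negbTE ->; rewrite /msubst mmapC /= mulr0n mpolyC0 mul0r.
    by congr mpolyX; apply/mnmP => i; rewrite mnmE ffunE.
  rewrite negb_forall => /existsP [i]; rewrite -leqNgt => mi.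
  have em : m = (U_(i) *+ N + (m - U_(i) *+ N))%MM.
    apply/mnmP => j; rewrite mnmDE mnmBE mulmnE mnm1E.
    by case: eqP => [<-|_]; rewrite ?mul1n ?mul0n ?subn0 // subnKC.
  have [u hu] : J 'X_[m].
    rewrite em mpolyXD mulrC; apply: ideal_mul => //.
    by rewrite -mpolyXn.
  (* Passing to the component of weight w replaces the cofactor of v j by its component of weight w
     - wv j. *)
  have -> : 'X_[m] = (grading 'X_[m])`_w.
    by rewrite gradingX mw coefCM coefXn eqxx mulr1.
  rewrite hu rmorph_sum coef_sum; apply: good_sum => j _.
  rewrite rmorphM /= v_weighted -mulrA coefCM coefXnM.
  case: ltnP => wj; first by rewrite mulr0.
  have := wv_gt0 j => wj0.
  apply: (@good_mono (w - wv j).+1); first by lia.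
  by apply: good_v; apply: good_coef; lia.
(* A monomial of degree at most D has weight at most D times the sum of the weights, and the weight
   bounds the degrees of the coefficients. *)
exists {ffun 'I_M -> 'I_N}, B, (\sum_i wt i)%N => D f sf.
suff [a [sa ef]] : good ((\sum_i wt i) * D)%N f by exists a.
rewrite [f]mpolyE [X in good _ X]big_seq; apply: good_sum => m mf; apply: goodZ.
apply: (@good_mono (wdeg m)); last exact: good_mon.
rewrite /wdeg big_distrl /=; apply: leq_sum => i _; rewrite mulnC leq_mul2l.
by rewrite (leq_trans (mdeg_le m i)) ?orbT //; have := msize_mdeg_lt mf; lia.
Qed.

End Weights.

(** * Finite maps between affine spaces *)

Section IdealPoints.
Variable k : closedFieldType.

Lemma ideal_congruence M M' (K : set {mpoly k[M]}) (v : 'I_M' -> {mpoly k[M]}) (c : 'I_M' -> k) :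
  is_ideal K -> (forall j, K (v j - (c j)%:MP)) ->
  forall a, K (msubst v a - (a.@[c])%:MP).
Proof.
move=> Ki Kv a.
have mul_congr x y x' y' : K (x - x') -> K (y - y') -> K (x * y - x' * y').
  move=> h1 h2; have -> : x * y - x' * y' = y * (x - x') + x' * (y - y') by ring.
  by apply: Ki.2 => //; apply: ideal_mul.
have K0 x : K (x - x) by rewrite subrr; apply: Ki.1.
rewrite mevalE /msubst /mmap rmorph_sum -sumrB; apply: ideal_sum => // m _.
rewrite rmorphM; apply: (mul_congr) => //.
rewrite /mmap1 rmorph_prod.
apply: (big_ind2 (fun x y => K (x - y))); first exact: K0.
  by move=> x x' y y' h1 h2; apply: (mul_congr).
move=> i _.
elim: (m i) => [|e IH]; first by rewrite !expr0 rmorph1.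
by rewrite !exprS rmorphM; apply: (mul_congr).
Qed.

Lemma msubst_id M (f : {mpoly k[M]}) : msubst (fun i => 'X_i) f = f.
Proof.
rewrite [RHS]mpolyE /msubst /mmap; apply: eq_bigr => m _.
by rewrite mmap1_id mul_mpolyC.
Qed.

(** The weak Nullstellensatz when each variable is algebraic modulo K: its equation splits into
    linear factors, and one factor per variable can be adjoined without reaching 1. *)
Lemma ideal_point M (K : set {mpoly k[M]}) : is_ideal K -> ~ K 1 ->
  (forall i, exists2 p : {poly k}, p != 0 & K (map_poly (@mpolyC M k) p).['X_i]) ->
  exists x : 'I_M -> k, forall f, K f -> f.@[x] = 0.
Proof.
move=> Ki K1 alg.
suff h n : (n <= M)%N -> exists K', [/\ is_ideal K', ~ K' 1, K `<=` K' &
    exists x : 'I_M -> k, forall i : 'I_M, (i < n)%N -> K' ('X_i - (x i)%:MP)].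
  have [K' [K'i K'1 KK' [x hx]]] := h M (leqnn M); exists x => f /KK' Kf.
  apply/eqP; apply: contrapT => /negP fx; apply: K'1.
  have := ideal_congruence K'i (fun i => hx i (ltn_ord i)) f; rewrite msubst_id => hf.
  have {}hf : K' (f.@[x])%:MP.
    rewrite (_ : _%:MP = -1 * (f - (f.@[x])%:MP) + f); last by ring.
    by apply: K'i.2.
  have := ideal_mul ((f.@[x])^-1)%:MP K'i hf.
  by rewrite -mpolyCM mulVf // mpolyC1.
elim: n => [|n IH] nM; first by exists K; split=> //; exists (fun=> 0).
have [|K' [K'i K'1 KK' [x hx]]] := IH; first exact: ltnW.
pose i0 := Ordinal nM.
have [p p0 Kp] := alg i0.
have [r pr] := closed_field_poly_normal p.
have {}Kp : K' (\prod_(z <- r) ('X_i0 - z%:MP)).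
  have := ideal_mul ((lead_coef p)^-1)%:MP K'i (KK' _ Kp).
  rewrite {2}pr -mul_polyC rmorphM /= map_polyC hornerM hornerC mulrA -mpolyCM.
  rewrite mulVf ?lead_coef_eq0 // mpolyC1 mul1r rmorph_prod horner_prod.
  by under eq_bigr do rewrite rmorphB /= map_polyX map_polyC hornerXsubC.
(* If every factor became invertible modulo K', the product could be stripped factor by factor,
   leaving 1 in K'. *)
have [z hz] : exists z, ~ ideal_adjoin K' ('X_i0 - z%:MP) 1.
  apply: contrapT => /forallNP nz; apply: K'1.
  elim: r Kp {pr} => [|z r IHr]; first by rewrite big_nil.
  rewrite big_cons => Kz; apply: IHr.
  have [j [s [Kj e]]] := contrapT (nz z).
  move: (\prod_(_ <- r) _) Kz => Q Kz.
  have -> : Q = Q * j + s * (('X_i0 - z%:MP) * Q) by rewrite -[LHS]mul1r [in LHS]e; ring.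
  by apply: ideal_add => //; apply: ideal_mul.
exists (ideal_adjoin K' ('X_i0 - z%:MP)); split=> //.
- exact: ideal_adjoinP.
- by move=> f /KK'; apply: ideal_adjoin_sub.
exists (fun i => if i == i0 then z else x i) => i; rewrite ltnS => ni.
case: eqP => [->|/eqP ii0]; first exact: ideal_adjoin_mem.
apply: ideal_adjoin_sub; apply: hx; rewrite ltn_neqAle ni andbT.
by apply: contra ii0 => /eqP e; apply/eqP/val_inj.
Qed.

(** Over a fixed y the generators B span k[x] modulo K over k, so the powers of each variable are
    linearly dependent there and [ideal_point] applies. *)
Lemma finite_ideal_point M M' (v : 'I_M' -> {mpoly k[M]}) (K : set {mpoly k[M]}) (y : 'I_M' -> k) :
  finite_over v -> is_ideal K -> ~ K 1 -> (forall j, K (v j - (y j)%:MP)) ->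
  exists x : 'I_M -> k, (forall j, (v j).@[x] = y j) /\ forall f, K f -> f.@[x] = 0.
Proof.
move=> [J [B [C fin]]] Ki K1 Kv.
have [i|x hx] := ideal_point Ki K1; last first.
  exists x; split=> // j; have := hx _ (Kv j).
  by rewrite mevalB mevalC => /eqP; rewrite subr_eq0 => /eqP.
have hm m : exists a : J -> {mpoly k[M']}, 'X_i ^+ m = \sum_j msubst v (a j) * B j.
  by have [a [_ ->]] := fin (msize ('X_i ^+ m : {mpoly k[M]})) ('X_i ^+ m) (leqnSn _); exists a.
have [a ha] := choice hm.
pose A := \matrix_(m < #|J|.+1, j < #|J|) (a m (enum_val j)).@[y].
have : kermx A != 0.
  rewrite -mxrank_eq0 mxrank_ker subn_eq0 -ltnNge.
  by rewrite (leq_ltn_trans (rank_leq_col _)).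
case/rowV0Pn => u /sub_kermxP uA u0.
exists (\poly_(m < #|J|.+1) u ord0 (inord m)).
  apply: contra u0 => /eqP e; apply/eqP/rowP => m; rewrite mxE.
  have := congr1 (fun p : {poly k} => p`_m) e; rewrite coef_poly coef0 ltn_ord.
  by rewrite inord_val.
rewrite poly_def rmorph_sum horner_sum.
have -> : \sum_(m < #|J|.+1) (map_poly (@mpolyC M k) (u ord0 (inord m) *: 'X^m)).['X_i] =
    \sum_(m < #|J|.+1) \sum_j (u ord0 m)%:MP * ((msubst v (a m j) - ((a m j).@[y])%:MP) * B j)
    + \sum_j (\sum_(m < #|J|.+1) u ord0 m * (a m j).@[y])%:MP * B j.
  under [X in _ + X]eq_bigr do rewrite rmorph_sum mulr_suml.
  rewrite [X in _ + X]exchange_big -big_split; apply: eq_bigr => m _ /=.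
  rewrite -big_split inord_val -mul_polyC rmorphM /= map_polyC map_polyXn hornerM hornerC hornerXn.
  rewrite ha mulr_sumr; apply: eq_bigr => j _ /=; rewrite mpolyCM; ring.
apply: ideal_add => //; last first.
  rewrite big1; first exact: Ki.1; move=> j _.
  have := congr1 (fun w : 'rV_#|J| => w ord0 (enum_rank j)) uA; rewrite !mxE => e.
  rewrite [X in X%:MP](_ : _ = 0) ?mpolyC0 ?mul0r // -[RHS]e.
  by apply: eq_bigr => m _; rewrite mxE enum_rankK.
apply: ideal_sum => // m _; apply: ideal_sum => // j _; apply: ideal_mul => //.
by rewrite mulrC; apply: ideal_mul => //; exact: ideal_congruence.
Qed.

End IdealPoints.

(** * Closed images and lifting of chains along finite maps *)

Section Closed.
Variable k : closedFieldType.

(** A root of p - 1 is not a root of p. *)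
Lemma nonroot (p : {poly k}) : p != 0 -> exists x, p.[x] != 0.
Proof.
move=> p0; case: (ltnP 1 (size p)) => [sp|sp].
  have /closed_rootP [x] : size (p - 1) != 1%N.
    rewrite size_polyDl ?size_polyN ?size_poly1 //; lia.
  by rewrite /root hornerD hornerN hornerC subr_eq0 => /eqP px; exists x; rewrite px oner_neq0.
have [c c0 ->] : exists2 c, c != 0 & p = c%:P.
  by apply/size_poly1P; rewrite eqn_leq sp size_poly_gt0.
by exists 0; rewrite hornerC.
Qed.

(** If f and h do not vanish at points a and b of S, neither restricts to zero on the line through a
    and b, so some point of this line is a zero of neither. *)
Lemma affine_irreducible N (S : set 'rV[k]_N) : S !=set0 ->
  (forall a b t, S a -> S b -> S (a + t *: (b - a))) -> zariski_irreducible S.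
Proof.
move=> S0 Sline; apply: integral_irreducible => // f h fh.
apply: contrapT => /not_orP[/existsNP [a /not_implyP[Sa /eqP fa]] /existsNP [b /not_implyP[Sb /eqP hb]]].
pose line (q : {mpoly k[N]}) := mmap polyC (fun i => (a ord0 i)%:P + (b ord0 i - a ord0 i)%:P * 'X) q.
have lineE q t : (line q).[t] = q.@[(a + t *: (b - a)) ord0].
  rewrite /line /mmap horner_sum mevalE; apply: eq_bigr => m _.
  rewrite hornerM hornerC horner_prod; congr (_ * _); apply: eq_bigr => i _.
  by rewrite horner_exp hornerD hornerM !hornerC hornerX !mxE mulrC.
have l0 q t : q.@[(a + t *: (b - a)) ord0] != 0 -> line q != 0.
  by rewrite -lineE; apply: contra => /eqP ->; rewrite horner0.
have f0 : line f != 0 by apply: (l0 _ 0); rewrite scale0r addr0.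
have h0 : line h != 0 by apply: (l0 _ 1); rewrite scale1r addrC subrK.
have [t] := nonroot (mulf_neq0 f0 h0).
by rewrite hornerM !lineE -mevalM fh ?eqxx //; apply: Sline.
Qed.

Lemma zariski_closedT N : zariski_closed [set: 'rV[k]_N].
Proof. by exists set0; apply/seteqP; split=> // x _ f. Qed.

Lemma full_chain N : irreducible_chain [set: 'rV[k]_N] N
  (fun i => [set x | forall j : 'I_N, (i <= j)%N -> x ord0 j = 0]).
Proof.
split=> i iN; first split.
- exists [set x | forall j : 'I_N, (i <= j)%N -> x ord0 j = 0]; last by rewrite setTI.
  exists [set 'X_j | j in [set j : 'I_N | (i <= j)%N]]; apply/seteqP; split=> x /=.
    by move=> h _ [j ij <-]; rewrite mevalXU h.
  by move=> h j ij; rewrite -mevalXU; apply: h; exists j.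
- apply: affine_irreducible; first by exists 0 => j _; rewrite mxE.
  by move=> a b t ha hb j ij; rewrite !mxE ha // hb // subr0 mulr0 addr0.
- split=> [x h j ij|]; first by apply: h; exact: ltnW.
  move=> /(_ (delta_mx ord0 (Ordinal iN))) h.
  have := h _ (Ordinal iN) (leqnn _); rewrite mxE !eqxx => /(_ _)/eqP; rewrite oner_eq0.
  by move=> e; apply/notF/e => j ij; rewrite mxE andbC; case: eqP => // ej; rewrite ej /= ltnn in ij.
Qed.

(** Otherwise the whole space would have the growth of a hypersurface, which its coordinate flag is
    too long for. *)
Lemma nonvanishing N (f : {mpoly k[N]}) : f != 0 -> exists x : 'rV_N, f.@[x ord0] != 0.
Proof.
move=> f0; apply: contrapT => /forallNP nx.
have fx (x : 'rV_N) : f.@[x ord0] = 0 by apply/eqP; apply: contrapT => /negP; exact: nx.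
case: N f f0 fx {nx} => [|N] f f0 fx.
  by move: (fx 0); rewrite [f]nvar0_mpolyC mevalC => e; case/eqP: f0; rewrite [f]nvar0_mpolyC e mpolyC0.
have gr := @growth_hypersurface _ _ [set: 'rV_N.+1] N (fun x => x ord0) f f0 (fun x _ => fx x).
by have := chain_length gr (full_chain N.+1); rewrite ltnn.
Qed.

Lemma zariski_closedI N (A B : set 'rV[k]_N) : zariski_closed A -> zariski_closed B ->
  zariski_closed (A `&` B).
Proof.
move=> [S ->] [T ->]; exists (S `|` T); apply/seteqP; split=> x /=.
  by case=> h1 h2 f [/h1|/h2].
by move=> h; split=> f hf; apply: h; [left|right].
Qed.

Variables (M M' : nat) (v : 'I_M' -> {mpoly k[M]}).
Hypothesis fin : finite_over v.

Definition polymap (x : 'rV[k]_M) : 'rV[k]_M' := \row_j (v j).@[x ord0].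

Lemma polymapE (a : {mpoly k[M']}) x : a.@[polymap x ord0] = (msubst v a).@[x ord0].
Proof. by rewrite msubstE; apply: meval_eq => j; rewrite mxE. Qed.

Lemma closed_preimage A : zariski_closed A -> zariski_closed (polymap @^-1` A).
Proof.
move=> [S ->]; exists (msubst v @` S); apply/seteqP; split=> x /=.
  by move=> h _ [f Sf <-]; rewrite -polymapE; apply: h.
by move=> h f Sf; rewrite polymapE; apply: h; exists f.
Qed.

Let fiber_ideal (K : set {mpoly k[M]}) (y : 'rV[k]_M') : set {mpoly k[M]} :=
  [set f | exists i u, K i /\ f = i + \sum_j (v j - (y ord0 j)%:MP) * u j].

Let fiber_idealP K y : is_ideal K -> is_ideal (fiber_ideal K y).
Proof.
move=> Ki; split; first by exists 0, (fun=> 0); split; [exact: Ki.1|rewrite big1 ?addr0 // => j _; rewrite mulr0].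
move=> a _ _ [i [u [Kj ->]]] [j [w [Kw ->]]]; exists (a * i + j), (fun l => a * u l + w l).
split; first exact: Ki.2.
rewrite mulrDr mulr_sumr addrACA -big_split; congr (_ + _); apply: eq_bigr => l _ /=; ring.
Qed.

Lemma fiber_point (K : set {mpoly k[M]}) (y : 'rV[k]_M') : is_ideal K ->
  (exists u, K (1 - \sum_j (v j - (y ord0 j)%:MP) * u j)) \/
  exists x, polymap x = y /\ forall f, K f -> f.@[x ord0] = 0.
Proof.
move=> Ki; have Li := fiber_idealP y Ki.
case: (pselect (fiber_ideal K y 1)) => [[i [u [Ku e]]]|n1].
  by left; exists u; rewrite e addrK.
right; have [j|x [xy hx]] := finite_ideal_point (y := y ord0) fin Li n1.
  exists 0, (fun l => (l == j)%:R); split; first exact: Ki.1.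
  rewrite (bigD1 j) //= eqxx mulr1 big1 ?addr0 ?add0r //.
  by move=> l /negbTE ->; rewrite mulr0.
have rx : (\row_j x j) ord0 =1 x by move=> j; rewrite mxE.
exists (\row_j x j); split.
  by apply/rowP => j; rewrite mxE (meval_eq _ rx) xy.
move=> f Kf; rewrite (meval_eq _ rx); apply: hx; exists f, (fun=> 0); split=> //.
by rewrite big1 ?addr0 // => j _; rewrite mulr0.
Qed.

Definition vanishing (X : set 'rV[k]_M) : set {mpoly k[M]} :=
  [set f | forall x, X x -> f.@[x ord0] = 0].

Lemma vanishing_ideal X : is_ideal (vanishing X).
Proof.
split=> [x _|a f h hf hh x Xx]; first by rewrite meval0.
by rewrite mevalD mevalM hf // hh // mulr0 addr0.
Qed.

Lemma vanishing_closed X (x : 'rV_M) : zariski_closed X ->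
  (forall f, vanishing X f -> f.@[x ord0] = 0) -> X x.
Proof.
by move=> [S ->] h f Sf; apply: h => y; apply.
Qed.

(* Nakayama's lemma: over a point outside the image, [1] lies in the ideal of the fibre, and the
   determinant trick produces an equation of the image that is nonzero there. *)
Lemma closed_image X : zariski_closed X -> zariski_closed (polymap @` X).
Proof.
move=> Xc; exists [set p | forall x, X x -> p.@[polymap x ord0] = 0].
apply/seteqP; split=> [_ [x Xx <-] p|y hy] /=; first exact.
have [[u hu]|[x [xy hx]]] := fiber_point y (vanishing_ideal X); last first.
  by exists x => //; exact: vanishing_closed.
exfalso; have [J [B [C F]]] := fin.
have hB (f : {mpoly k[M]}) : exists a : J -> {mpoly k[M']}, f = \sum_j msubst v (a j) * B j.
  by have [a [_ e]] := F (msize f) f (leqnSn _); exists a.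
have [a ha] := choice (fun jm : 'I_M' * J => hB (u jm.1 * B jm.2)).
(* On X the sum of the (v j - y j) u j is 1; multiplied by a generator it gives B m = \sum_n c m n B
   n there, with c vanishing at y. *)
pose c (m n : J) : {mpoly k[M']} := \sum_j ('X_j - (y ord0 j)%:MP) * a (j, m) n.
pose Cm := \matrix_(m < #|J|, n < #|J|) c (enum_val m) (enum_val n).
(* Equal to 1 at y, since c vanishes there; zero on the image of X, where the nonzero column of the
   generators lies in the kernel. *)
pose p := \det (1%:M - Cm).
have py : p.@[y ord0] = 1.
  rewrite -det_map_mx -[RHS](det1 k #|J|); congr (\det _); apply/matrixP => m n.
  rewrite !mxE rmorphB /= rmorph_sum big1 ?subr0 ?rmorph_nat // => j _.
  by rewrite /= mevalM mevalB mevalXU mevalC subrr mul0r.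
suff : p.@[y ord0] = 0 by rewrite py => /eqP; rewrite oner_eq0.
apply: hy => x Xx; rewrite -det_map_mx; apply/eqP; apply: contrapT => /negP.
set A := map_mx _ _ => detA.
have Bx m : (B m).@[x ord0] = \sum_n (c m n).@[polymap x ord0] * (B n).@[x ord0].
  have := hu x Xx; rewrite mevalB meval1 => /eqP; rewrite subr_eq0 => /eqP e.
  rewrite -[LHS]mul1r e rmorph_sum mulr_suml.
  under [RHS]eq_bigr do rewrite /c rmorph_sum mulr_suml.
  rewrite exchange_big; apply: eq_bigr => j _ /=.
  rewrite mevalM -mulrA -mevalM (ha (j, m)) rmorph_sum mulr_sumr; apply: eq_bigr => n _ /=.
  by rewrite !mevalM -polymapE mulrA !mevalB !mevalC mevalXU mxE.
pose b : 'cV[k]_#|J| := \col_m (B (enum_val m)).@[x ord0].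
have Ab : A *m b = 0.
  apply/colP => m; rewrite !mxE.
  under eq_bigr do rewrite !mxE rmorphB mulrBl rmorph_nat /=.
  rewrite sumrB (bigD1 m) //= eqxx mul1r big1 ?addr0; last first.
    by move=> n /negbTE nm; rewrite eq_sym nm mul0r.
  apply/eqP; rewrite subr_eq0 Bx; apply/eqP.
  by rewrite (reindex (@enum_val J predT)) /=; last exact: onW_bij (@enum_val_bij J).
have b0 : b = 0.
  have uA : A \in unitmx by rewrite unitmxE unitfE.
  by rewrite -[b]mul1mx -(mulVmx uA) -mulmxA Ab mulmx0.
have [a1 e1] := hB 1.
have := congr1 (meval (x ord0)) e1; rewrite meval1 rmorph_sum big1 => [/eqP|m _].
  by rewrite oner_eq0.
have := congr1 (fun w : 'cV_#|J| => w (enum_rank m) ord0) b0; rewrite !mxE enum_rankK => Bm.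
by rewrite /= mevalM Bm mulr0.
Qed.

(** By Zorn. The intersection of a chain of closed sets over A still covers A: if a point had no
    preimage in it, 1 would lie in the fibre ideal, hence already in that of a single member. *)
Lemma minimal_closed (A : set 'rV[k]_M') X : zariski_closed X -> A `<=` polymap @` X ->
  exists C, [/\ zariski_closed C, C `<=` X, A `<=` polymap @` C &
    forall C', zariski_closed C' -> C' `<=` C -> A `<=` polymap @` C' -> C `<=` C'].
Proof.
move=> Xc AX.
pose good C := [/\ zariski_closed C, C `<=` X & A `<=` polymap @` C].
pose T := {C : set 'rV[k]_M | good C}.
(* The order is reversed, so that a maximal element is a smallest set. *)
pose R (C D : T) : bool := `[< sval D `<=` sval C >].
pose X0 : T := exist _ X (And3 Xc (@subset_refl _ X) AX).
have [|||[C [Cc CX AC]] Cmin] := @ZL_preorder T X0 R.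
- by move=> C; apply/asboolP.
- by move=> B C D /asboolP BC /asboolP CD; apply/asboolP => x /CD /BC.
- move=> F tot; case: (pselect (exists C, F C)) => [[C0 FC0]|nF]; last first.
    by exists X0 => C FC; case: nF; exists C.
  pose I := [set x | forall C, F C -> sval C x].
  have Ic : zariski_closed I.
    exists [set f | exists2 C, F C & vanishing (sval C) f]; apply/seteqP; split=> x.
      by move=> Ix f [C FC]; apply; apply: Ix.
    move=> h C FC; have [Cc _ _] := svalP C; apply: vanishing_closed => // f hf.
    by apply: h; exists C.
  have AI : A `<=` polymap @` I.
    move=> y Ay; pose K := [set f | exists2 C, F C & vanishing (sval C) f].
    have Ki : is_ideal K.
      split; first by exists C0 => // x _; rewrite meval0.
      move=> a f h [C FC hf] [D FD hh].
      have [/asboolP CD|/asboolP DC] := tot _ _ FC FD.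
        by exists D => //; apply: (vanishing_ideal _).2 => // x /CD; apply: hf.
      by exists C => //; apply: (vanishing_ideal _).2 => // x /DC; apply: hh.
    have [[u [C FC hC]]|[x [xy hx]]] := fiber_point y Ki.
      have [_ _ AC] := svalP C; have [x Cx xy] := AC y Ay.
      have := hC x Cx; rewrite mevalB meval1 rmorph_sum big1 ?subr0 => [/eqP|j _].
        by rewrite oner_eq0.
      by rewrite /= mevalM mevalB mevalC -xy mxE subrr mul0r.
    exists x => // C FC; have [Cc _ _] := svalP C; apply: vanishing_closed => // f hf.
    by apply: hx; exists C.
  have IX : I `<=` X by move=> x Ix; have [_ CX _] := svalP C0; apply: CX; apply: Ix.
  by exists (exist _ I (And3 Ic IX AI)) => C FC; apply/asboolP => x; apply.
exists C; split=> // C' C'c C'C AC'.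
have C'X : C' `<=` X by move=> x /C'C /CX.
have /(Cmin (exist _ C' (And3 C'c C'X AC'))) /asboolP : `[< C' `<=` C >] by apply/asboolP.
by apply.
Qed.

(** Built from the top, each member inside the previous one. A minimal closed set over [A d] is
    irreducible: two closed sets covering it have closed images covering [A d], one image is
    everything, and minimality applies. *)
Lemma chain_over d (A : nat -> set 'rV[k]_M') X : zariski_closed X ->
  (forall i, (i <= d)%N -> zariski_closed (A i) /\ zariski_irreducible (A i)) ->
  (forall i, (i < d)%N -> A i `<` A i.+1) -> A d `<=` polymap @` X ->
  exists C, [/\ irreducible_chain setT d C, C d `<=` X &
    forall i, (i <= d)%N -> zariski_closed (C i) /\ polymap @` C i = A i].
Proof.
elim: d X => [|d IH] X Xc Aci Alt AX.
all: set d' := (X in A X `<=` _) in AX.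
all: have [Adc [Ad0 Adirr]] := Aci d' (leqnn _).
all: have X'c := zariski_closedI Xc (closed_preimage Adc).
all: have AX' : A d' `<=` polymap @` (X `&` polymap @^-1` A d')
  by move=> y Ay; have [x Xx xy] := AX y Ay; exists x => //; split=> //=; rewrite xy.
all: have [C [Cc CX AC Cmin]] := minimal_closed X'c AX'.
all: have CA : polymap @` C = A d'
  by apply/seteqP; split=> // _ [x /CX [_ Ax] <-].
all: have Cirr : zariski_irreducible C.
1,3: split; [by have [y Ay] := Ad0; have [x Cx _] := AC y Ay; exists x|].
1,2: move=> P Q Pc Qc CPQ; have CPc := closed_image (zariski_closedI Cc Pc);
  have CQc := closed_image (zariski_closedI Cc Qc);
  have [|h|h] := Adirr _ _ CPc CQc;
  [ by move=> y Ay; have [x Cx xy] := AC y Ay;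
    have [Px|Qx] := CPQ x Cx; [left|right]; exists x
  | left; move=> x /(Cmin _ (zariski_closedI Cc Pc) (@subIsetl _ _ _) h) []
  | right; move=> x /(Cmin _ (zariski_closedI Cc Qc) (@subIsetl _ _ _) h) [] ]; by [].
- exists (fun=> C); split; [split| |] => //.
  + by move=> i _; split=> //; exists C; rewrite ?setTI.
  + by move=> x /CX [].
  + by case.
have [||| D [Dch DC hD]] := IH C Cc.
- by move=> i id; apply: Aci; exact: leqW.
- by move=> i id; apply: Alt; exact: leqW.
- by rewrite CA; have [] := Alt d (ltnSn d).
pose E i := if (i <= d)%N then D i else C.
have Ele i : (i <= d)%N -> E i = D i by rewrite /E => ->.
have Elast : E d.+1 = C by rewrite /E ltnn.
exists E; split.
- split=> i.
    rewrite leq_eqVlt => /orP[/eqP ->|]; last by rewrite ltnS => id; rewrite Ele //; apply: Dch.1.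
    by rewrite Elast; split=> //; exists C; rewrite ?setTI.
  rewrite ltnS leq_eqVlt => /orP[/eqP ->|id]; last by rewrite !Ele //; [apply: Dch.2|exact: ltnW].
  rewrite Elast Ele //; split=> // CD.
  (* Strictness is inherited from the images. *)
  have [_ Dd] := hD d (leqnn d); have [_] := Alt d (ltnSn d); apply.
  by rewrite -[A d.+1]CA -Dd; apply: image_subset.
- by rewrite Elast => x /CX [].
- move=> i; rewrite leq_eqVlt => /orP[/eqP ->|]; first by rewrite Elast.
  by rewrite ltnS => id; rewrite Ele //; apply: hD.
Qed.

End Closed.

(** The image is closed. An equation of it would give the image the growth of a hypersurface, and by
    finiteness the source too, against the coordinate flag. *)
Lemma polymap_surj (k : closedFieldType) M (v : 'I_M -> {mpoly k[M]}) : finite_over v ->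
  forall y, exists x, polymap v x = y.
Proof.
move=> fin y; have [S eS] := closed_image fin (@zariski_closedT k M).
suff : (polymap v @` setT) y by case=> x _; exists x.
rewrite eS => p Sp /=; apply/eqP; apply: contrapT => /negP py.
have p0 : p != 0 by apply: contra py => /eqP ->; rewrite meval0.
have pv x : p.@[polymap v x ord0] = 0.
  have : (polymap v @` setT) (polymap v x) by exists x.
  by rewrite eS; apply.
case: M v fin y p p0 pv py {S eS Sp} => [|N] v fin y p p0 pv py.
  by move/eqP: py; apply; rewrite -(pv 0); congr meval; apply/funext => -[].
have gr := @growth_hypersurface _ _ [set: 'rV_N.+1] N (fun x => polymap v x ord0) p p0 (fun x _ => pv x).
have := @growth_finite _ _ [set: 'rV_N.+1] _ _ v (fun x => x ord0) N fin.
have -> : (fun (x : 'rV[k]_N.+1) j => (v j).@[x ord0]) = (fun x => polymap v x ord0).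
  by apply/funext => x; apply/funext => j; rewrite mxE.
by move=> /(_ gr) g2; have := chain_length g2 (full_chain k N.+1); rewrite ltnn.
Qed.

(** * The Wronski map *)

Section Wronskian.
Variable R : comNzRingType.
Implicit Types (p q : {poly R}) (xs : nat -> R).

Definition wronskian p q := p^`() * q - p * q^`().

Definition monic_poly d (xs : nat -> R) o : {poly R} := 'X^d + \poly_(i < d) xs (o + i)%N.

Lemma coef_monic_poly d xs o i :
  (monic_poly d xs o)`_i = if (i < d)%N then xs (o + i)%N else (i == d)%:R.
Proof.
rewrite coefD coefXn coef_poly; case: ltnP => id; last by rewrite addr0.
by rewrite (ltn_eqF id) add0r.
Qed.

Lemma size_monic_poly d xs o : size (monic_poly d xs o) = d.+1.
Proof. by rewrite size_polyDl ?size_polyXn // ltnS size_poly. Qed.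

Lemma monic_monic_poly d xs o : monic_poly d xs o \is monic.
Proof. by rewrite monicE lead_coefE size_monic_poly coef_monic_poly ltnn eqxx. Qed.

Lemma coefM_low p q i j : (forall a, (a < i)%N -> p`_a = 0) ->
  (forall a, (a < j)%N -> q`_a = 0) -> (p * q)`_(i + j) = p`_i * q`_j.
Proof.
move=> hp hq; rewrite coefM.
have ii : (i < (i + j).+1)%N by lia.
rewrite (bigD1 (Ordinal ii)) //= addKn big1 ?addr0 // => a ai.
case: (ltnP a i) => ai'; first by rewrite hp ?mul0r.
have {}ai : (a : nat) <> i by move=> e; case/eqP: ai; apply: val_inj.
by rewrite hq ?mulr0 //; have := ltn_ord a; lia.
Qed.

Lemma coefM_high p q i j : (size p <= i.+1)%N -> (size q <= j.+1)%N ->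
  (p * q)`_(i + j) = p`_i * q`_j.
Proof.
move=> hp hq; rewrite coefM.
have ii : (i < (i + j).+1)%N by lia.
rewrite (bigD1 (Ordinal ii)) //= addKn big1 ?addr0 // => a ai.
have {}ai : (a : nat) <> i by move=> ai'; case/eqP: ai; apply: val_inj.
have al := ltn_ord a.
case: (ltnP i a) => ai'; first by rewrite [p`_a]nth_default ?mul0r // (leq_trans hp).
by rewrite [q`__]nth_default ?mulr0 // (leq_trans hq) //; lia.
Qed.

(** The factor X turns the derivative into the Euler operator, which multiplies the coefficient of
    t^i by i and shifts no degree. Extreme coefficients of Wronskians thus acquire the factor i -
    j. *)
Lemma coef_XwronskianE p q : 'X * wronskian p q = ('X * p^`()) * q - p * ('X * q^`()).
Proof. by rewrite /wronskian; ring. Qed.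

Lemma coef_Xderiv p i : ('X * p^`())`_i = p`_i *+ i.
Proof. by rewrite coefXM; case: i => [|i] //=; rewrite coef_deriv. Qed.

Lemma wronskian_low p q i j : (forall a, (a < i)%N -> p`_a = 0) ->
  (forall a, (a < j)%N -> q`_a = 0) ->
  ('X * wronskian p q)`_(i + j) = (i%:R - j%:R) * (p`_i * q`_j).
Proof.
move=> hp hq; rewrite coef_XwronskianE coefB !coefM_low //.
- rewrite !coef_Xderiv -[_ *+ i]mulr_natl -[_ *+ j]mulr_natl; ring.
- by move=> a /hq; rewrite coef_Xderiv => ->; rewrite mul0rn.
- by move=> a /hp; rewrite coef_Xderiv => ->; rewrite mul0rn.
Qed.

Lemma size_Xderiv p d : (size p <= d.+1)%N -> (size ('X * p^`())%R <= d.+1)%N.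
Proof.
move=> sp; apply/leq_sizeP => j dj; rewrite coef_Xderiv nth_default ?mul0rn //.
exact: leq_trans sp dj.
Qed.

Lemma wronskian_high p q i j : (size p <= i.+1)%N -> (size q <= j.+1)%N ->
  ('X * wronskian p q)`_(i + j) = (i%:R - j%:R) * (p`_i * q`_j).
Proof.
move=> hp hq; rewrite coef_XwronskianE coefB !coefM_high ?size_Xderiv //.
rewrite !coef_Xderiv -[_ *+ i]mulr_natl -[_ *+ j]mulr_natl; ring.
Qed.

Lemma size_wronskian p q i j : (size p <= i.+1)%N -> (size q <= j.+1)%N ->
  (size (wronskian p q) <= i + j)%N.
Proof.
move=> hp hq; apply/leq_sizeP => a ija.
have := coefXM (wronskian p q) a.+1 => /= <-.
rewrite nth_default // coef_XwronskianE (leq_trans (size_polyD _ _)) // size_polyN geq_max.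
have bnd (p1 q1 : {poly R}) : (size p1 <= i.+1)%N -> (size q1 <= j.+1)%N -> (size (p1 * q1)%R <= a.+1)%N.
  by move=> s1 s2; rewrite (leq_trans (size_polyMleq _ _)) //; lia.
by rewrite !bnd // size_Xderiv.
Qed.

End Wronskian.

Section BasePencil.
Variables (b al be : nat).

(* Coordinates of a pencil [<h m1, h m2>] with [h], [m1], [m2] monic of degrees [b], [al], [be]:
   the coefficients of [h], [m1], [m2], in this order, followed by further parameters. *)
Definition base_poly (R : comNzRingType) (xs : nat -> R) := monic_poly b xs 0.
Definition pencil1 (R : comNzRingType) (xs : nat -> R) := monic_poly al xs b.
Definition pencil2 (R : comNzRingType) (xs : nat -> R) := monic_poly be xs (b + al).
Definition wronski_poly (R : comNzRingType) (xs : nat -> R) :=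
  base_poly xs * wronskian (pencil1 xs) (pencil2 xs).

Local Notation e := (b + al + be - 1)%N.

(* The Wronski map, completed by the coefficient of [t^be] in [m1] (which makes the pencil
   determine its basis) and by the further parameters. *)
Definition wronski (R : comNzRingType) (xs : nat -> R) (j : nat) : R :=
  if (j < e)%N then (wronski_poly xs)`_j else if j == e then xs (b + be)%N else xs j.

Lemma map_monic_poly (R S : comNzRingType) (f : {rmorphism R -> S}) d xs o :
  map_poly f (monic_poly d xs o) = monic_poly d (f \o xs) o.
Proof.
apply/polyP => i; rewrite coef_map /= !coef_monic_poly /=.
by case: ifP => // _; rewrite rmorph_nat.
Qed.

Lemma map_wronskian (R S : comNzRingType) (f : {rmorphism R -> S}) (p q : {poly R}) :
  map_poly f (wronskian p q) = wronskian (map_poly f p) (map_poly f q).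
Proof. by rewrite /wronskian rmorphB !rmorphM /= !deriv_map. Qed.

Lemma map_wronski_poly (R S : comNzRingType) (f : {rmorphism R -> S}) xs :
  map_poly f (wronski_poly xs) = wronski_poly (f \o xs).
Proof. by rewrite rmorphM /= map_wronskian !map_monic_poly. Qed.

Lemma map_wronski (R S : comNzRingType) (f : {rmorphism R -> S}) xs j :
  f (wronski xs j) = wronski (f \o xs) j.
Proof.
rewrite /wronski; case: ifP => _; last by case: ifP.
by rewrite -coef_map /= map_wronski_poly.
Qed.

Hypothesis beal : (be < al)%N.

Lemma size_wronski_poly (R : comNzRingType) (xs : nat -> R) :
  (size (wronski_poly xs) <= e.+1)%N.
Proof.
have := @size_wronskian _ (pencil1 xs) (pencil2 xs) al be.
rewrite !size_monic_poly => /(_ (leqnn _) (leqnn _)) h.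
rewrite (leq_trans (size_polyMleq _ _)) // size_monic_poly; lia.
Qed.

Lemma lead_wronski_poly (R : comNzRingType) (xs : nat -> R) :
  (wronski_poly xs)`_e = al%:R - be%:R.
Proof.
have sw := @size_wronskian _ (pencil1 xs) (pencil2 xs) al be.
have e1 : e = (b + (al + be - 1))%N by lia.
rewrite e1 coefM_high; last 2 first.
- by rewrite size_monic_poly.
- by rewrite (leq_trans (sw _ _)) ?size_monic_poly //; lia.
rewrite coef_monic_poly ltnn eqxx mul1r.
have := coefXM (wronskian (pencil1 xs) (pencil2 xs)) (al + be).
rewrite ifF; last by lia.
rewrite -subn1 => <-; rewrite wronskian_high ?size_monic_poly //.
by rewrite !coef_monic_poly !ltnn !eqxx !mulr1.
Qed.

Section Domain.
Variable D : idomainType.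
Hypothesis charD : forall n, n.+1%:R != 0 :> D.

Lemma lowest_coef (p : {poly D}) : p != 0 -> exists i, [/\ p`_i != 0,
   (i <= (size p).-1)%N & forall a, (a < i)%N -> p`_a = 0].
Proof.
move=> p0; have ex : exists i, p`_i != 0 by exists (size p).-1; rewrite -lead_coefE lead_coef_eq0.
have [i pi imin] := ex_minnP ex; exists i; split=> //.
  by apply: imin; rewrite -lead_coefE lead_coef_eq0.
by move=> a ai; apply/eqP; apply: contraTT ai => /imin; rewrite -leqNgt.
Qed.

Lemma natr_sub_neq0 i j : i != j -> i%:R - j%:R != 0 :> D.
Proof.
case: (ltngtP i j) => // ij _; last first.
  by rewrite -natrB 1?ltnW // -[(i - j)%N]prednK ?charD //; lia.
by rewrite -opprB oppr_eq0 -natrB 1?ltnW // -[(j - i)%N]prednK ?charD //; lia.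
Qed.

Lemma monic_poly_low (d : nat) (xs : nat -> D) o :
  (forall a, (a < d)%N -> (monic_poly d xs o)`_a = 0) ->
  forall i, (i < d)%N -> xs (o + i)%N = 0.
Proof. by move=> h i id; have := h i id; rewrite coef_monic_poly id. Qed.

(** The hypothesis says that h w, with w the Wronskian of m1 and m2, is a nonzero multiple of t^e.
    Comparing lowest orders with degrees then makes h, w, m1 and m2 monomials in turn. *)
Lemma wronski_trivial_zero (xs : nat -> D) M : (b + al + be <= M)%N ->
  (forall j, (j < M)%N -> wronski xs j = 0) -> forall i, (i < M)%N -> xs i = 0.
Proof.
move=> eM h.
set c := (al%:R - be%:R : D); have c0 : c != 0 by apply: natr_sub_neq0; lia.
have vE j : (wronski_poly xs)`_j != 0 -> j = e.
  case: (ltngtP j e) => // je; last by rewrite nth_default ?eqxx // (leq_trans (size_wronski_poly _)).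
  have := h j; rewrite /wronski je => -> //; last by lia.
  by rewrite eqxx.
pose w := wronskian (pencil1 xs) (pencil2 xs).
have w0 : w != 0.
  apply/eqP => w0; have := lead_wronski_poly xs.
  by rewrite /wronski_poly -/w w0 mulr0 coef0 => /esym/eqP; rewrite (negbTE c0).
have [i0 [hi0 i0b hlow]] := lowest_coef (monic_neq0 (monic_monic_poly b xs 0)).
have [j0 [wj0 j0w wlow]] := lowest_coef w0.
rewrite size_monic_poly /= in i0b.
have sw : (size w <= al + be)%N by rewrite size_wronskian ?size_monic_poly.
have j0le : (j0 <= al + be - 1)%N.
  by apply: leq_trans j0w _; rewrite -subn1 leq_sub2r.
(* The lowest orders of h and w add up to e, as do their upper bounds b and al + be - 1; so each
   attains its bound. *)
have ij0 : (i0 + j0)%N = e.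
  by apply: vE; rewrite /wronski_poly coefM_low // mulf_neq0.
have {ij0} [ei0 ej0] : i0 = b /\ j0 = (al + be - 1)%N by lia.
have wE j : ('X * w)`_j != 0 -> j = (al + be)%N.
  rewrite coefXM; case: j => [|j] /=; first by rewrite eqxx.
  case: (ltngtP j j0) => [jj|jj|->] wj; last by rewrite ej0; lia.
  - by rewrite wlow ?eqxx in wj.
  - by move: wj; rewrite nth_default ?eqxx // (leq_trans sw) //; lia.
have m0 d o : monic_poly d xs o != 0 by exact: monic_neq0 (monic_monic_poly d xs o).
have [i [pi ial plow]] := lowest_coef (m0 al b).
have [j [qj jbe qlow]] := lowest_coef (m0 be (b + al)%N).
rewrite !size_monic_poly /= in ial jbe.
have [eqi eqj] : i = al /\ j = be.
  have [eij|ij] := eqVneq i j; last first.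
    suff : (i + j)%N = (al + be)%N by lia.
    by apply: wE; rewrite wronskian_low // !mulf_neq0 // natr_sub_neq0.
  (* For equal orders the lowest terms are cancelled. The combination P has a higher order i', at
     most al, and the same Wronskian with q up to a factor, so i' + j = al + be and j = be. Then m1
     has order be as well, but its coefficient of t^be is zero. *)
  pose p := pencil1 xs; pose q := pencil2 xs.
  pose P := q`_j *: p - p`_i *: q.
  have Plow a : (a < i.+1)%N -> P`_a = 0.
    rewrite ltnS leq_eqVlt coefB !coefZ => /orP[/eqP ->|ai].
      by rewrite eij; ring.
    have pa : p`_a = 0 := plow a ai.
    have qa : q`_a = 0 by apply: qlow; rewrite -eij.
    by rewrite pa qa !mulr0 subr0.
  have Pal : P`_al = q`_j.
    have pa : p`_al = 1 by rewrite coef_monic_poly ltnn eqxx.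
    have qa : q`_al = 0 by rewrite coef_monic_poly ltnNge ltnW //= gtn_eqF.
    by rewrite coefB !coefZ pa qa mulr1 mulr0 subr0.
  have P0 : P != 0 by apply/eqP => P0; move: qj; rewrite -/q -Pal P0 coef0 eqxx.
  have [i' [Pi' _ Plow']] := lowest_coef P0.
  have ii' : (i < i')%N by rewrite ltnNge; apply/negP => /Plow e0; rewrite e0 eqxx in Pi'.
  have i'al : (i' <= al)%N.
    rewrite leqNgt; apply/negP => /Plow'; rewrite Pal => e0.
    by move: qj; rewrite -/q e0 eqxx.
  have : (i' + j)%N = (al + be)%N.
    apply: wE; have e1 : q`_j *: ('X * w) = 'X * wronskian P q.
      rewrite /w -/p -/q /wronskian /P derivB !derivZ -!mul_polyC; ring.
    have : ('X * wronskian P q)`_(i' + j) != 0.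
      by rewrite wronskian_low // !mulf_neq0 // natr_sub_neq0 //; lia.
    by rewrite -e1 coefZ mulf_eq0 negb_or => /andP[].
  move=> eij'; have jb : j = be by lia.
  have := h e; rewrite /wronski ltnn eqxx => /(_ _) e0.
  by move: pi; rewrite eij jb coef_monic_poly beal e0 ?eqxx //; lia.
rewrite {}ei0 in hlow; rewrite {}eqi in plow; rewrite {}eqj in qlow.
move=> a aM; case: (ltnP a b) => ab; first exact: (monic_poly_low hlow ab).
case: (ltnP a (b + al)) => abl.
  by rewrite -(subnKC ab); apply: (monic_poly_low plow); lia.
case: (ltnP a (b + al + be)) => able.
  by rewrite -(subnKC abl); apply: (monic_poly_low qlow); lia.
have := h a aM; rewrite /wronski ifF; last by lia.
by rewrite ifF //; lia.
Qed.

End Domain.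

End BasePencil.

Section Extend.

(** Extension by zero: formulas for pencils are written for sequences indexed by [nat] and evaluated
    in any ring. *)
Definition extend (R : nmodType) M (x : 'I_M -> R) (i : nat) : R :=
  if insub i is Some o then x o else 0.

Lemma extendE (R : nmodType) M (x : 'I_M -> R) (i : 'I_M) : extend x i = x i.
Proof. by rewrite /extend valK. Qed.

Lemma extend_lt (R : nmodType) M (x : 'I_M -> R) i (iM : (i < M)%N) : extend x i = x (Ordinal iM).
Proof. by rewrite /extend insubT. Qed.

Lemma comp_extend (R S : comNzRingType) (f : {rmorphism R -> S}) M (x : 'I_M -> R) :
  f \o extend x = extend (f \o x).
Proof.
by apply/funext => i; rewrite /extend /=; case: insubP => [o _ _|_] //=; rewrite rmorph0.
Qed.

Lemma extend_id (R : nmodType) M (f : nat -> R) i : (i < M)%N ->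
  extend (fun o : 'I_M => f o) i = f i.
Proof. by move=> iM; rewrite (extend_lt _ iM). Qed.

End Extend.

Section GradedPolynomials.
Variables (k : fieldType) (M : nat) (wt : 'I_M -> nat).
Local Notation weighted := (@weighted k M wt).

(** Homogeneity of total weight d when t itself has weight 1. *)
Definition graded d (p : {poly {mpoly k[M]}}) :=
  forall i, ((i <= d)%N -> weighted (d - i) p`_i) /\ ((d < i)%N -> p`_i = 0).

Lemma gradedM d e p q : graded d p -> graded e q -> graded (d + e) (p * q).
Proof.
move=> hp hq i; split=> id.
  rewrite coefM; apply: weighted_sum => j _; have jl := ltn_ord j.
  case: (leqP j d) => jd; last by rewrite (hp j).2 // mul0r; apply: weighted0.
  case: (leqP (i - j) e) => je; last by rewrite (hq (i - j)%N).2 // mulr0; apply: weighted0.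
  have -> : (d + e - i)%N = ((d - j) + (e - (i - j)))%N by lia.
  by apply: weightedM; [apply: (hp j).1|apply: (hq _).1].
rewrite coefM big1 // => j _; have jl := ltn_ord j.
case: (leqP j d) => jd; last by rewrite (hp j).2 // mul0r.
by rewrite (hq (i - j)%N).2 ?mulr0 //; lia.
Qed.

Lemma weightedMn d f n : weighted d f -> weighted d (f *+ n).
Proof.
move=> wf; elim: n => [|n IH]; first by rewrite mulr0n; apply: weighted0.
by rewrite mulrS; apply: weightedD.
Qed.

Lemma graded_deriv d p : graded d.+1 p -> graded d p^`().
Proof.
move=> hp i; rewrite coef_deriv; split=> id; last by rewrite (hp i.+1).2 ?mul0rn.
by apply: weightedMn; rewrite -subSS; apply: (hp i.+1).1.
Qed.

Lemma gradedB d p q : graded d p -> graded d q -> graded d (p - q).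
Proof.
move=> hp hq i; rewrite coefB; split=> id; last by rewrite (hp i).2 // (hq i).2 // subr0.
by apply: weightedD; [apply: (hp i).1|apply: weightedN; apply: (hq i).1].
Qed.

Lemma graded_monic d (xs : nat -> {mpoly k[M]}) o :
  (forall i, (i < d)%N -> weighted (d - i) (xs (o + i)%N)) -> graded d (monic_poly d xs o).
Proof.
move=> h i; rewrite coef_monic_poly; split=> id.
  case: ltnP => id'; first exact: h.
  have -> : i = d by apply/eqP; rewrite eqn_leq id.
  by rewrite eqxx subnn -[_%:R]/1 -mpolyC1; apply: weightedC.
by rewrite ltnNge ltnW //= gtn_eqF.
Qed.

(** For e = 0 the predecessor of e is truncated and [graded_deriv] does not apply to q; in that case
    q = 1 has zero derivative. *)
Lemma graded_wronskian d e p q : (0 < d)%N -> q = 1 \/ (0 < e)%N ->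
  graded d p -> graded e q -> graded (d + e - 1) (wronskian p q).
Proof.
move=> d0 e0 hp hq; rewrite /wronskian.
have h1 : graded (d + e - 1) (p^`() * q).
  have -> : (d + e - 1 = d.-1 + e)%N by lia.
  by apply: gradedM => //; apply: graded_deriv; rewrite prednK.
case: e0 => [q1|e0].
  by move: h1; rewrite q1 -polyC1 derivC mulr0 subr0.
apply: (gradedB h1).
have -> : (d + e - 1 = d + e.-1)%N by lia.
by apply: gradedM => //; apply: graded_deriv; rewrite prednK.
Qed.

End GradedPolynomials.

Section Generic.
Variable k : fieldType.

Definition generic N : nat -> {mpoly k[N]} := extend (fun i : 'I_N => 'X_i).

Lemma eval_generic N (x : 'I_N -> k) : meval x \o generic N = extend x.
Proof.
by apply/funext => i; rewrite /generic /extend /=; case: insubP => [o _ _|_] //=; rewrite ?mevalXU ?meval0.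
Qed.

End Generic.

(** * Finiteness of the Wronski map *)

Section WronskiFinite.
Variables (k : fieldType) (b al be r : nat).
Hypothesis char0 : [pchar k] =i pred0.
Hypothesis beal : (be < al)%N.
Local Notation M := (b + al + be + r)%N.
Local Notation e := (b + al + be - 1)%N.

Definition wronski_map (j : 'I_M) : {mpoly k[M]} := wronski b al be (generic k M) j.

Lemma wronski_mapE (x : 'I_M -> k) j : (wronski_map j).@[x] = wronski b al be (extend x) j.
Proof. by rewrite /wronski_map -[meval _ _]/((meval x : {rmorphism _ -> _}) _) map_wronski eval_generic. Qed.

(** Roots have weight 1, so the coefficient of t^i in a monic polynomial of degree d has weight d -
    i. The further parameters can have any positive weight. *)
Definition weight (i : nat) : nat :=
  if (i < b)%N then (b - i)%N else if (i < b + al)%N then (b + al - i)%N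
  else if (i < b + al + be)%N then (b + al + be - i)%N else 1%N.

Definition wronski_weight (j : nat) : nat :=
  if (j < e)%N then (e - j)%N else if j == e then (al - be)%N else 1%N.

Lemma wronski_weight_gt0 j : (0 < wronski_weight j)%N.
Proof. by rewrite /wronski_weight; do ![case: ifP => //]; lia. Qed.

Lemma generic_weighted i : (i < M)%N -> weighted (fun i : 'I_M => weight i) (weight i) (generic k M i).
Proof.
move=> iM; rewrite /generic (extend_lt _ iM).
exact: (@weightedX k M (fun i : 'I_M => weight i) (Ordinal iM)).
Qed.

Lemma wronski_map_weighted (j : 'I_M) :
  weighted (fun i : 'I_M => weight i) (wronski_weight j) (wronski_map j).
Proof.
have jM := ltn_ord j; rewrite /wronski_map /wronski /wronski_weight.
have gw i w : (i < M)%N -> weight i = w -> weighted (fun i : 'I_M => weight i) w (generic k M i).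
  by move=> iM <-; apply: generic_weighted.
case: ifP => je; last first.
  by case: ifP => je'; apply: gw; rewrite ?/weight; do ?[case: ifP]; lia.
have gr : graded (fun i : 'I_M => weight i) e (wronski_poly b al be (generic k M)).
  have -> : e = (b + (al + be - 1))%N by lia.
  apply: gradedM.
    by apply: graded_monic => i ib; apply: gw; rewrite ?/weight; do ?[case: ifP]; lia.
  apply: graded_wronskian; first by lia.
  - case: be => [|b']; [left|by right].
    apply/polyP => i; rewrite coef_monic_poly coef1 /=.
    by case: i.
  - by apply: graded_monic => i ib; apply: gw; rewrite ?/weight; do ?[case: ifP]; lia.
  - by apply: graded_monic => i ib; apply: gw; rewrite ?/weight; do ?[case: ifP]; lia.
by apply: (gr j).1; apply: ltnW.
Qed.

Lemma wronski_finite : finite_over wronski_map.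
Proof.
apply: (@weighted_finite _ _ (fun i : 'I_M => weight i) _ _ (fun j => wronski_weight j)).
- by move=> j; apply: wronski_weight_gt0.
- by move=> j; apply: wronski_map_weighted.
move=> D phi h i.
(* The domain receives k through [phi], hence inherits characteristic 0. *)
have charD n : n.+1%:R != 0 :> D.
  have u : (n.+1%:R : k) != 0 by rewrite (pcharf0P k).1.
  apply/eqP => e0; have := rmorph1 (phi \o @mpolyC M k : {rmorphism k -> D}).
  rewrite -(mulfV u) rmorphM /= [X in X * _](_ : _ = 0) ?mul0r.
    by move/esym/eqP; rewrite oner_eq0.
  by rewrite -[RHS]e0 mpolyC_nat rmorph_nat.
have := @wronski_trivial_zero b al be beal D charD (phi \o generic k M) M (leq_addr _ _).
move=> /(_ _ i (ltn_ord i)) /=; rewrite {2}/generic extendE; apply=> j jM.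
by rewrite -map_wronski -[j]/(nat_of_ord (Ordinal jM)); exact: h.
Qed.

End WronskiFinite.

(** * The linear system of a pencil *)

Section Functional.
Variable R : comNzRingType.
Implicit Types (p q : {poly R}) (f : nat -> R).

(** The pairing [pair] over any ring, so that it can be formed with generic coordinates and then
    specialised. *)
Definition fpair m f p : R := \sum_(i < m) f i * p`_i.

Lemma fpairD m f p q : fpair m f (p + q) = fpair m f p + fpair m f q.
Proof. by rewrite -big_split; apply: eq_bigr => i _; rewrite coefD mulrDr. Qed.

Lemma fpairZ m f a p : fpair m f (a *: p) = a * fpair m f p.
Proof. by rewrite mulr_sumr; apply: eq_bigr => i _; rewrite coefZ mulrCA. Qed.

Lemma fpair0 m f : fpair m f 0 = 0.
Proof. by rewrite -[0](scale0r (0 : {poly R})) fpairZ mul0r. Qed.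

Lemma fpairB m f p q : fpair m f (p - q) = fpair m f p - fpair m f q.
Proof. by rewrite -scaleN1r fpairD fpairZ mulN1r. Qed.

Lemma fpair_sum m f (I : Type) (r : seq I) (P : pred I) (u : I -> {poly R}) :
  fpair m f (\sum_(i <- r | P i) u i) = \sum_(i <- r | P i) fpair m f (u i).
Proof. by elim/big_rec2: _ => [|i x y _ <-]; rewrite ?fpair0 ?fpairD. Qed.

Lemma fpairXn m f i : (i < m)%N -> fpair m f 'X^i = f i.
Proof.
move=> im; rewrite /fpair (bigD1 (Ordinal im)) //= coefXn eqxx mulr1 big1 ?addr0 // => j ji.
rewrite coefXn; case: eqP => [e|_]; last by rewrite mulr0.
by case/eqP: ji; apply: val_inj.
Qed.

Lemma fpair_mul m f p q N : (size p <= N)%N ->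
  fpair m f (p * q) = \sum_(i < N) p`_i * fpair m f ('X^i * q).
Proof.
move=> sp; have {1}-> : p = \sum_(i < N) p`_i *: 'X^i.
  rewrite -poly_def; apply/polyP => i; rewrite coef_poly; case: ltnP => // iN.
  by rewrite nth_default // (leq_trans sp).
rewrite mulr_suml fpair_sum; apply: eq_bigr => i _.
by rewrite -scalerAl fpairZ.
Qed.

Lemma fpair_mul0 m f p q N : (size p <= N)%N ->
  (forall i, (i < N)%N -> fpair m f ('X^i * q) = 0) -> fpair m f (p * q) = 0.
Proof. by move=> sp h; rewrite (fpair_mul _ _ _ sp) big1 // => i _; rewrite h ?mulr0. Qed.

Lemma eq_fpair m f f' p : (forall i, (i < m)%N -> f i = f' i) -> fpair m f p = fpair m f' p.
Proof. by move=> h; apply: eq_bigr => i _; rewrite h. Qed.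

End Functional.

Lemma map_fpair (R S : comNzRingType) (h : {rmorphism R -> S}) m f p :
  h (fpair m f p) = fpair m (h \o f) (map_poly h p).
Proof. by rewrite rmorph_sum; apply: eq_bigr => i _; rewrite rmorphM coef_map. Qed.

Lemma pairE (k : fieldType) m (v : 'rV[k]_m) p : pair v p = fpair m (extend (v ord0)) p.
Proof. by apply: eq_bigr => i _; rewrite extendE. Qed.

Section Bezout.
Variable k : fieldType.

Lemma bezout_bounded (m1 m2 Q : {poly k}) N al be : coprimep m1 m2 ->
  size m1 = al.+1 -> size m2 = be.+1 -> (be < al)%N -> (al <= N)%N -> (size Q <= N + al)%N ->
  exists q1 q2 : {poly k}, [/\ (size q1 <= N)%N, (size q2 <= N)%N & Q = q1 * m1 + q2 * m2].
Proof.
move=> /Bezout_eq1_coprimepP [[u1 u2] /= e] s1 s2 beal alN sQ.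
have m10 : m1 != 0 by rewrite -size_poly_eq0 s1.
pose q2 := (Q * u2) %% m1; pose q1 := Q * u1 + (Q * u2) %/ m1 * m2.
have eQ : Q = q1 * m1 + q2 * m2.
  have := divp_eq (Q * u2) m1; rewrite /q1 /q2.
  move: (_ %/ _) (_ %% _) => d r0 dv.
  rewrite -[LHS]mulr1 -e mulrDr [Q * (u2 * m2)]mulrA dv; ring.
have sq2 : (size q2 <= al)%N by rewrite -ltnS -s1 ltn_modp.
exists q1, q2; split=> //; last exact: leq_trans sq2 alN.
have [->|q10] := eqVneq q1 0; first by rewrite size_poly0.
have : (size (q1 * m1)%R <= N + al)%N.
  have -> : q1 * m1 = Q - q2 * m2 by rewrite [in RHS]eQ addrK.
  rewrite (leq_trans (size_polyD _ _)) // geq_max sQ size_polyN.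
  by rewrite (leq_trans (size_polyMleq _ _)) // s2 addnS /= (addnC N) leq_add // (leq_trans (ltnW beal)).
by rewrite size_mul // s1 addnS /= leq_add2r.
Qed.

End Bezout.

Section LinearSystem.
Variables (g n b al be : nat).
Local Notation N := (g - n)%N.
Local Notation L := (N + N + (n - al))%N.

(** By coprimality the equations reach exactly h times the polynomials of degree below g - n + al. A
    complement in degree below g consists of the remainders modulo h, of degree below b, and the
    monomials from t^(g-n+al+b) on: n - al in all. *)
Definition free_index l := if (l < b)%N then l else (g - n + al + l)%N.

(* The equations determining the parameter [G] of a line bundle with sections [h m1], [h m2],
   completed by fixing the coordinates of [G] that these equations leave free. *)
Definition row_poly (R : comNzRingType) (xs : nat -> R) l : {poly R} :=
  if (l < N)%N then 'X^l * (base_poly b xs * pencil1 b al xs)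
  else if (l < N + N)%N then 'X^(l - N) * (base_poly b xs * pencil2 b al be xs)
  else 'X^(free_index (l - (N + N))).

Definition row_rhs (R : comNzRingType) (f xs : nat -> R) l : R :=
  if (l < N)%N then - fpair (g - 2) f ('X^l * (base_poly b xs * pencil1 b al xs)^`())
  else if (l < N + N)%N then
    - fpair (g - 2) f ('X^(l - N) * (base_poly b xs * pencil2 b al be xs)^`())
  else xs (b + al + be + (l - (N + N)))%N.

Definition system_mx (R : comNzRingType) (xs : nat -> R) : 'M[R]_(L, g) :=
  \matrix_(l, i) (row_poly xs l)`_i.

Definition system_rhs (R : comNzRingType) (f xs : nat -> R) : 'cV[R]_L :=
  \col_l row_rhs f xs l.

Lemma map_row_poly (R S : comNzRingType) (h : {rmorphism R -> S}) xs l :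
  map_poly h (row_poly xs l) = row_poly (h \o xs) l.
Proof.
rewrite /row_poly; case: ifP => _.
  by rewrite !rmorphM /= map_polyXn !map_monic_poly.
case: ifP => _; last by rewrite map_polyXn.
by rewrite !rmorphM /= map_polyXn !map_monic_poly.
Qed.

Lemma map_row_rhs (R S : comNzRingType) (h : {rmorphism R -> S}) f xs l :
  h (row_rhs f xs l) = row_rhs (h \o f) (h \o xs) l.
Proof.
rewrite /row_rhs; case: ifP => _.
  by rewrite rmorphN map_fpair rmorphM /= map_polyXn -deriv_map rmorphM /= !map_monic_poly.
case: ifP => _ //.
by rewrite rmorphN map_fpair rmorphM /= map_polyXn -deriv_map rmorphM /= !map_monic_poly.
Qed.

Lemma map_system_mx (R S : comNzRingType) (h : {rmorphism R -> S}) xs :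
  map_mx h (system_mx xs) = system_mx (h \o xs).
Proof. by apply/matrixP => l i; rewrite !mxE -coef_map map_row_poly. Qed.

Lemma map_system_rhs (R S : comNzRingType) (h : {rmorphism R -> S}) f xs :
  map_mx h (system_rhs f xs) = system_rhs (h \o f) (h \o xs).
Proof. by apply/colP => l; rewrite !mxE map_row_rhs. Qed.

Lemma mul_system_mx (R : comNzRingType) (xs : nat -> R) (G : 'cV[R]_g) l :
  (system_mx xs *m G) l ord0 = fpair g (extend (fun i => G i ord0)) (row_poly xs l).
Proof. by rewrite !mxE; apply: eq_bigr => i _; rewrite !mxE extendE mulrC. Qed.

Hypotheses (beal : (be < al)%N) (baln : (b + al <= n)%N) (ng : (n + n < g)%N).

(** As a functional G kills every polynomial: high monomials by the free rows, the quotient part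
    after division by h through Bezout with bounded degrees, and the remainder by the free rows
    again. *)
Lemma system_injective (k : fieldType) (xs : nat -> k) (G : 'cV[k]_g) :
  coprimep (pencil1 b al xs) (pencil2 b al be xs) -> system_mx xs *m G = 0 -> G = 0.
Proof.
move=> cop AG; set Gx := extend (fun i => G i ord0).
have rows l : (l < L)%N -> fpair g Gx (row_poly xs l) = 0.
  move=> lL; have := congr1 (fun u : 'cV_L => u (Ordinal lL) ord0) AG.
  by rewrite mul_system_mx mxE.
have r1 j : (j < N)%N -> fpair g Gx ('X^j * (base_poly b xs * pencil1 b al xs)) = 0.
  by move=> jN; rewrite -[RHS](rows j) ?/row_poly ?jN //; lia.
have r2 j : (j < N)%N -> fpair g Gx ('X^j * (base_poly b xs * pencil2 b al be xs)) = 0.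
  move=> jN; rewrite -[RHS](rows (N + j)%N) /row_poly; last by lia.
  by rewrite ifF ?ltn_add2l ?jN ?addKn //; lia.
have free l : (l < n - al)%N -> Gx (free_index l) = 0.
  move=> ln; rewrite -[LHS](@fpairXn _ g); last by rewrite /free_index; case: ifP; lia.
  rewrite -[RHS](rows (N + N + l)%N) /row_poly; last by lia.
  by rewrite ifF ?ifF ?addKn //; lia.
have low j : (j < b)%N -> Gx j = 0.
  by move=> jb; have := free j; rewrite /free_index jb; apply; lia.
have high j : (g - n + al + b <= j)%N -> (j < g)%N -> Gx j = 0.
  move=> jl jg; have := free (j - (g - n + al))%N; rewrite /free_index ifF; last by lia.
  by rewrite subnKC; last lia; apply; lia.
have all P : fpair g Gx P = 0.
  set t := (g - n + al + b)%N; set h := base_poly b xs.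
  have -> : fpair g Gx P = fpair g Gx (take_poly t P).
    apply: eq_bigr => i _; rewrite coef_take_poly; case: ltnP => // ti.
    by rewrite high // !mul0r.
  rewrite (divp_eq (take_poly t P) h) fpairD.
  have h0 : h != 0 by exact: monic_neq0 (monic_monic_poly b xs 0).
  have sh : size h = b.+1 by exact: size_monic_poly.
  have sr : (size (take_poly t P %% h)%R <= b)%N by rewrite -ltnS -sh ltn_modp.
  have sQ : (size (take_poly t P %/ h)%R <= N + al)%N.
    by rewrite size_divp // sh /= leq_subLR addnC; apply: leq_trans (size_take_poly _ _) _.
  have alN : (al <= N)%N by lia.
  have [q1 [q2 [s1 s2 ->]]] := bezout_bounded cop (size_monic_poly _ _ _) (size_monic_poly _ _ _)
    beal alN sQ.
  rewrite mulrDl -!mulrA fpairD (mulrC _ h) (mulrC _ h).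
  rewrite (fpair_mul0 s1 r1) (fpair_mul0 s2 r2) !add0r.
  apply: big1 => i _; case: (ltnP i b) => ib; first by rewrite low ?mul0r.
  by rewrite nth_default ?mulr0 // (leq_trans sr).
apply/colP => i; rewrite mxE -(extendE (fun i => G i ord0)) -/Gx.
by rewrite -(@fpairXn _ g Gx i (ltn_ord i)) all.
Qed.

(** A nonzero maximal minor lets Cramer's rule express G rationally through the pencil. *)
Lemma system_full (k : fieldType) (xs : nat -> k) :
  coprimep (pencil1 b al xs) (pencil2 b al be xs) ->
  exists f : 'I_g -> 'I_L, \det (rowsub f (system_mx xs)) != 0.
Proof.
move=> cop; have full : row_full (system_mx xs).
  have : kermx (system_mx xs)^T == 0.
    apply/eqP/row_matrixP => i; rewrite row0; apply: trmx_inj; rewrite trmx0.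
    apply: (system_injective cop); apply: trmx_inj.
    by rewrite trmx_mul trmxK -row_mul mulmx_ker row0 trmx0.
  by rewrite -mxrank_eq0 mxrank_ker subn_eq0 mxrank_tr => rk; rewrite /row_full eqn_leq rk rank_leq_col.
exists (fullrankfun full).
by rewrite -unitfE -unitmxE -row_full_unit fullrowsub_full.
Qed.

End LinearSystem.

(** * The upper bound *)

Section Hankel.

Definition hankel (R : comNzRingType) (f : nat -> R) s := \matrix_(i < s, j < s) f (i + j)%N.

Lemma map_hankel (R S : comNzRingType) (h : {rmorphism R -> S}) f s :
  map_mx h (hankel f s) = hankel (h \o f) s.
Proof. by apply/matrixP => i j; rewrite !mxE. Qed.

Definition hankel_rhs (R : comNzRingType) (f : nat -> R) s e (u : nat -> R) : 'cV[R]_s :=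
  - \col_(i < s) \sum_(s <= l < e.+1) f (i + l)%N * u l.

(** The first s unknowns are split off, so that an invertible Hankel matrix expresses them through
    the remaining ones. *)
Lemma hankelE (R : comNzRingType) (f : nat -> R) s e (u : nat -> R) : (s <= e)%N ->
  (forall i, (i < s)%N -> \sum_(j < e.+1) f (i + j)%N * u j = 0) <->
  hankel f s *m (\col_(j < s) u j) = hankel_rhs f s e u.
Proof.
move=> se.
have split_sum i : \sum_(j < e.+1) f (i + j)%N * u j =
    \sum_(j < s) f (i + j)%N * u j + \sum_(s <= l < e.+1) f (i + l)%N * u l.
  rewrite -(big_mkord xpredT (fun j => f (i + j)%N * u j)) (big_cat_nat (n := s)) //=.
    by rewrite big_mkord.
  exact: leqW.
split=> [h|h i si].
  apply/colP => i; rewrite !mxE; apply/eqP; rewrite -addr_eq0; apply/eqP.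
  by rewrite -[RHS](h i) // split_sum; congr (_ + _); apply: eq_bigr => j _; rewrite !mxE.
have := congr1 (fun w : 'cV_s => w (Ordinal si) ord0) h; rewrite !mxE => /eqP.
rewrite -addr_eq0 => /eqP e0; rewrite -[RHS]e0 split_sum; congr (_ + _).
by apply: eq_bigr => j _; rewrite !mxE.
Qed.

Lemma fpair_shift (R : comNzRingType) (f : nat -> R) m i e (p : {poly R}) :
  (i + e < m)%N -> (size p <= e.+1)%N ->
  fpair m f ('X^i * p) = \sum_(j < e.+1) f (i + j)%N * p`_j.
Proof.
move=> iem sp; rewrite mulrC (fpair_mul _ _ _ sp); apply: eq_bigr => j _.
by rewrite -exprD fpairXn 1?addnC 1?mulrC //; have := ltn_ord j; lia.
Qed.

End Hankel.

Lemma growth_empty (k : fieldType) (T : Type) (S : set T) N (X : T -> 'I_N -> k) d :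
  (forall p, ~ S p) -> growth S X d.
Proof.
move=> S0; exists 0%N => D; exists 'I_0, (fun _ _ => 0); split; first by rewrite card_ord.
by move=> f _; exists (fun=> 0) => p /S0.
Qed.

Section UpperBound.
Variables (k : fieldType) (g n : nat) (F : 'rV[k]_(g - 2)).
Hypothesis char0 : [pchar k] =i pred0.
Hypothesis ng : (2 * n + 1 <= g)%N.
Local Notation Fx := (extend (F ord0)).
(** The range is that in which all entries are true coefficients of F: the largest index is 2s - 2
    <= g - 3. *)
Hypothesis generic_F : forall s, (2 * s <= g - 1)%N -> \det (hankel Fx s) != 0.

Section Stratum.
Variables (b al be : nat).
Hypotheses (beal : (be < al)%N) (baln : (b + al <= n)%N).
Local Notation e := (b + al + be - 1)%N.
Local Notation s := (g - n - al)%N.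
Local Notation r := (n - al)%N.
Local Notation M := (b + al + be + r)%N.
Local Notation L := (g - n + (g - n) + r)%N.

(** The range of i comes from testing sections against t^i m1 and t^i m2, whose size may be at most
    g - n. The last n - al coordinates carry the free coordinates of G. *)
Definition wronski_locus : set ('I_M -> k) :=
  [set x | (forall i, (i < s)%N -> fpair (g - 2) Fx ('X^i * wronski_poly b al be (extend x)) = 0)
           /\ extend x (b + be)%N = 0].

Lemma wronski_locus_hankel (x : 'I_M -> k) : wronski_locus x -> forall i, (i < s)%N ->
  \sum_(j < e.+1) Fx (i + j)%N * (wronski_poly b al be (extend x))`_j = 0.
Proof.
move=> [h _] i si; rewrite -(@fpair_shift _ Fx (g - 2)) ?h // ?size_wronski_poly //; lia.
Qed.

(** If e < s, the invertible Hankel matrix of size e + 1 would annihilate the coefficients of the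
    Wronskian, whose leading one is al - be, nonzero in characteristic 0. *)
Lemma wronski_locus_bound x : wronski_locus x -> (s <= e)%N.
Proof.
move=> /wronski_locus_hankel h; rewrite leqNgt; apply/negP => es.
have H0 : \det (hankel Fx e.+1) != 0 by apply: generic_F; lia.
set p := wronski_poly b al be (extend x) in h.
have : hankel Fx e.+1 *m (\col_(j < e.+1) p`_j) = 0.
  apply/colP => i; rewrite !mxE -[RHS](h i); last by have := ltn_ord i; lia.
  by apply: eq_bigr => j _; rewrite !mxE.
move/(congr1 (mulmx (invmx (hankel Fx e.+1)))); rewrite mulmxA mulVmx ?unitmxE ?unitfE //.
rewrite mul1mx mulmx0 => /colP /(_ ord_max) /=; rewrite !mxE /= lead_wronski_poly //.
move=> e0; have : al%:R = be%:R :> k by apply/eqP; rewrite -subr_eq0 e0.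
move=> /eqP; rewrite -subr_eq0 -natrB ?(ltnW beal) // (pcharf0P k).1 //; lia.
Qed.

(** By finiteness it suffices to bound the image, which is parametrised by e - s lower coefficients
    of the Wronskian and the r further parameters: the Hankel matrix gives the first s, and slot e
    is zero. *)
Lemma growth_wronski_locus : growth wronski_locus (fun x => x) (e - s + r).
Proof.
case: (pselect (exists x, wronski_locus x)) => [[x0 /wronski_locus_bound se]|n0]; last first.
  by apply: growth_empty => x Wx; apply: n0; exists x.
apply: (@growth_finite _ _ _ _ _ (@wronski_map k b al be r)); first exact: wronski_finite.
pose N := (e - s + r)%N; pose Y := generic k N.
pose c : k := al%:R - be%:R.
(* The generic tail of the Wronskian, ending with its constant leading coefficient. *)
pose Z l : {mpoly k[N]} := if (l < e)%N then Y (l - s)%N else c%:MP.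
have H0 : \det (hankel Fx s) != 0 by apply: generic_F; lia.
pose psi (j : 'I_M) : {mpoly k[N]} :=
  if insub (j : nat) is Some o then
   (map_mx (@mpolyC N k) (invmx (hankel Fx s)) *m hankel_rhs (@mpolyC N k \o Fx) s e Z) o ord0
  else if (j < e)%N then Y (j - s)%N else if j == e :> nat then 0 else Y (j - s - 1)%N.
apply: (@growth_image _ _ _ _ [set: 'I_N -> k] M N _ (fun y => y) psi 1); last exact: growth_full.
move=> x Wx; set p := wronski_poly b al be (extend x).
pose u j := wronski b al be (extend x) j.
(* The slot e, which vanishes on the locus, is skipped. *)
pose y (l : 'I_N) := if (l < e - s)%N then u (s + l)%N else u (s + l + 1)%N.
exists y => //; split; first by rewrite meval1 oner_neq0.
have Yy l : (Y l).@[y] = extend y l by rewrite -[LHS]/((meval y \o Y) l) eval_generic.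
have Yl l : (s <= l)%N -> (l < e)%N -> (Y (l - s)%N).@[y] = u l.
  move=> sl le; have lN : (l - s < N)%N by rewrite /N; lia.
  by rewrite Yy (extend_lt _ lN) /y /= ifT ?subnKC //; lia.
move=> j; rewrite meval1 mulr1 wronski_mapE -/(u j) /psi.
case: insubP => [o _ oj|]; last first.
  rewrite -leqNgt => sj; case: ltnP => je; first by rewrite Yl.
  case: eqP => [->|/eqP nje]; first by rewrite meval0 /u /wronski ltnn eqxx; case: Wx.
  have jN : (j - s - 1 < N)%N by have := ltn_ord j; rewrite /N; lia.
  by rewrite Yy (extend_lt _ jN) /y /= ifF; [congr u|]; lia.
have /hankelE := wronski_locus_hankel Wx; rewrite -/p => /(_ se) hp.
have -> : u j = (\col_(j < s) p`_j) o ord0.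
  by rewrite mxE oj /u /wronski ifT // (leq_trans _ se) // -oj ltn_ord.
have Hu : hankel Fx s \in unitmx by rewrite unitmxE unitfE.
rewrite -(mulKmx Hu (\col_(j < s) p`_j)) hp.
have -> : hankel_rhs Fx s e (fun j => p`_j) = map_mx (meval y) (hankel_rhs (@mpolyC N k \o Fx) s e Z).
  rewrite /hankel_rhs map_mxN; congr (- _); apply/colP => i; rewrite !mxE raddf_sum.
  apply: eq_big_nat => l /andP[sl le]; rewrite /= mevalM mevalC; congr (_ * _).
  rewrite /Z; case: ltnP => le'; first by rewrite Yl // /u /wronski le'.
  have -> : l = e by lia.
  by rewrite mevalC lead_wronski_poly.
set A := invmx _; set B := hankel_rhs _ _ _ _.
rewrite !mxE rmorph_sum; apply: eq_bigr => i _.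
by rewrite /= mevalM !mxE mevalC.
Qed.

Definition stratum : set 'rV[k]_g :=
  [set G | exists2 x, wronski_locus x &
     coprimep (pencil1 b al (extend x)) (pencil2 b al be (extend x)) /\
     system_mx g n b al be (extend x) *m G^T = system_rhs g n b al be Fx (extend x)].

(** Finitely many pieces, one for each choice of a maximal minor; on each, Cramer's rule makes G a
    rational image of the Wronski locus. *)
Lemma growth_stratum : growth stratum (fun G : 'rV_g => G ord0) (e - s + r).
Proof.
pose S (f : {ffun 'I_g -> 'I_L}) : set 'rV[k]_g := [set G | exists2 x, wronski_locus x &
   \det (rowsub f (system_mx g n b al be (extend x))) != 0 /\
     system_mx g n b al be (extend x) *m G^T = system_rhs g n b al be Fx (extend x)].
have sub : stratum `<=` [set G | exists f, S f G].
  move=> G [x Wx [cop sys]]; have ng' : (n + n < g)%N by lia.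
  have [f fx] := system_full beal baln ng' cop.
  by exists [ffun i => f i], x => //; split=> //; rewrite mxsub_ffunl.
suff gS f : growth (S f) (fun G : 'rV_g => G ord0) (e - s + r).
  have := growth_bigcup gS; apply: (@growth_image _ _ _ _ _ _ _ _ _ (fun i => 'X_i) 1) => G /sub SG.
  exists G => //; split; first by rewrite meval1 oner_neq0.
  by move=> i; rewrite meval1 mulr1 mevalXU.
pose A := rowsub f (system_mx g n b al be (generic k M)).
pose y := rowsub f (system_rhs g n b al be (@mpolyC M k \o Fx) (generic k M)).
apply: (@growth_image _ _ _ _ _ _ _ _ _ (fun i => (\adj A *m y) i ord0) (\det A)) growth_wronski_locus.
move=> G [x Wx [dx sys]]; exists x => //.
have eA : map_mx (meval x) A = rowsub f (system_mx g n b al be (extend x)).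
  by rewrite map_mxsub map_system_mx eval_generic.
have ey : map_mx (meval x) y = rowsub f (system_rhs g n b al be Fx (extend x)).
  rewrite map_mxsub map_system_rhs eval_generic; congr (rowsub _ (system_rhs _ _ _ _ _ _ _)).
  by apply/funext => i; rewrite /= mevalC.
have ed : (\det A).@[x] = \det (rowsub f (system_mx g n b al be (extend x))).
  by rewrite -eA det_map_mx.
split; first by rewrite ed.
move=> i; rewrite ed.
have -> : ((\adj A *m y) i ord0).@[x] = (map_mx (meval x) (\adj A *m y)) i ord0 by rewrite [RHS]mxE.
rewrite map_mxM map_mx_adj eA ey -sys -mul_rowsub_mx mulmxA mul_adj_mx mul_scalar_mx.
by rewrite !mxE mulrC.
Qed.

End Stratum.

Section Decomposition.
Variable G : 'rV[k]_g.
Local Notation Gx := (extend (G ord0)).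
Local Notation sec := (@pair_sec k g n F G).

Lemma sec_poly c (q : {poly k}) : sec c -> (size q <= g - n)%N ->
  fpair (g - 2) Fx (q * c^`()) + fpair g Gx (q * c) = 0.
Proof.
move=> sc sq; rewrite !(fpair_mul _ _ _ sq) -big_split big1 // => j _ /=.
by rewrite -mulrDr -!pairE sc // mulr0.
Qed.

Lemma sec_combination x y c1 c2 : sec c1 -> sec c2 -> sec (x *: c1 + y *: c2).
Proof.
move=> s1 s2 j jl; rewrite !pairE derivD !derivZ !mulrDr -!scalerAr !fpairD !fpairZ.
have := s1 j jl; have := s2 j jl; rewrite !pairE => e2 e1.
transitivity (x * (fpair (g - 2) Fx ('X^j * c1^`()) + fpair g Gx ('X^j * c1)) +
  y * (fpair (g - 2) Fx ('X^j * c2^`()) + fpair g Gx ('X^j * c2))); first by ring.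
by rewrite e1 e2 !mulr0 addr0.
Qed.

Lemma sec_scale x c : sec c -> sec (x *: c).
Proof. by move=> sc; have := sec_combination x 0 sc sc; rewrite scale0r addr0. Qed.

Lemma monic_pair : W1 F n G -> exists c1 c2 : {poly k}, [/\ c1 \is monic, c2 \is monic,
  (size c2 < size c1)%N, (size c1 <= n.+1)%N & sec c1 /\ sec c2].
Proof.
have ng' : (n <= g)%N by lia.
move/(W1P _ _ ng') => [c1 [c2 [z1 z2 s1 s2 free]]].
suff [d1 [d2 [d10 d20 lt sz [t1 t2]]]] : exists d1 d2 : {poly k}, [/\ d1 != 0, d2 != 0,
  (size d2 < size d1)%N, (size d1 <= n.+1)%N & sec d1 /\ sec d2].
  exists ((lead_coef d1)^-1 *: d1), ((lead_coef d2)^-1 *: d2).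
  rewrite !monicE !lead_coefZ !mulVf ?lead_coef_eq0 //.
  by rewrite !size_scale ?invr_eq0 ?lead_coef_eq0 //; split=> //; split; apply: sec_scale.
have c10 : c1 != 0.
  by apply/eqP => e; have [] := free 1 0; rewrite ?e ?scaler0 ?scale0r ?addr0 // => /eqP; rewrite oner_eq0.
have c20 : c2 != 0.
  by apply/eqP => e; have [] := free 0 1; rewrite ?e ?scaler0 ?scale0r ?addr0 // => _ /eqP; rewrite oner_eq0.
case: (ltngtP (size c1) (size c2)) => sz.
- by exists c2, c1.
- by exists c1, c2.
pose d := lead_coef c2 *: c1 + (- lead_coef c1) *: c2.
exists c1, d; split=> //; last by split=> //; apply: sec_combination.
  apply/eqP => /free [/eqP]; by rewrite lead_coef_eq0 (negbTE c20).
have c1s : (0 < size c1)%N by rewrite size_poly_gt0.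
rewrite -(prednK c1s) ltnS; apply/leq_sizeP => j; rewrite leq_eqVlt => /orP[/eqP <-|jl].
  by rewrite coefD !coefZ -lead_coefE sz -lead_coefE; ring.
have jz : (size c1 <= j)%N by rewrite -(prednK c1s).
by rewrite coefD !coefZ !nth_default -?sz // !mulr0 addr0.
Qed.

Lemma monic_polyE d (xs : nat -> k) o (p : {poly k}) : p \is monic -> size p = d.+1 ->
  (forall i, (i < d)%N -> xs (o + i)%N = p`_i) -> monic_poly d xs o = p.
Proof.
move=> pm sp h; apply/polyP => i; rewrite coef_monic_poly; case: ltnP => id; first exact: h.
case: eqP => [->|/eqP ne]; last by rewrite nth_default // sp ltn_neqAle eq_sym ne.
by move/eqP: pm; rewrite lead_coefE sp.
Qed.

Lemma stratum_pair b al be (h m1 m2 : {poly k}) : (be < al)%N -> (b + al <= n)%N ->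
  h \is monic -> m1 \is monic -> m2 \is monic ->
  size h = b.+1 -> size m1 = al.+1 -> size m2 = be.+1 -> m1`_be = 0 -> coprimep m1 m2 ->
  sec (h * m1) -> sec (h * m2) -> stratum b al be G.
Proof.
move=> beal baln hm m1m m2m sh sm1 sm2 m1be cop sec1 sec2.
pose xs i := if (i < b)%N then h`_i else if (i < b + al)%N then m1`_(i - b)
  else if (i < b + al + be)%N then m2`_(i - (b + al)) else Gx (free_index g n b al (i - (b + al + be))).
pose x (i : 'I_(b + al + be + (n - al))) := xs i.
have xE i : (i < b + al + be + (n - al))%N -> extend x i = xs i by apply: extend_id.
have Eh : base_poly b (extend x) = h.
  apply: (monic_polyE hm sh) => i ib; rewrite add0n xE; last by lia.
  by rewrite /xs ib.
have E1 : pencil1 b al (extend x) = m1.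
  apply: (monic_polyE m1m sm1) => i ib; rewrite xE; last by lia.
  by rewrite /xs ifF ?ltn_add2l ?ib ?addKn //; lia.
have E2 : pencil2 b al be (extend x) = m2.
  apply: (monic_polyE m2m sm2) => i ib; rewrite xE; last by lia.
  have l1 : (b + al + i < b)%N = false by lia.
  have l2 : (b + al + i < b + al)%N = false by lia.
  by rewrite /xs l1 l2 ltn_add2l ib addKn.
exists x; last split.
- split; last first.
    rewrite xE /xs; last by lia.
    by rewrite ifF ?ltn_add2l ?beal ?addKn //; lia.
  move=> i il; rewrite /wronski_poly Eh E1 E2.
  (* Testing h m1 against t^i m2 and h m2 against t^i m1 and subtracting cancels both G and h',
     which leaves F on t^i times the Wronski polynomial. *)
  have q1s : (size ('X^i * m2)%R <= g - n)%N.
    by rewrite size_mul ?monic_neq0 ?monicXn // size_polyXn sm2; lia.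
  have q2s : (size ('X^i * m1)%R <= g - n)%N.
    by rewrite size_mul ?monic_neq0 ?monicXn // size_polyXn sm1; lia.
  have := sec_poly sec1 q1s; have := sec_poly sec2 q2s => t2 t1.
  have := congr2 (fun u v : k => u - v) t1 t2.
  rewrite subr0 opprD addrACA -!fpairB => t.
  rewrite -[RHS]t [X in _ + X](_ : _ = 0) ?addr0; last first.
    by rewrite (_ : _ - _ = 0) ?fpair0 //; ring.
  by congr fpair; rewrite !derivM /wronskian; ring.
- by rewrite E1 E2.
apply/colP => i; rewrite mul_system_mx [RHS]mxE /row_poly /row_rhs Eh E1 E2.
have -> : extend (fun i => G^T i ord0) = Gx.
  by apply/funext => j; rewrite /extend; case: insub => // o; rewrite mxE.
have ii := ltn_ord i.
case: ifP => iN.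
  by apply/eqP; rewrite -addr_eq0 addrC -!pairE; apply/eqP/sec1.
case: ifP => iNN.
  by apply/eqP; rewrite -addr_eq0 addrC -!pairE; apply/eqP/sec2; lia.
rewrite fpairXn; last by rewrite /free_index; case: ifP; lia.
rewrite xE /xs; last by lia.
by rewrite !ifF ?addKn //; lia.
Qed.

Lemma W1_stratum : W1 F n G -> exists b al be, [/\ (be < al)%N, (b + al <= n)%N & stratum b al be G].
Proof.
case/monic_pair => c1 [c2 [mon1 mon2 lt sz [s1 s2]]].
pose h0 := gcdp c1 c2; pose l := lead_coef h0.
have c10 := monic_neq0 mon1; have c20 := monic_neq0 mon2.
have h00 : h0 != 0 by rewrite gcdp_eq0 negb_and c10.
have l0 : l != 0 by rewrite lead_coef_eq0.
pose h := l^-1 *: h0; pose n1 := l *: (c1 %/ h0); pose m2 := l *: (c2 %/ h0).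
have hm : h \is monic by rewrite monicE lead_coefZ mulVf.
have e1 : c1 = h * n1.
  by rewrite -scalerAl -scalerAr scalerA mulVf // scale1r mulrC divpK ?dvdp_gcdl.
have e2 : c2 = h * m2.
  by rewrite -scalerAl -scalerAr scalerA mulVf // scale1r mulrC divpK ?dvdp_gcdr.
have n1m : n1 \is monic by rewrite -(monicMl _ hm) -e1.
have m2m : m2 \is monic by rewrite -(monicMl _ hm) -e2.
have cop0 : coprimep n1 m2.
  by rewrite coprimepZl // coprimepZr // coprimep_div_gcd // c10.
clearbody h n1 m2.
pose b := (size h).-1; pose al := (size n1).-1; pose be := (size m2).-1.
have szm (p : {poly k}) : p \is monic -> size p = (size p).-1.+1.
  by move=> pm; rewrite prednK // size_poly_gt0 monic_neq0.
have sh : size h = b.+1 := szm _ hm.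
have sn1 : size n1 = al.+1 := szm _ n1m.
have sm2 : size m2 = be.+1 := szm _ m2m.
have sc1 : size c1 = (b + al).+1 by rewrite e1 size_mul ?monic_neq0 // sh sn1 addnS.
have sc2 : size c2 = (b + be).+1 by rewrite e2 size_mul ?monic_neq0 // sh sm2 addnS.
have beal : (be < al)%N by rewrite sc1 sc2 ltnS ltn_add2l in lt.
have baln : (b + al <= n)%N by rewrite sc1 in sz.
(* A multiple of m2 is subtracted to make the coefficient of t^be zero; coprimality and the pencil
   are unchanged. *)
pose a := n1`_be; pose m1 := n1 + (- a) *: m2.
have sm1 : size m1 = al.+1.
  by rewrite size_polyDl ?sn1 // (leq_ltn_trans (size_scale_leq _ _)) // sm2.
have m1m : m1 \is monic.
  rewrite monicE lead_coefDl -?monicE // sn1 (leq_ltn_trans (size_scale_leq _ _)) // sm2.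
  by [].
have m1be : m1`_be = 0.
  have m2be : m2`_be = 1 by move/eqP: m2m; rewrite lead_coefE.
  by rewrite coefD coefZ m2be mulr1 subrr.
have cop : coprimep m1 m2.
  by rewrite coprimep_sym /m1 addrC -mul_polyC coprimep_addl_mul coprimep_sym.
have sec1 : sec (h * m1).
  have -> : h * m1 = 1 *: c1 + (- a) *: c2.
    by rewrite scale1r e1 e2 scalerAr -mulrDr.
  exact: sec_combination.
have sec2 : sec (h * m2) by rewrite -e2.
exists b, al, be; split=> //; exact: (stratum_pair beal baln hm m1m m2m sh sm1 sm2 m1be cop sec1 sec2).
Qed.

End Decomposition.

(** On a nonempty stratum e - s + r = 2n - g + b + al + be - 1. Under b + al <= n and be < al this
    is largest for b = 0, al = n, be = n - 1, with value 4n - 2 - g. *)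
Lemma growth_W1 : growth (W1 F n) (fun G : 'rV_g => G ord0) (4 * n - 2 - g).
Proof.
pose S (t : 'I_n.+1 * 'I_n.+1 * 'I_n.+1) : set 'rV[k]_g :=
  [set G | [/\ (t.2 < t.1.2)%N, (t.1.1 + t.1.2 <= n)%N & stratum t.1.1 t.1.2 t.2 G]].
have gS t : growth (S t) (fun G : 'rV_g => G ord0) (4 * n - 2 - g).
  case: t => [[b al] be]; rewrite /S /=.
  case: (pselect (exists G : 'rV_g, [/\ (be < al)%N, (b + al <= n)%N & stratum b al be G])) =>
    [[G0 [beal baln [x Wx _]]]|n0]; last first.
    by apply: growth_empty => G SG; apply: n0; exists G.
  have se := wronski_locus_bound beal baln Wx.
  have := growth_stratum beal baln.
  move/(@growth_mono _ _ _ _ _ _ (4 * n - 2 - g)%N) => gr.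
  have {}gr : growth (stratum b al be) (fun G : 'rV_g => G ord0) (4 * n - 2 - g) by apply: gr; lia.
  apply: (@growth_image _ _ _ _ _ _ _ _ _ (fun i => 'X_i) 1) gr => G [_ _ SG].
  exists G => //; split; first by rewrite meval1 oner_neq0.
  by move=> i; rewrite meval1 mulr1 mevalXU.
have := growth_bigcup gS; apply: (@growth_image _ _ _ _ _ _ _ _ _ (fun i => 'X_i) 1) => G WG.
exists G; last first.
  split; first by rewrite meval1 oner_neq0.
  by move=> i; rewrite meval1 mulr1 mevalXU.
have [b [al [be [beal baln SG]]]] := W1_stratum WG.
have [bn aln ben] : [/\ (b < n.+1)%N, (al < n.+1)%N & (be < n.+1)%N] by split; lia.
by exists (Ordinal bn, Ordinal aln, Ordinal ben).
Qed.

End UpperBound.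

(** * The lower bound *)

Section Transport.
Variables (k : fieldType) (M N : nat).
Variables (W : set 'rV[k]_N) (phi : 'rV[k]_M -> 'rV[k]_N).
Variables (psi : 'I_N -> {mpoly k[M]}) (delta : {mpoly k[M]}).
Variables (psi' : 'I_M -> {mpoly k[N]}) (delta' : {mpoly k[N]}).
Variables (d : nat) (C : nat -> set 'rV[k]_M) (z0 : 'rV[k]_M).
Hypothesis C_chain : irreducible_chain setT d C.
Hypothesis phiE : forall z : 'rV_M, delta.@[z ord0] != 0 ->
  forall i, phi z ord0 i * delta.@[z ord0] = (psi i).@[z ord0].
Hypothesis phiW : forall z : 'rV_M, C d z -> delta.@[z ord0] != 0 -> W (phi z).
Hypothesis phiK : forall z : 'rV_M, C d z -> delta.@[z ord0] != 0 ->
  forall i, z ord0 i * delta'.@[phi z ord0] = (psi' i).@[phi z ord0].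
Hypotheses (Cz0 : C 0 z0) (dz0 : delta.@[z0 ord0] != 0) (dz0' : delta'.@[phi z0 ord0] != 0).

Let C_sub i j : (i <= j)%N -> (j <= d)%N -> C i `<=` C j.
Proof.
move=> /subnKC <-; elim: (j - i)%N => [|m IH]; first by rewrite addn0 => _ x.
rewrite addnS => h x Cx; have [sub _] := C_chain.2 (i + m)%N h.
by apply: sub; apply: IH => //; exact: ltnW.
Qed.

Let pull (f : {mpoly k[N]}) := homogenize psi delta (msize f) f.

Let pullE f (z : 'rV_M) : delta.@[z ord0] != 0 ->
  (pull f).@[z ord0] = delta.@[z ord0] ^+ msize f * f.@[phi z ord0].
Proof. by move=> dz; apply: homogenizeE => // i; apply: phiE. Qed.

Let image_closure i : set 'rV[k]_N :=
  [set x | W x /\ forall f : {mpoly k[N]}, (forall z : 'rV_M, C i z -> delta.@[z ord0] != 0 ->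
      f.@[phi z ord0] = 0) -> f.@[x ord0] = 0].

Let C_irr i : (i <= d)%N -> zariski_irreducible (C i).
Proof. by move=> id; have [_ h] := C_chain.1 i id. Qed.

Let mem_image i (z : 'rV_M) : (i <= d)%N -> C i z -> delta.@[z ord0] != 0 -> image_closure i (phi z).
Proof.
move=> id Cz dz; split; last by move=> f; apply.
by apply: phiW => //; apply: (C_sub id).
Qed.

(** Irreducibility follows by pulling functions back after clearing [delta], strictness by pushing
    an equation of [C i] forward through the inverse psi'/delta'. Neither denominator may vanish
    identically on a member, which the point z0 of the smallest member ensures. *)
Lemma transport_chain : irreducible_chain W d image_closure.
Proof.
have Cz i : (i <= d)%N -> C i z0 by move=> id; apply: (C_sub (leq0n i) id).
split=> i id; first split.
- exists [set x | forall f : {mpoly k[N]}, (forall z : 'rV_M, C i z -> delta.@[z ord0] != 0 ->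
      f.@[phi z ord0] = 0) -> f.@[x ord0] = 0]; last by apply/seteqP; split=> x.
  by exists [set f | forall z, C i z -> delta.@[z ord0] != 0 -> f.@[phi z ord0] = 0].
- apply: integral_irreducible; first by exists (phi z0); apply: mem_image => //; apply: Cz.
  move=> f h fh.
  have e z : C i z -> (pull f * (pull h * delta)).@[z ord0] = 0.
    move=> Ciz; rewrite !mevalM; have [->|dz] := eqVneq (delta.@[z ord0]) 0; first by rewrite !mulr0.
    have := fh _ (mem_image id Ciz dz); rewrite mevalM !pullE // => e0.
    by rewrite mulrA mulrACA e0 mulr0 mul0r.
  case: (irreducible_integral (C_irr id) e) => [h1|h1].
    left=> x [_ hx]; apply: hx => z Ciz dz; have := h1 z Ciz; rewrite pullE // => /eqP.
    by rewrite mulf_eq0 expf_eq0 (negbTE dz) andbF => /eqP.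
  case: (irreducible_integral (C_irr id) h1) => [h2|/(_ _ (Cz i id)) /eqP]; last by rewrite (negbTE dz0).
  right=> x [_ hx]; apply: hx => z Ciz dz; have := h2 z Ciz; rewrite pullE // => /eqP.
  by rewrite mulf_eq0 expf_eq0 (negbTE dz) andbF => /eqP.
have idl : (i <= d)%N by exact: ltnW.
have [sub nsub] := C_chain.2 i id.
split.
  move=> x [Wx hx]; split=> // f hf; apply: hx => z Ciz; apply: hf; exact: sub.
move=> XX.
have [[A [S eA] eC] _] := C_chain.1 i idl.
apply: nsub => z1 Cz1; rewrite eC eA setTI => p Sp /=.
have pC z : C i z -> p.@[z ord0] = 0 by rewrite eC eA => -[_]; apply.
(* The equation p of [C i], rewritten in the coordinates of the image. *)
pose P := homogenize psi' delta' (msize p) p.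
have PE z : C d z -> delta.@[z ord0] != 0 ->
    P.@[phi z ord0] = delta'.@[phi z ord0] ^+ msize p * p.@[z ord0].
  by move=> Cz' dz; apply: homogenizeE => // j; apply: phiK.
have P0 x : image_closure i.+1 x -> P.@[x ord0] = 0.
  move=> /XX [_]; apply=> z Ciz dz; rewrite PE ?pC ?mulr0 //.
  exact: (C_sub idl).
have e z : C i.+1 z -> (p * (delta * pull delta')).@[z ord0] = 0.
  move=> Ciz; rewrite !mevalM; have [->|dz] := eqVneq (delta.@[z ord0]) 0; first by rewrite mul0r mulr0.
  have := P0 _ (mem_image id Ciz dz); rewrite PE ?pullE //; last exact: (C_sub id).
  move=> /eqP; rewrite mulf_eq0 expf_eq0 => /orP[/andP[_ /eqP ->]|/eqP ->]; last by rewrite mul0r.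
  by rewrite !mulr0.
case: (irreducible_integral (C_irr id) e) => [->//|h].
have := h z0 (Cz _ id); rewrite mevalM pullE // => /eqP.
by rewrite !mulf_eq0 expf_eq0 (negbTE dz0) (negbTE dz0') !andbF.
Qed.

End Transport.

(** * Norms along finite maps and linear recurrences *)

Section Norm.
Variable k : fieldType.

(* Over [k[v]], the element [f] is integral; the lowest nonzero coefficient of an integral equation
   is a multiple of [f]. *)
Lemma finite_norm M M' (v : 'I_M' -> {mpoly k[M]}) (f : {mpoly k[M]}) : finite_over v -> f != 0 ->
  exists2 q : {mpoly k[M']}, q != 0 &
    forall x, f.@[x] = 0 -> q.@[fun j => (v j).@[x]] = 0.
Proof.
move=> [J [B [C F]]] f0.
have hB (h : {mpoly k[M]}) : exists a : J -> {mpoly k[M']}, h = \sum_j msubst v (a j) * B j.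
  by have [a [_ e]] := F (msize h) h (leqnSn _); exists a.
have [a ha] := choice (fun m => hB (f * B m)).
pose A := \matrix_(m < #|J|, n < #|J|) a (enum_val m) (enum_val n).
pose P := map_poly (msubst v) (char_poly A).
have Pm : P \is monic by apply: monic_map; apply: char_poly_monic.
have Pf : P.[f] = 0.
  (* A is the matrix of multiplication by f on the generators, so D kills their column. A nonzero
     determinant would make all generators vanish, although they span 1. *)
  pose D := f%:M - map_mx (msubst v) A.
  have -> : P.[f] = \det D.
    have -> : P.[f] = horner_eval f (map_poly (msubst v) (char_poly A)) by [].
    rewrite /char_poly -(det_map_mx (map_poly (msubst v))) -(det_map_mx (horner_eval f)).
    congr (\det _); apply/matrixP => m n; rewrite !mxE rmorphB /= rmorphMn /= map_polyX map_polyC.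
    by rewrite /horner_eval hornerD hornerN hornerC hornerMn hornerX.
  pose u := \col_(m < #|J|) B (enum_val m).
  have Du : D *m u = 0.
    apply/colP => m; rewrite mulmxBl mul_scalar_mx !mxE ha.
    apply/eqP; rewrite subr_eq0; apply/eqP.
    rewrite (reindex (@enum_val J predT)) /=; last exact: onW_bij (@enum_val_bij J).
    by apply: eq_bigr => n _; rewrite !mxE.
  have := congr1 (mulmx (\adj D)) Du; rewrite mulmxA mul_adj_mx mul_scalar_mx mulmx0 => du.
  apply/eqP; apply: contrapT => /negP dD.
  have B0 j : B j = 0.
    have := congr1 (fun w : 'cV_#|J| => w (enum_rank j) ord0) du; rewrite !mxE enum_rankK => /eqP.
    by rewrite mulf_eq0 (negbTE dD) => /eqP.
  have [a1 e1] := hB 1; have := oner_neq0 {mpoly k[M]}.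
  by rewrite e1 big1 ?eqxx // => j _; rewrite B0 mulr0.
(* As f is nonzero, f^i cancels from P(f) = 0; what remains shows that the coefficient of index i is
   a multiple of f. *)
have [i [Pi imin]] : exists i, P`_i != 0 /\ forall j, (j < i)%N -> P`_j = 0.
  have ex : exists i, P`_i != 0.
    by exists (size P).-1; rewrite -lead_coefE lead_coef_eq0 monic_neq0.
  have [i Pi h] := ex_minnP ex; exists i; split=> // j ji; apply/eqP.
  by apply: contraTT ji => /h; rewrite -leqNgt.
have eP : P = drop_poly i P * 'X^i.
  rewrite -[LHS](poly_take_drop i) [take_poly i P](_ : _ = 0) ?add0r //.
  by apply/polyP => j; rewrite coef_take_poly coef0; case: ifP => // /imin.
have Q0 : (drop_poly i P).[f] = 0.
  move/eqP: Pf; rewrite {1}eP hornerM hornerXn mulf_eq0 expf_eq0 (negbTE f0) andbF orbF.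
  by move/eqP.
exists (char_poly A)`_i.
  by apply: contra Pi => /eqP e; rewrite coef_map /= e rmorph0.
move=> x fx; rewrite -msubstE -coef_map -/P.
have := congr1 (meval x) Q0; rewrite meval0 -horner_map /= fx horner_coef0 coef_map coef_drop_poly add0n.
by [].
Qed.

End Norm.

Lemma hankel_antidiagonal (k : fieldType) s (f : nat -> k) :
  (forall i, f i = (i.+1 == s)%:R) -> \det (hankel f s) != 0.
Proof.
move=> fE; have HH : hankel f s *m hankel f s = 1%:M.
  apply/matrixP => i l; rewrite !mxE.
  rewrite (bigD1 (rev_ord i)) //= !mxE !fE /= [X in _ + X]big1 ?addr0.
    have il := ltn_ord i; have -> : ((i + (s - i.+1)).+1 == s) by apply/eqP; lia.
    rewrite mul1r; congr (_%:R); congr nat_of_bool.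
    by rewrite -val_eqE /=; have := ltn_ord l; lia.
  move=> j ji; rewrite !mxE !fE.
  case: eqP => [e|_]; last by rewrite mul0r.
  by case/eqP: ji; apply: val_inj => /=; lia.
have [u _] := mulmx1_unit HH.
by rewrite -unitfE -unitmxE.
Qed.

Section Recursion.
Variables (R : comNzRingType) (e : nat) (w q : nat -> R).

(* The linear recurrence sequence with characteristic polynomial [X^e + \sum_j w_j X^j] and initial
   values [q], continued for [t] steps and by [0] from there on. *)
Fixpoint recurrence t : nat -> R :=
  if t is t'.+1 then
    fun l => if l == (e + t')%N then - \sum_(j < e) w j * recurrence t' (t' + j) else recurrence t' l
  else fun l => if (l < e)%N then q l else 0.

Lemma recurrence_init t l : (l < e)%N -> recurrence t l = q l.
Proof.
by move=> le; elim: t => [|t IH] /=; [rewrite le|rewrite ifN ?IH //; apply/eqP; lia].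
Qed.

Lemma recurrence_stable t t' l : (t <= t')%N -> (l < e + t)%N -> recurrence t' l = recurrence t l.
Proof.
move=> /subnKC <- lt; elim: (t' - t)%N => [|m IH]; first by rewrite addn0.
by rewrite addnS /= ifN ?IH //; apply/eqP; lia.
Qed.

Lemma recurrenceE s i : (i < s)%N ->
  \sum_(j < e) w j * recurrence s (i + j) + recurrence s (e + i) = 0.
Proof.
move=> si; rewrite (@recurrence_stable i.+1) ?addnS //= eqxx addrC.
apply/eqP; rewrite addrC subr_eq0; apply/eqP; apply: eq_bigr => j _; congr (_ * _).
by apply: recurrence_stable; [exact: ltnW|have := ltn_ord j; lia].
Qed.

Lemma recurrence_unique s (f : nat -> R) : (forall l, (l < e)%N -> f l = q l) ->
  (forall i, (i < s)%N -> \sum_(j < e) w j * f (i + j)%N + f (e + i)%N = 0) ->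
  forall l, (l < e + s)%N -> recurrence s l = f l.
Proof.
move=> fq fw; elim/ltn_ind => l IH ls.
case: (ltnP l e) => le; first by rewrite recurrence_init ?fq.
have si : (l - e < s)%N by lia.
have := fw _ si; have := recurrenceE si; rewrite subnKC // => h1 h2.
apply: (addrI (\sum_(j < e) w j * f (l - e + j)%N)); rewrite h2 -[RHS]h1; congr (_ + _).
by apply: eq_bigr => j _; rewrite IH //; have := ltn_ord j; lia.
Qed.

End Recursion.

Lemma map_recurrence (R S : comNzRingType) (h : {rmorphism R -> S}) e w q t l :
  h (recurrence e w q t l) = recurrence e (h \o w) (h \o q) t l.
Proof.
elim: t l => [|t IH] l /=; first by case: ifP; rewrite ?rmorph0.
case: ifP => // _; rewrite rmorphN rmorph_sum; congr (- _); apply: eq_bigr => j _.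
by rewrite rmorphM IH.
Qed.

Lemma eq_recurrence (R : comNzRingType) e (w q w' q' : nat -> R) t l :
  (forall j, (j < e)%N -> w j = w' j) -> (forall j, (j < e)%N -> q j = q' j) ->
  recurrence e w q t l = recurrence e w' q' t l.
Proof.
move=> hw hq; elim: t l => [|t IH] l /=; first by case: ifP => // /hq.
by case: ifP => // _; congr (- _); apply: eq_bigr => j _; rewrite hw // IH.
Qed.

(** * Pencils of degrees n and n - 1 without base points *)

Section LowerPencils.
Variables (g n : nat).
Hypotheses (n_gt1 : (1 < n)%N) (ng : (2 * n + 1 <= g)%N).
Local Notation be := (n - 1)%N.
Local Notation e := (0 + n + be - 1)%N.
Local Notation s := (g - n - n)%N.
Local Notation wr xs := (wronski_poly 0 n be xs).
Local Notation c1 xs := (pencil1 0 n xs).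
Local Notation c2 xs := (pencil2 0 n be xs).

Let beal : (be < n)%N. Proof. by lia. Qed.

Lemma lead_wr (R : comNzRingType) (xs : nat -> R) : (wr xs)`_e = 1.
Proof. by rewrite lead_wronski_poly // -natrB ?leq_subr // subKn // ltnW. Qed.

(** The Wronskian has leading coefficient n - (n - 1) = 1, so the condition is a linear recurrence
    that determines f from its first e values. *)
Lemma killE (R : comNzRingType) (f xs : nat -> R) :
  (forall i, (i < s)%N -> fpair (g - 2) f ('X^i * wr xs) = 0) <->
  (forall i, (i < s)%N -> \sum_(j < e) (wr xs)`_j * f (i + j)%N + f (e + i)%N = 0).
Proof.
have E i : (i < s)%N -> fpair (g - 2) f ('X^i * wr xs) =
    \sum_(j < e) (wr xs)`_j * f (i + j)%N + f (e + i)%N.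
  move=> si; rewrite (@fpair_shift _ _ _ _ e) ?size_wronski_poly //; last by lia.
  rewrite big_ord_recr /= lead_wr mulr1 [(e + i)%N]addnC; congr (_ + _).
  by apply: eq_bigr => j _; rewrite mulrC.
by split=> h i si; [rewrite -E // h|rewrite E // h].
Qed.

Lemma base_poly0 (R : comNzRingType) (xs : nat -> R) : base_poly 0 xs = 1.
Proof. by apply/polyP => i; rewrite coef_monic_poly coef1. Qed.

Lemma wrE (R : comNzRingType) (xs : nat -> R) : wr xs = wronskian (c1 xs) (c2 xs).
Proof. by rewrite /wronski_poly base_poly0 mul1r. Qed.

Section Field.
Variable k : fieldType.
Implicit Types (xs f : nat -> k).

Lemma syzygy (m1 m2 q1 q2 : {poly k}) N al : coprimep m1 m2 -> size m1 = al.+1 ->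
  (size q2 <= N)%N -> q1 * m1 + q2 * m2 = 0 ->
  exists p : {poly k}, [/\ (size p <= N - al)%N, q1 = p * m2 & q2 = - (p * m1)].
Proof.
move=> cop s1 sq2 e0.
have m10 : m1 != 0 by rewrite -size_poly_eq0 s1.
have : m1 %| q2 * m2.
  by rewrite (_ : q2 * m2 = - q1 * m1) ?dvdp_mull // mulNr; apply/eqP; rewrite -addr_eq0 addrC e0.
rewrite Gauss_dvdpl // => /dvdpP [p ep]; exists (- p).
have q2E : q2 = - (- p * m1) by rewrite mulNr opprK.
split=> //; last first.
  apply: (mulIf m10); apply/eqP; rewrite -subr_eq0 -[X in _ == X]e0 ep; apply/eqP; ring.
rewrite size_polyN; have [->|p0] := eqVneq p 0; first by rewrite size_poly0.
move: sq2; rewrite ep size_mul // s1 addnS /=.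
by move=> h; rewrite leq_subRL ?(leq_trans _ h) ?leq_addl // addnC.
Qed.

Local Notation N := (g - n)%N.
Local Notation L := (N + N + (n - n))%N.
Local Notation sys xs := (system_mx g n 0 n be xs).
Local Notation rhs f xs := (system_rhs g n 0 n be f xs).

(** The right side has to be orthogonal to the left kernel of the matrix. A kernel vector is a
    syzygy of the coprime pair, hence (p m2, -p m1) with p of size at most s, and it pairs with the
    right side to -F(p (m1' m2 - m1 m2')) = 0. *)
Lemma system_solvable f xs : coprimep (c1 xs) (c2 xs) ->
  (forall i, (i < s)%N -> fpair (g - 2) f ('X^i * wr xs) = 0) ->
  exists G : 'cV[k]_g, sys xs *m G = rhs f xs.
Proof.
move=> cop kill; have sb : ((rhs f xs)^T <= (sys xs)^T)%MS.
  rewrite submxE; apply/eqP; apply: trmx_inj; rewrite trmx0 trmx_mul trmxK.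
  apply/row_matrixP => r; rewrite row_mul row0; set v := row r _.
  have vA : v *m sys xs = 0.
    rewrite -row_mul -[RHS](row0 _ _ r); congr row.
    by apply: trmx_inj; rewrite trmx_mul trmxK mulmx_coker trmx0.
  clearbody v.
  pose q1 := \poly_(l < N) (extend (v ord0)) l.
  pose q2 := \poly_(l < N) (extend (v ord0)) (N + l)%N.
  have lsum (F : nat -> k) : \sum_(l < L) F l = \sum_(l < N) F l + \sum_(l < N) F (N + l)%N.
    rewrite -(big_mkord xpredT F).
    have -> : L = (N + N)%N by rewrite subnn addn0.
    rewrite (big_cat_nat (n := N)) ?leq_addr //= big_mkord; congr (_ + _).
    by rewrite -{1}[N]add0n big_addn addnK big_mkord; apply: eq_bigr => l _; rewrite addnC.
  have e0 : q1 * c1 xs + q2 * c2 xs = 0.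
    have sz : (size (q1 * c1 xs + q2 * c2 xs)%R <= g)%N.
      rewrite (leq_trans (size_polyD _ _)) // geq_max.
      have b1 := size_poly N (extend (v ord0)).
      have b2 := size_poly N (fun l => extend (v ord0) (N + l)%N).
      rewrite !(leq_trans (size_polyMleq _ _)) // size_monic_poly addnS /=.
        by rewrite (leq_trans (leq_add b2 (leq_subr 1 n))) //; lia.
      by rewrite (leq_trans (leq_add b1 (leqnn n))) //; lia.
    apply/polyP => i; rewrite coef0; case: (ltnP i g) => ig; last by rewrite nth_default // (leq_trans sz).
    have := congr1 (fun u : 'rV_g => u ord0 (Ordinal ig)) vA; rewrite !mxE => h.
    rewrite -[RHS]h; under [RHS]eq_bigr => l _ do rewrite mxE /= -(extendE (v ord0)).
    rewrite (lsum (fun l => extend (v ord0) l * (row_poly g n 0 n be xs l)`_i)).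
    rewrite coefD /q1 /q2 !poly_def !mulr_suml !coef_sum; congr (_ + _); apply: eq_bigr => l _.
      by rewrite -scalerAl coefZ /row_poly ltn_ord base_poly0 mul1r.
    rewrite -scalerAl coefZ /row_poly ifF; last by lia.
    by rewrite ltn_add2l ltn_ord base_poly0 mul1r addKn.
  have [p [sp ep1 ep2]] := syzygy cop (size_monic_poly _ _ _) (size_poly _ _) e0.
  apply/rowP => i; rewrite ord1 !mxE.
  under eq_bigr => l _ do rewrite mxE -(extendE (v ord0)).
  rewrite (lsum (fun l => extend (v ord0) l * row_rhs g n 0 n be f xs l)).
  have -> : \sum_(l < N) extend (v ord0) l * row_rhs g n 0 n be f xs l =
     - fpair (g - 2) f (q1 * (c1 xs)^`()).
    rewrite /q1 poly_def mulr_suml fpair_sum -sumrN; apply: eq_bigr => l _.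
    by rewrite /row_rhs ltn_ord base_poly0 mul1r -scalerAl fpairZ mulrN.
  have -> : \sum_(l < N) extend (v ord0) (N + l)%N * row_rhs g n 0 n be f xs (N + l) =
     - fpair (g - 2) f (q2 * (c2 xs)^`()).
    rewrite /q2 poly_def mulr_suml fpair_sum -sumrN; apply: eq_bigr => l _.
    rewrite /row_rhs ifF; last by lia.
    by rewrite ltn_add2l ltn_ord base_poly0 mul1r addKn -scalerAl fpairZ mulrN.
  rewrite -opprD -fpairD.
  have -> : q1 * (c1 xs)^`() + q2 * (c2 xs)^`() = p * wr xs.
    transitivity (p * c2 xs * (c1 xs)^`() + - (p * c1 xs) * (c2 xs)^`()).
      by congr (_ * _ + _ * _).
    by rewrite wrE /wronskian; ring.
  by rewrite (fpair_mul0 sp kill) oppr0.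
have [D eD] := submxP sb.
by exists D^T; apply: trmx_inj; rewrite trmx_mul trmxK.
Qed.

End Field.

End LowerPencils.

Lemma fpair_delta (R : comNzRingType) m a (c : R) f (p : {poly R}) : (a < m)%N ->
  (forall i, (i < m)%N -> f i = c * (i == a)%:R) -> fpair m f p = c * p`_a.
Proof.
move=> am fE; rewrite /fpair (bigD1 (Ordinal am)) //= fE // eqxx mulr1 big1 ?addr0 // => j ja.
rewrite fE //; case: eqP => [e|_]; last by rewrite mulr0 mul0r.
by case/eqP: ja; apply: val_inj.
Qed.

Lemma eq_monic_poly (R : comNzRingType) d (xs ys : nat -> R) o :
  (forall i, (i < d)%N -> xs (o + i)%N = ys (o + i)%N) -> monic_poly d xs o = monic_poly d ys o.
Proof.
by move=> h; apply/polyP => i; rewrite !coef_monic_poly; case: ltnP => // id; rewrite h.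
Qed.

(** * The mutual determination of pencil and bundle, and an explicit example *)

Section GoodPencils.
Variables (g n : nat).
Hypotheses (n_gt1 : (1 < n)%N) (ng : (2 * n + 1 <= g)%N).
Local Notation be := (n - 1)%N.
Local Notation e := (0 + n + be - 1)%N.
Local Notation s := (g - n - n)%N.
Local Notation N := (g - n)%N.
Local Notation L := (N + N + (n - n))%N.
Local Notation M0 := (0 + n + be)%N.
Local Notation wr xs := (wronski_poly 0 n be xs).
Local Notation c1 xs := (pencil1 0 n xs).
Local Notation c2 xs := (pencil2 0 n be xs).
Local Notation sys xs := (system_mx g n 0 n be xs).
Local Notation rhs f xs := (system_rhs g n 0 n be f xs).

Let beal : (be < n)%N. Proof. by lia. Qed.

(* [c] of degree at most [n] is a section iff [sec_val f G j c = 0] for all [j < g - n]. *)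
Definition sec_val (R : comNzRingType) (f G : nat -> R) j (c : {poly R}) :=
  fpair (g - 2) f ('X^j * c^`()) + fpair g G ('X^j * c).

Lemma sec_valD (R : comNzRingType) (f G : nat -> R) j (c d : {poly R}) :
  sec_val f G j (c + d) = sec_val f G j c + sec_val f G j d.
Proof. by rewrite /sec_val derivD !mulrDr !fpairD; ring. Qed.

Lemma sec_valZ (R : comNzRingType) (f G : nat -> R) j a (c : {poly R}) :
  sec_val f G j (a *: c) = a * sec_val f G j c.
Proof. by rewrite /sec_val derivZ -!scalerAr !fpairZ; ring. Qed.

Lemma sec_val_poly (R : comNzRingType) (f G : nat -> R) j m (z : nat -> R) :
  sec_val f G j (\poly_(i < m) z i) = \sum_(i < m) z i * sec_val f G j 'X^i.
Proof.
rewrite poly_def; elim: m => [|m IH].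
  by rewrite !big_ord0 /sec_val deriv0 !mulr0 !fpair0 addr0.
by rewrite !big_ord_recr /= sec_valD IH sec_valZ.
Qed.

Lemma map_sec_val (R S : comNzRingType) (h : {rmorphism R -> S}) f G j c :
  h (sec_val f G j c) = sec_val (h \o f) (h \o G) j (map_poly h c).
Proof. by rewrite /sec_val rmorphD !map_fpair !rmorphM /= !map_polyXn deriv_map. Qed.

Lemma sec_val_scale (R : comNzRingType) (a : R) f G j (c : {poly R}) :
  sec_val (fun i => a * f i) (fun i => a * G i) j c = a * sec_val f G j c.
Proof.
rewrite /sec_val mulrDr /fpair !mulr_sumr; congr (_ + _); apply: eq_bigr => i _; ring.
Qed.

Lemma eq_sec_val (R : comNzRingType) (f f' G G' : nat -> R) j c :
  (forall i, (i < g - 2)%N -> f i = f' i) -> (forall i, (i < g)%N -> G i = G' i) ->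
  sec_val f G j c = sec_val f' G' j c.
Proof. by move=> hf hG; congr (_ + _); apply: eq_fpair. Qed.

(** Over a field its columns are independent exactly when no nonzero section has degree below n - 1;
    the low coefficients of the two sections can then be recovered from the bundle. *)
Definition second_mx (R : comNzRingType) (f G : nat -> R) : 'M[R]_(N, n - 1) :=
  \matrix_(j, i) sec_val f G j 'X^i.

Lemma map_second_mx (R S : comNzRingType) (h : {rmorphism R -> S}) f G :
  map_mx h (second_mx f G) = second_mx (h \o f) (h \o G).
Proof. by apply/matrixP => j i; rewrite !mxE map_sec_val map_polyXn. Qed.

Lemma mul_second_mx (R : comNzRingType) (f G z : nat -> R) (j : 'I_N) :
  (second_mx f G *m \col_(i < n - 1) z i) j ord0 = sec_val f G j (\poly_(i < n - 1) z i).
Proof. by rewrite sec_val_poly !mxE; apply: eq_bigr => i _; rewrite !mxE mulrC. Qed.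

Lemma pencil1E (R : comNzRingType) (xs : nat -> R) :
  c1 xs = ('X^n + xs (n - 1)%N *: 'X^(n - 1)) + \poly_(i < n - 1) xs i.
Proof.
rewrite -addrA; congr (_ + _); apply/polyP => i; rewrite coefD coefZ coefXn !coef_poly add0n.
case: (ltngtP i (n - 1)) => h.
- by rewrite ifT ?mulr0 ?add0r //; lia.
- by rewrite ifF ?mulr0 ?add0r //; lia.
- by rewrite h ifT ?mulr1 ?addr0 //; lia.
Qed.

Lemma pencil2E (R : comNzRingType) (xs : nat -> R) :
  c2 xs = 'X^(n - 1) + \poly_(i < n - 1) xs (n + i)%N.
Proof. by []. Qed.

Lemma system_sec (R : comNzRingType) (f xs : nat -> R) (G : 'cV[R]_g) : sys xs *m G = rhs f xs ->
  forall j, (j < N)%N -> sec_val f (extend (fun i => G i ord0)) j (c1 xs) = 0 /\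
    sec_val f (extend (fun i => G i ord0)) j (c2 xs) = 0.
Proof.
move=> eG j jN.
have jL : (j < L)%N by lia.
have jL' : (N + j < L)%N by lia.
have := congr1 (fun u : 'cV_L => u (Ordinal jL) ord0) eG.
have := congr1 (fun u : 'cV_L => u (Ordinal jL') ord0) eG.
rewrite !mul_system_mx !mxE /= /row_poly /row_rhs jN.
have -> : (N + j < N)%N = false by lia.
rewrite ltn_add2l jN addKn !base_poly0 !mul1r => e2 e1.
by rewrite /sec_val e1 e2 !subrr.
Qed.

Lemma eq_system_mx (R : comNzRingType) (xs ys : nat -> R) :
  (forall i, (i < M0)%N -> xs i = ys i) -> sys xs = sys ys.
Proof.
move=> h; apply/matrixP => l i; rewrite !mxE /row_poly !base_poly0.
have -> : c1 xs = c1 ys by apply: eq_monic_poly => j jn; apply: h; lia.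
by have -> : c2 xs = c2 ys by apply: eq_monic_poly => j jn; apply: h; lia.
Qed.

Lemma eq_system_rhs (R : comNzRingType) (f f' xs ys : nat -> R) :
  (forall i, (i < g - 2)%N -> f i = f' i) ->
  (forall i, (i < M0)%N -> xs i = ys i) -> rhs f xs = rhs f' ys.
Proof.
move=> hf h; apply/colP => l; rewrite !mxE /row_rhs !base_poly0.
have -> : c1 xs = c1 ys by apply: eq_monic_poly => j jn; apply: h; lia.
have -> : c2 xs = c2 ys by apply: eq_monic_poly => j jn; apply: h; lia.
case: ifP => _; first by rewrite (eq_fpair _ hf).
case: ifP => [_|hl]; first by rewrite (eq_fpair _ hf).
by have := ltn_ord l; lia.
Qed.

(** The ribbon that the Wronskian kills, with first e coefficients stored behind the pencil; s
    further steps reach all g - 2 coefficients. *)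
Definition ribbon_of (R : comNzRingType) (xs : nat -> R) : nat -> R :=
  recurrence e (fun j => (wr xs)`_j) (fun l => xs (M0 + l)%N) s.

Definition bundle_den (R : comNzRingType) (f : 'I_g -> 'I_L) (xs : nat -> R) : R :=
  \det (rowsub f (sys xs)).

Definition bundle_num (R : comNzRingType) (f : 'I_g -> 'I_L) (F xs : nat -> R) : 'cV[R]_g :=
  \adj (rowsub f (sys xs)) *m rowsub f (rhs F xs).

(* Nonzero when the pencil determines the line bundle and conversely.  The second factor is that of
   the bundle multiplied by the denominator [bundle_den], so as to be a polynomial in [xs]. *)
Definition good_den (R : comNzRingType) (f : 'I_g -> 'I_L) (f' : 'I_(n - 1) -> 'I_N)
    (xs : nat -> R) : R :=
  bundle_den f xs * \det (rowsub f' (second_mx (fun i => bundle_den f xs * ribbon_of xs i)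
     (extend (fun i => bundle_num f (ribbon_of xs) xs i ord0)))).

Lemma map_bundle_den (R S : comNzRingType) (h : {rmorphism R -> S}) f xs :
  h (bundle_den f xs) = bundle_den f (h \o xs).
Proof. by rewrite /bundle_den -det_map_mx map_mxsub map_system_mx. Qed.

Lemma map_bundle_num (R S : comNzRingType) (h : {rmorphism R -> S}) f F xs :
  map_mx h (bundle_num f F xs) = bundle_num f (h \o F) (h \o xs).
Proof. by rewrite map_mxM map_mx_adj !map_mxsub map_system_mx map_system_rhs. Qed.

Lemma map_ribbon_of (R S : comNzRingType) (h : {rmorphism R -> S}) xs :
  h \o ribbon_of xs = ribbon_of (h \o xs).
Proof.
apply/funext => l; rewrite /= map_recurrence; apply: eq_recurrence => j je //=.
by rewrite -coef_map map_wronski_poly.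
Qed.

Lemma map_good_den (R S : comNzRingType) (h : {rmorphism R -> S}) f f' xs :
  h (good_den f f' xs) = good_den f f' (h \o xs).
Proof.
rewrite rmorphM /= map_bundle_den -det_map_mx map_mxsub map_second_mx comp_extend.
have -> : h \o (fun i => bundle_den f xs * ribbon_of xs i) =
    (fun i => bundle_den f (h \o xs) * ribbon_of (h \o xs) i).
  by apply/funext => i; rewrite /= rmorphM map_bundle_den -map_ribbon_of.
have -> : h \o (fun i => bundle_num f (ribbon_of xs) xs i ord0) =
    (fun i => bundle_num f (ribbon_of (h \o xs)) (h \o xs) i ord0).
  by apply/funext => i; rewrite /= -map_ribbon_of -map_bundle_num [RHS]mxE.
by [].
Qed.

Section Field.
Variable k : fieldType.
Implicit Types (xs f : nat -> k).

Lemma bundle_numE (f : 'I_g -> 'I_L) F xs (G : 'cV[k]_g) : sys xs *m G = rhs F xs ->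
  bundle_num f F xs = bundle_den f xs *: G.
Proof.
by move=> eG; rewrite /bundle_num -eG -mul_rowsub_mx mulmxA mul_adj_mx mul_scalar_mx.
Qed.

Lemma good_denE (f : 'I_g -> 'I_L) (f' : 'I_(n - 1) -> 'I_N) F xs (G : 'cV[k]_g) : sys xs *m G = rhs F xs ->
  (forall i, (i < g - 2)%N -> ribbon_of xs i = F i) ->
  good_den f f' xs = bundle_den f xs *
    \det (bundle_den f xs *: rowsub f' (second_mx F (extend (fun i => G i ord0)))).
Proof.
move=> eG eF; congr (_ * \det _); apply/matrixP => j i; rewrite !mxE -sec_val_scale.
apply: eq_sec_val => l lg; first by rewrite eF.
rewrite !(extend_lt _ lg).
have -> : bundle_num f (ribbon_of xs) xs = bundle_num f F xs.
  by rewrite /bundle_num (eq_system_rhs eF (fun i _ => erefl)).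
by rewrite (bundle_numE _ eG) mxE.
Qed.

Lemma W1_of_system (F : 'rV[k]_(g - 2)) xs (G : 'rV[k]_g) :
  sys xs *m G^T = rhs (extend (F ord0)) xs -> W1 F n G.
Proof.
move=> /system_sec h; have ng' : (n <= g)%N by lia.
apply/(W1P _ _ ng'); exists (c1 xs), (c2 xs).
have eG : extend (fun i => G^T i ord0) = extend (G ord0).
  by apply/funext => j; rewrite /extend; case: insub => // o; rewrite mxE.
split; rewrite ?size_monic_poly //; first by lia.
- by move=> j jN; have [] := h j jN; rewrite eG /sec_val !pairE.
- by move=> j jN; have [] := h j jN; rewrite eG /sec_val !pairE.
move=> x y xy.
have := congr1 (fun p : {poly k} => p`_n) xy.
rewrite coefD !coefZ !coef_monic_poly ltnn eqxx coef0 mulr1.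
have -> : (n < be)%N = false by lia.
have -> : (n == be) = false by lia.
rewrite mulr0 addr0 => x0; split=> //.
have := congr1 (fun p : {poly k} => p`_be) xy.
by rewrite x0 scale0r add0r coefZ coef_monic_poly ltnn eqxx coef0 mulr1.
Qed.

(** Slot n is the constant term of m2; slot M0 + (n - 2) is the coefficient F_(n-1). *)
Definition good_xs : nat -> k := fun i => if i == n then 1 else (i == (M0 + (n - 2))%N)%:R.
Let F0 : nat -> k := fun i => (i == (n - 2)%N)%:R.
(** F0 takes the value n - 1 on the derivative of t^(n-1) + 1, and G0 has to cancel it on the
    constant term. *)
Let G0 : 'cV[k]_g := \col_i (- (n - 1)%:R * (i == 0 :> nat)%:R).

Let c1_good : c1 good_xs = 'X^n.
Proof.
rewrite -[RHS]addr0; congr (_ + _); apply/polyP => i; rewrite coef_poly coef0.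
case: ifP => // ind; rewrite /good_xs add0n ifF; last by lia.
by rewrite (_ : (i == _)%N = false) //; lia.
Qed.

Let c2_good : c2 good_xs = 'X^(n - 1) + 1.
Proof.
congr (_ + _); apply/polyP => i; rewrite coef_poly coef1.
case: ifP => ind; last by rewrite (_ : (i == 0)%N = false) //; lia.
rewrite /good_xs; case: i ind => [|i] ind; first by rewrite addn0 add0n eqxx.
by rewrite ifF; [rewrite (_ : (_ == _)%N = false) //|]; lia.
Qed.

Let wr_good : wr good_xs = 'X^(n - 1) * ('X^(n - 1) + n%:R%:P).
Proof.
rewrite wrE c1_good c2_good /wronskian derivXn derivD derivXn -polyC1 derivC addr0.
have [m en] : exists m, n = m.+2 by exists (n - 2)%N; lia.
rewrite en subSS subn0 [m.+1.-1]/= [m.+2.-1]/= polyC_natr.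
rewrite -[_ *+ m.+2]mulr_natr -[_ *+ m.+1]mulr_natr !exprS -[m.+2]addn1 natrD -[1%:R]/1.
move: (m.+1%:R : {poly k}) ('X^m : {poly k}) => a X; ring.
Qed.

Let kill_good i : (i < s)%N -> fpair (g - 2) F0 ('X^i * wr good_xs) = 0.
Proof.
move=> si; rewrite (@fpair_delta _ _ (n - 2) 1); [|lia|by move=> j _; rewrite mul1r].
rewrite mul1r wr_good mulrA -exprD coefXnM ifT //; lia.
Qed.

Let ribbon_good i : (i < g - 2)%N -> ribbon_of good_xs i = F0 i.
Proof.
move=> ig; apply: recurrence_unique.
- move=> l le; rewrite /good_xs ifF; last by lia.
  by rewrite eqn_add2l.
- by apply/(killE n_gt1 ng) => j; apply: kill_good.
- by lia.
Qed.

Let G0E i : (i < g)%N -> extend (fun i => G0 i ord0) i = - (n - 1)%:R * (i == 0)%:R.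
Proof. by move=> ig; rewrite (extend_lt _ ig) mxE. Qed.

Let fpairF0 (p : {poly k}) : fpair (g - 2) F0 p = p`_(n - 2).
Proof. by rewrite (@fpair_delta _ _ (n - 2) 1) ?mul1r //; [lia|move=> j _; rewrite mul1r]. Qed.

Let fpairG0 (p : {poly k}) : fpair g (extend (fun i => G0 i ord0)) p = - (n - 1)%:R * p`_0.
Proof. by apply: fpair_delta; [lia|exact: G0E]. Qed.

Let system_good : sys good_xs *m G0 = rhs F0 good_xs.
Proof.
apply/colP => l; rewrite mul_system_mx [RHS]mxE /row_poly /row_rhs !base_poly0 !mul1r.
rewrite c1_good c2_good; case: ifP => lN.
  rewrite fpairG0 fpairF0 -exprD coefXn derivXn mulrnAr -exprD coefMn coefXn.
  have -> : (0%N == (l + n)%N :> nat) = false by lia.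
  have -> : ((n - 2)%N == (l + n.-1)%N :> nat) = false by lia.
  by rewrite mulr0 mul0rn oppr0.
case: ifP => lNN; last by have := ltn_ord l; lia.
rewrite fpairG0 fpairF0 derivD derivXn -polyC1 derivC addr0 mulrnAr -exprD coefMn coefXn.
rewrite coefXnM; case: (l - N)%N => [|j] /=.
  rewrite coefD coefXn coefC eqxx (_ : (0 == n - 1)%N = false); last by lia.
  by rewrite add0r mulr1 add0n (_ : (n - 2 == (n - 1).-1)%N) //; lia.
by rewrite (_ : (n - 2 == _)%N = false) ?mul0rn ?oppr0 ?mulr0 //; lia.
Qed.

Hypothesis char0 : [pchar k] =i pred0.

Let natr_neq0 m : (0 < m)%N -> m%:R != 0 :> k.
Proof. by rewrite (pcharf0P k).1 // lt0n. Qed.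

(** The equations separate the unknowns: index 0 gives -(n-1) z_0 through G0, and index n - 1 - i
    gives i z_i through F0. *)
Let second_good (z : 'cV[k]_(n - 1)) :
  second_mx F0 (extend (fun i => G0 i ord0)) *m z = 0 -> z = 0.
Proof.
move=> h; pose zz := extend (fun i => z i ord0).
have ez : z = \col_(i < n - 1) zz i by apply/colP => i; rewrite mxE /zz extendE.
have row j : (j < N)%N -> sec_val F0 (extend (fun i => G0 i ord0)) j (\poly_(i < n - 1) zz i) = 0.
  move=> jN; have := congr1 (fun u : 'cV_N => u (Ordinal jN) ord0) h.
  by rewrite {1}ez mul_second_mx mxE.
apply/colP => i; rewrite {1}ez !mxE; have il := ltn_ord i.
case: (posnP i) => [i0|i0].
  have := row 0%N; rewrite /sec_val fpairF0 fpairG0 expr0 !mul1r coef_deriv !coef_poly.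
  rewrite ifF; last by lia.
  rewrite mul0rn add0r ifT; last by lia.
  move=> /(_ _) /eqP; rewrite mulf_eq0 oppr_eq0 (negbTE (natr_neq0 _)); last by lia.
  by rewrite i0 => /(_ _)/eqP; apply; lia.
have := row (n - 1 - i)%N; rewrite /sec_val fpairF0 fpairG0 !coefXnM ifF; last by lia.
rewrite ifT; last by lia.
rewrite mulr0 addr0 coef_deriv coef_poly ifT; last by lia.
have -> : (n - 2 - (n - 1 - i)).+1 = i :> nat by lia.
rewrite -mulr_natr => /(_ _) /eqP; rewrite mulf_eq0 (negbTE (natr_neq0 i0)) orbF.
by move=> /(_ _)/eqP; apply; lia.
Qed.

Lemma good_pencil : exists (f : 'I_g -> 'I_L) (f' : 'I_(n - 1) -> 'I_N),
  good_den f f' good_xs != 0.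
Proof.
have cop : coprimep (c1 good_xs) (c2 good_xs).
  rewrite c1_good c2_good coprimep_expl //.
  have -> : 'X^(n - 1) = 'X^(n - 2) * 'X :> {poly k} by rewrite -exprSr; congr (_ ^+ _); lia.
  by rewrite coprimep_addl_mul coprimep1.
have [||f df] := @system_full g n 0 n be beal _ _ k good_xs cop; try lia.
have full : row_full (second_mx F0 (extend (fun i => G0 i ord0))).
  have : kermx (second_mx F0 (extend (fun i => G0 i ord0)))^T == 0.
    apply/eqP/row_matrixP => i; rewrite row0; apply: trmx_inj; rewrite trmx0.
    apply: second_good; apply: trmx_inj.
    by rewrite trmx_mul trmxK -row_mul mulmx_ker row0 trmx0.
  by rewrite -mxrank_eq0 mxrank_ker subn_eq0 mxrank_tr => rk; rewrite /row_full eqn_leq rk rank_leq_col.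
exists f, (fullrankfun full).
rewrite (good_denE _ _ system_good ribbon_good) detZ !mulf_neq0 // ?expf_neq0 //.
by rewrite -unitfE -unitmxE fullrowsub_unit.
Qed.

End Field.

End GoodPencils.

Lemma hankel_cramer (R : comNzRingType) (f u y : nat -> R) s e : (s <= e)%N ->
  (forall i, (i < s)%N -> \sum_(j < e.+1) f (i + j)%N * u j = 0) ->
  (forall l, (s <= l <= e)%N -> u l = y l) ->
  \adj (hankel f s) *m hankel_rhs f s e y = \det (hankel f s) *: \col_(j < s) u j.
Proof.
move=> se /(hankelE _ _ se) h uy.
have -> : hankel_rhs f s e y = hankel_rhs f s e u.
  congr (- _); apply/colP => i; rewrite !mxE; apply: eq_big_nat => l /andP[sl le].
  by rewrite uy // sl -ltnS.
by rewrite -h mulmxA mul_adj_mx mul_scalar_mx.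
Qed.

Lemma hankel_solve (k : fieldType) (f y : nat -> k) s e : (s <= e)%N ->
  \det (hankel f s) != 0 ->
  exists u : nat -> k, (forall i, (i < s)%N -> \sum_(j < e.+1) f (i + j)%N * u j = 0) /\
    forall l, (s <= l)%N -> u l = y l.
Proof.
move=> se d0; have U : hankel f s \in unitmx by rewrite unitmxE unitfE.
pose v := invmx (hankel f s) *m hankel_rhs f s e y.
pose u l := if (l < s)%N then extend (fun i => v i ord0) l else y l.
have uy l : (s <= l)%N -> u l = y l by move=> sl; rewrite /u ltnNge sl.
exists u; split=> //; apply/(hankelE _ _ se).
have -> : \col_(j < s) u j = v by apply/colP => j; rewrite mxE /u ltn_ord extendE.
rewrite mulKVmx //; congr (- _); apply/colP => i; rewrite !mxE.
by apply: eq_big_nat => l /andP[sl _]; rewrite uy.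
Qed.

(** * From the norm to a condition on the ribbon alone *)

Section Target.
Variables (k : closedFieldType) (m M s e : nat).
Hypothesis se : (s <= e)%N.

(* Coordinates in the order of [wronski]; [f] fills the slots of the further parameters. *)
Definition target (R : nzRingType) (u : nat -> R) (x : R) (f : nat -> R) (j : nat) : R :=
  if (j < e)%N then u j else if j == e then x else f (j - e.+1)%N.

Local Notation F := (generic k m).
Local Notation H := (\det (hankel F s)).

Let monic_tail (y : nat -> k) l := if l == e then 1 else y l.

Let psi (y : nat -> k) (j : 'I_M) : {mpoly k[m]} :=
  if (j < s)%N then
    extend (fun i => (\adj (hankel F s) *m hankel_rhs F s e (@mpolyC m k \o monic_tail y)) i ord0) j
  else H * target (@mpolyC m k \o y) (y e)%:MP F j.

(** The value of q at the Wronskian killed by F with prescribed tail y. Its first s coefficients are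
    rational in F with denominator the Hankel determinant, so clearing denominators leaves a
    polynomial in F. *)
Definition pull_target (q : {mpoly k[M]}) (y : nat -> k) : {mpoly k[m]} :=
  homogenize (psi y) H (msize q) q.

Lemma pull_targetE (q : {mpoly k[M]}) (y u : nat -> k) (v : 'rV[k]_m) :
  (forall i, (i < s)%N -> \sum_(j < e.+1) extend (v ord0) (i + j)%N * u j = 0) ->
  u e = 1 -> (forall l, (s <= l < e)%N -> u l = y l) ->
  (pull_target q y).@[v ord0] = \det (hankel (extend (v ord0)) s) ^+ msize q *
    q.@[fun j => target u (y e) (extend (v ord0)) j].
Proof.
move=> ker ue uy.
have HE : H.@[v ord0] = \det (hankel (extend (v ord0)) s).
  by rewrite -det_map_mx map_hankel eval_generic.
rewrite /pull_target (homogenizeE (x := fun j : 'I_M => target u (y e) (extend (v ord0)) j)) ?HE //.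
move=> j; rewrite /psi; case: ifP => js; last first.
  rewrite mevalM HE mulrC; congr (_ * _); rewrite /target.
  case: ifP => je; first by rewrite /= mevalC uy // leqNgt js.
  by case: ifP => _; rewrite ?mevalC // -eval_generic.
rewrite (extend_lt _ js).
have tail l : (s <= l <= e)%N -> u l = monic_tail y l.
  move=> /andP[sl le]; rewrite /monic_tail; case: eqP => [->//|/eqP ne].
  by apply: uy; rewrite sl ltn_neqAle ne.
have := congr1 (fun w : 'cV_s => w (Ordinal js) ord0) (hankel_cramer se ker tail).
rewrite [in RHS]mxE [in RHS]mxE /= mulrC /target (leq_trans js se) => <-.
have map_rhs : map_mx (meval (v ord0)) (hankel_rhs F s e (@mpolyC m k \o monic_tail y)) =
    hankel_rhs (extend (v ord0)) s e (monic_tail y).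
  apply/colP => i; rewrite !mxE rmorphN rmorph_sum; congr (- _); apply: eq_bigr => l _.
  by rewrite rmorphM /= mevalC -eval_generic.
rewrite -map_rhs -(eval_generic (v ord0)) -map_hankel -map_mx_adj -map_mxM [LHS]mxE.
by [].
Qed.

End Target.

Lemma det_hankel_neq0 (k : fieldType) m s : (s + s <= m.+1)%N ->
  \det (hankel (generic k m) s) != 0.
Proof.
move=> sm; pose v := fun i : 'I_m => (i.+1 == s)%:R : k.
apply/eqP => d0; have := congr1 (meval v) d0.
rewrite meval0 -det_map_mx map_hankel eval_generic; apply/eqP.
apply: hankel_antidiagonal => i; case: (ltnP i m) => im; first by rewrite (extend_lt _ im).
rewrite /extend insubF; last by apply/negbTE; rewrite -leqNgt.
by rewrite (_ : (i.+1 == s) = false) //; lia.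
Qed.

Section Generic.
Variables (g n : nat).
Hypotheses (n_gt1 : (1 < n)%N) (ng : (2 * n + 1 <= g)%N) (rho : (g + 2 <= 4 * n)%N).
Local Notation be := (n - 1)%N.
Local Notation e := (0 + n + be - 1)%N.
Local Notation s := (g - n - n)%N.
Local Notation N := (g - n)%N.
Local Notation L := (N + N + (n - n))%N.
Local Notation M0 := (0 + n + be)%N.
Local Notation M2 := (0 + n + be + e)%N.

(** The e further parameters are the first e coefficients of F, which with the pencil determine the
    ribbon; so [good_den] is a polynomial on the source of the Wronski map and has a norm. *)
Lemma good_norm (k : closedFieldType) (char0 : [pchar k] =i pred0) :
  exists (f : 'I_g -> 'I_L) (f' : 'I_(n - 1) -> 'I_N) (q : {mpoly k[M2]}), q != 0 /\
    forall x : 'I_M2 -> k, good_den f f' (extend x) = 0 ->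
      q.@[fun j => wronski 0 n be (extend x) j] = 0.
Proof.
have [f [f' d0]] := good_pencil n_gt1 ng char0.
have beal : (be < n)%N by lia.
have D0 : good_den f f' (generic k M2) != 0.
  apply: contraNneq d0 => D0; have := congr1 (meval (fun o : 'I_M2 => good_xs n k o)) D0.
  rewrite meval0 (map_good_den (meval _)) eval_generic.
  have -> : extend (fun o : 'I_M2 => good_xs n k o) = good_xs n k; last by move=> ->.
  apply/funext => i; case: (ltnP i M2) => iM; first by rewrite extend_id.
  rewrite /extend insubF; last by apply/negbTE; rewrite -leqNgt.
  rewrite /good_xs ifF; last by lia.
  by rewrite (_ : (_ == _) = false) //; lia.
have [q q0 qE] := finite_norm (@wronski_finite k 0 n be e char0 beal) D0.
exists f, f', q; split=> // x dx; rewrite -[RHS](qE x).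
  by apply: meval_eq => j; rewrite wronski_mapE.
by rewrite (map_good_den (meval _)) eval_generic.
Qed.

(** The Hankel determinant is needed too, because it occurs as a factor in [pull_targetE]. *)
Lemma generic_target (k : closedFieldType) (q : {mpoly k[M2]}) : q != 0 ->
  exists y : 'I_M2 -> k, q.@[y] != 0 /\
    \det (hankel (recurrence e (extend y) (fun l => extend y (M0 + l)%N) s) s) != 0.
Proof.
move=> q0.
pose h := \det (hankel (recurrence e (generic k M2) (fun l => generic k M2 (M0 + l)%N) s) s).
have hE y : h.@[y] = \det (hankel (recurrence e (extend y) (fun l => extend y (M0 + l)%N) s) s).
  rewrite -det_map_mx map_hankel -(eval_generic y); congr (\det (hankel _ _)).
  by apply/funext => l; rewrite /= map_recurrence.
have h0 : h != 0.
  (* With zero lower coefficients in the characteristic polynomial, the recurrence continues by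
     zero; a single initial value 1 at s - 1 gives an antidiagonal Hankel matrix. *)
  pose y := fun o : 'I_M2 => ((o : nat) == M0 + s.-1)%N%:R : k.
  apply/eqP => h0; have := hE y; rewrite h0 meval0 => /esym; apply/eqP.
  apply: hankel_antidiagonal => i.
  have yE l : (l < M2)%N -> extend y l = (l == M0 + s.-1)%N%:R by move=> lM; rewrite (extend_lt _ lM).
  case: (ltnP i (e + s)) => ies.
    apply: (recurrence_unique (f := fun i => (i.+1 == s)%:R)) => //.
      move=> l le; rewrite yE; last by lia.
      by rewrite eqn_add2l; congr (_%:R); congr nat_of_bool; lia.
    move=> j js; rewrite big1; last first.
      move=> l _; have ll := ltn_ord l; rewrite yE; last by lia.
      by rewrite (_ : (_ == _) = false) ?mul0r //; lia.
    by rewrite add0r (_ : (_ == _) = false) //; lia.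
  rewrite (_ : (_ == s) = false); last by lia.
  elim: s ies => [|t IH] ies /=; first by rewrite ifF //; lia.
  by rewrite ifF ?IH //; lia.
have [y] := nonvanishing (mulf_neq0 q0 h0); rewrite mevalM hE mulf_eq0 negb_or => /andP[q1 h1].
by exists (y ord0).
Qed.

(** The tail Y is fixed once for all ribbons, so that the nonvanishing of q becomes an open
    condition on F only; the ribbon built from a good point of the target shows that it is not
    empty. *)
Lemma generic_ribbon (k : closedFieldType) (q : {mpoly k[M2]}) : q != 0 ->
  exists (Y : nat -> k) (P : {mpoly k[g - 2]}), P != 0 /\ forall F : 'rV_(g - 2), P.@[F ord0] != 0 ->
    (forall m, (2 * m <= g - 1)%N -> \det (hankel (extend (F ord0)) m) != 0) /\
    forall u : nat -> k, (forall i, (i < s)%N -> \sum_(j < e.+1) extend (F ord0) (i + j)%N * u j = 0) ->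
      u e = 1 -> (forall l, (s <= l < e)%N -> u l = Y l) ->
      q.@[fun j => target e u (Y e) (extend (F ord0)) j] != 0.
Proof.
move=> q0; have [y [qy hy]] := generic_target q0.
have se : (s <= e)%N by lia.
pose Y := extend y; pose P := @pull_target k (g - 2) M2 s e q Y.
pose D := \prod_(m < g.+1 | (2 * m <= g - 1)%N) \det (hankel (generic k (g - 2)) m).
have D0 : D != 0.
  by apply/prodf_neq0 => m hm; apply: det_hankel_neq0; lia.
have P0 : P != 0.
  (* At this ribbon the Wronskian encoded in y is killed by F, so P is a power of a nonzero Hankel
     determinant times q at y. *)
  pose r := recurrence e Y (fun l => Y (M0 + l)%N) s.
  pose F : 'rV[k]_(g - 2) := \row_i r i.
  have Fr i : (i < g - 2)%N -> extend (F ord0) i = r i.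
    by move=> ig; rewrite (extend_lt _ ig) mxE.
  have HF : hankel (extend (F ord0)) s = hankel r s.
    apply/matrixP => i j; rewrite !mxE Fr //.
    by have := ltn_ord i; have := ltn_ord j; lia.
  pose u l := if (l < e)%N then Y l else 1.
  have ker i : (i < s)%N -> \sum_(j < e.+1) extend (F ord0) (i + j)%N * u j = 0.
    move=> si; rewrite -[RHS](@recurrenceE _ e Y (fun l => Y (M0 + l)%N) s i si) big_ord_recr /=.
    rewrite /u ltnn mulr1 Fr; last by lia.
    congr (_ + _); last by rewrite addnC.
    apply: eq_bigr => j _; have jl := ltn_ord j; rewrite jl Fr; last by lia.
    by rewrite mulrC.
  have ue : u e = 1 by rewrite /u ltnn.
  have uy l : (s <= l < e)%N -> u l = Y l by move=> /andP[_ le]; rewrite /u le.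
  apply/eqP => P0; move: (pull_targetE se q ker ue uy).
  rewrite -/P P0 meval0 => /esym/eqP; rewrite mulf_eq0 expf_eq0 HF (negbTE hy) andbF /=.
  apply/negP; rewrite (_ : meval _ q = q.@[y]) //; apply: meval_eq => j.
  rewrite /target /u -[RHS](extendE y); case: ifP => je; first by rewrite je. case: ifP => [/eqP ->|/eqP ne] //.
  have jl := ltn_ord j; rewrite Fr; last by lia.
  rewrite /r recurrence_init; last by lia.
  by congr (Y _); lia.
exists Y, (P * D); split; first by rewrite mulf_neq0.
move=> F; rewrite mevalM mulf_eq0 negb_or => /andP[PF DF].
have hF m : (2 * m <= g - 1)%N -> \det (hankel (extend (F ord0)) m) != 0.
  move=> hm; have mg : (m < g.+1)%N by lia.
  move: DF; rewrite /D rmorph_prod /= => /prodf_neq0 /(_ (Ordinal mg) hm).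
  by rewrite -det_map_mx map_hankel eval_generic.
split=> // u ker ue uy; move: PF; rewrite (pull_targetE se q ker ue uy) mulf_eq0 negb_or.
by case/andP.
Qed.

End Generic.

(** * Flags of Wronskians and recovery of pencils *)

Section Flag.
Variables (k : closedFieldType) (M s e : nat).
Hypotheses (Me : M = e.+1) (se : (s <= e)%N).
Variables (f y : nat -> k).
Hypothesis hankel_neq0 : \det (hankel f s) != 0.

(** In the coordinates of [wronski], slot e holds a coefficient of m1, whereas the Wronskian has
    leading coefficient 1; the slot is overwritten accordingly. *)
Definition monic_seq (R : nzRingType) (u : nat -> R) l := if (l < e)%N then u l else 1.

(** Slots s to s + i - 1 are free and the first s follow from the Hankel system, so [flag 0] is a
    single point. *)
Definition flag i : set 'rV[k]_M :=
  [set u | [/\ forall t, (t < s)%N -> \sum_(j < e.+1) f (t + j)%N * monic_seq (extend (u ord0)) j = 0,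
    extend (u ord0) e = y e & forall l, (s + i <= l < e)%N -> extend (u ord0) l = y l]].

Let flag_point (z : nat -> k) : exists u : 'rV[k]_M,
  [/\ forall t, (t < s)%N -> \sum_(j < e.+1) f (t + j)%N * monic_seq (extend (u ord0)) j = 0,
    extend (u ord0) e = y e & forall l, (s <= l < e)%N -> extend (u ord0) l = z l].
Proof.
have [u [hu uz]] := hankel_solve (fun l => if (l < e)%N then z l else 1) se hankel_neq0.
pose v : 'rV[k]_M := \row_j (if (j < e)%N then u j else y e).
have vE l : (l < M)%N -> extend (v ord0) l = if (l < e)%N then u l else y e.
  by move=> lM; rewrite (extend_lt _ lM) mxE.
exists v; split.
- move=> t ts; rewrite -[RHS](hu t ts); apply: eq_bigr => j _; congr (_ * _); have jl := ltn_ord j.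
  rewrite /monic_seq; case: ifP => je; first by rewrite vE ?je // Me.
  by rewrite uz ?je //; lia.
- by rewrite vE ?ltnn // Me.
- by move=> l /andP[sl le]; rewrite vE ?le ?uz ?le // Me leqW.
Qed.

Lemma flag_closed i : zariski_closed (flag i).
Proof.
exists [set p | [\/ exists2 t, (t < s)%N & p = \sum_(j < e.+1) (f (t + j)%N)%:MP * monic_seq (generic k M) j,
   p = generic k M e - (y e)%:MP | exists2 l, (s + i <= l < e)%N & p = generic k M l - (y l)%:MP]].
have gE (u : 'rV[k]_M) l : (generic k M l).@[u ord0] = extend (u ord0) l by rewrite -eval_generic.
have mE (u : 'rV[k]_M) l : (monic_seq (generic k M) l).@[u ord0] = monic_seq (extend (u ord0)) l.
  by rewrite /monic_seq; case: ifP; rewrite ?gE ?meval1.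
have sE (u : 'rV[k]_M) t : (\sum_(j < e.+1) (f (t + j)%N)%:MP * monic_seq (generic k M) j).@[u ord0]
    = \sum_(j < e.+1) f (t + j)%N * monic_seq (extend (u ord0)) j.
  by rewrite rmorph_sum; apply: eq_bigr => j _; rewrite /= mevalM mevalC mE.
apply/seteqP; split=> u /=.
  move=> [h1 h2 h3] p [[t ts ->]|->|[l hl ->]]; first by rewrite sE h1.
    by rewrite mevalB gE mevalC h2 subrr.
  by rewrite mevalB gE mevalC h3 ?subrr.
move=> h; split.
- by move=> t ts; rewrite -sE; apply: h; constructor 1; exists t.
- apply/eqP; rewrite -subr_eq0 -gE -(mevalC (u ord0) (y e)) -mevalB; apply/eqP; apply: h.
  by constructor 2.
- move=> l hl; apply/eqP; rewrite -subr_eq0 -gE -(mevalC (u ord0) (y l)) -mevalB; apply/eqP; apply: h.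
  by constructor 3; exists l.
Qed.

Lemma flag_irreducible i : zariski_irreducible (flag i).
Proof.
apply: affine_irreducible.
  have [u [h1 h2 h3]] := flag_point y; exists u; split=> // l /andP[sl le]; apply: h3.
  by rewrite le (leq_trans (leq_addr i s)).
move=> a b t [a1 a2 a3] [b1 b2 b3].
have xE l : extend ((a + t *: (b - a)) ord0) l = extend (a ord0) l + t * (extend (b ord0) l - extend (a ord0) l).
  by rewrite /extend; case: insub => [o|]; rewrite ?mxE // subrr mulr0 addr0.
split.
- move=> r rs; rewrite (_ : \sum_(j < e.+1) _ =
     \sum_(j < e.+1) f (r + j)%N * monic_seq (extend (a ord0)) j +
     t * (\sum_(j < e.+1) f (r + j)%N * monic_seq (extend (b ord0)) j -
      \sum_(j < e.+1) f (r + j)%N * monic_seq (extend (a ord0)) j)).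
    by rewrite a1 ?b1 // subrr mulr0 addr0.
  rewrite -sumrB mulr_sumr -big_split; apply: eq_bigr => j _ /=.
  by rewrite /monic_seq; case: ifP => _; rewrite ?xE; ring.
- by rewrite xE a2 b2 subrr mulr0 addr0.
- by move=> l hl; rewrite xE a3 ?b3 // subrr mulr0 addr0.
Qed.

Lemma flag_lt i : (i < e - s)%N -> flag i `<` flag i.+1.
Proof.
move=> ies; split.
  move=> u [h1 h2 h3]; split=> // l /andP[sl le]; apply: h3; rewrite le.
  by rewrite (leq_trans _ sl) // addnS.
move=> sub; have [u [h1 h2 h3]] := flag_point (fun l => y l + (l == s + i)%N%:R).
have [] := sub u.
  split=> // l /andP[sl le]; rewrite h3.
    by rewrite (_ : (l == _) = false) ?addr0 //; lia.
  by rewrite le (leq_trans _ sl) // leq_addr.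
move=> _ _ /(_ (s + i)%N); rewrite h3; last by lia.
rewrite eqxx => /(_ _)/eqP; rewrite -subr_eq0 addrC addKr oner_eq0 => F.
by have : false by apply: F; lia.
Qed.

End Flag.

Section Recover.
Variables (g n : nat).
Hypotheses (n_gt1 : (1 < n)%N) (ng : (2 * n + 1 <= g)%N).
Local Notation be := (n - 1)%N.
Local Notation e := (0 + n + be - 1)%N.
Local Notation s := (g - n - n)%N.
Local Notation N := (g - n)%N.
Local Notation L := (N + N + (n - n))%N.
Local Notation M0 := (0 + n + be)%N.
Local Notation wr xs := (wronski_poly 0 n be xs).
Local Notation c1 xs := (pencil1 0 n xs).
Local Notation c2 xs := (pencil2 0 n be xs).
Local Notation sys xs := (system_mx g n 0 n be xs).
Local Notation rhs f xs := (system_rhs g n 0 n be f xs).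

Let beal : (be < n)%N. Proof. by lia. Qed.

(** Cramer's rule for the low part of a section with prescribed top part a, before division by the
    determinant. *)
Definition recover (R : comNzRingType) (f' : 'I_(n - 1) -> 'I_N) (f G : nat -> R) (a : {poly R}) : 'cV[R]_(n - 1) :=
  - (\adj (rowsub f' (second_mx g n f G)) *m rowsub f' (\col_j sec_val g f G j a)).

Lemma map_recover (R S : comNzRingType) (h : {rmorphism R -> S}) f' (f G : nat -> R) a :
  map_mx h (recover f' f G a) = recover f' (h \o f) (h \o G) (map_poly h a).
Proof.
rewrite /recover map_mxN map_mxM map_mx_adj !map_mxsub map_second_mx; congr (- (_ *m rowsub _ _)).
by apply/colP => j; rewrite !mxE map_sec_val.
Qed.

Lemma recoverE (R : comNzRingType) f' (f G z : nat -> R) a :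
  (forall j, (j < N)%N -> sec_val g f G j (a + \poly_(i < n - 1) z i) = 0) ->
  recover f' f G a = \det (rowsub f' (second_mx g n f G)) *: \col_(i < n - 1) z i.
Proof.
move=> h; rewrite /recover; have -> : \col_(j < N) sec_val g f G j a = - (second_mx g n f G *m \col_(i < n - 1) z i).
  apply/colP => j; rewrite [LHS]mxE [RHS]mxE mul_second_mx; apply/eqP.
  by rewrite -addr_eq0 -sec_valD h.
rewrite -mul_scalar_mx -mul_adj_mx -mulmxA mul_rowsub_mx.
by rewrite -mulmxN; congr (_ *m _); apply/colP => j; rewrite !mxE opprK.
Qed.

(** A common root z gives the functional of evaluation at z, that is the vector of the z^i, which
    kills all rows of the system. *)
Lemma coprime_bundle_den (k : closedFieldType) (f : 'I_g -> 'I_L) (xs : nat -> k) :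
  bundle_den f xs != 0 -> coprimep (c1 xs) (c2 xs).
Proof.
apply: contraNT => /closed_rootP [z]; rewrite root_gcd => /andP[/eqP z1 /eqP z2].
pose v : 'cV[k]_g := \col_i z ^+ i.
have g0 : (0 < g)%N by lia.
have vE i : (i < g)%N -> extend (fun i => v i ord0) i = z ^+ i.
  by move=> ig; rewrite (extend_lt _ ig) mxE.
have h l (p : {poly k}) : (l < N)%N -> (size p <= n.+1)%N -> p.[z] = 0 ->
    fpair g (extend (fun i => v i ord0)) ('X^l * p) = 0.
  move=> lN sp pz; transitivity ('X^l * p).[z]; last by rewrite hornerM pz mulr0.
  rewrite (@horner_coef_wide _ g).
    by apply: eq_bigr => i _; rewrite vE // mulrC.
  by rewrite (leq_trans (size_polyMleq _ _)) // size_polyXn addSn /= (leq_trans (leq_add (leqnn l) sp)) //; lia.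
have sv : sys xs *m v = 0.
  apply/colP => l; rewrite mul_system_mx mxE /row_poly !base_poly0 !mul1r.
  case: ifP => lN; first by apply: h; rewrite ?size_monic_poly.
  case: ifP => lNN; first by apply: h; rewrite ?size_monic_poly //; lia.
  by have := ltn_ord l; lia.
have rv : rowsub f (sys xs) *m v = 0.
  by rewrite mul_rowsub_mx sv; apply/colP => i; rewrite !mxE.
have := congr1 (mulmx (\adj (rowsub f (sys xs)))) rv.
rewrite mulmx0 mulmxA mul_adj_mx mul_scalar_mx => /(congr1 (fun w : 'cV_g => w (Ordinal g0) ord0)).
by rewrite [LHS]mxE [v _ _]mxE expr0 mulr1 [RHS]mxE => e0; rewrite /bundle_den e0 eqxx.
Qed.

End Recover.

Lemma meval_comp_const (k : fieldType) N (x : 'I_N -> k) (f : nat -> k) :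
  meval x \o (@mpolyC N k \o f) = f.
Proof. by apply/funext => i; rewrite /= mevalC. Qed.

(** * The chain of line bundles *)

Section ChainInW1.
Variables (k : closedFieldType) (g n : nat).
Hypotheses (n_gt1 : (1 < n)%N) (ng : (2 * n + 1 <= g)%N) (rho : (g + 2 <= 4 * n)%N).
Hypothesis char0 : [pchar k] =i pred0.
Local Notation be := (n - 1)%N.
Local Notation e := (0 + n + be - 1)%N.
Local Notation s := (g - n - n)%N.
Local Notation N := (g - n)%N.
Local Notation L := (N + N + (n - n))%N.
Local Notation M0 := (0 + n + be)%N.
Local Notation M := (0 + n + be + 0)%N.
Local Notation M2 := (0 + n + be + e)%N.
Local Notation wr xs := (wronski_poly 0 n be xs).
Local Notation c1 xs := (pencil1 0 n xs).
Local Notation c2 xs := (pencil2 0 n be xs).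
Local Notation sys xs := (system_mx g n 0 n be xs).
Local Notation rhs f xs := (system_rhs g n 0 n be f xs).
Local Notation v := (@wronski_map k 0 n be 0).

Let beal : (be < n)%N. Proof. by lia. Qed.

Variables (F : 'rV[k]_(g - 2)) (f : 'I_g -> 'I_L) (f' : 'I_(n - 1) -> 'I_N) (Y : nat -> k).
Local Notation Fx := (extend (F ord0)).
Local Notation A := (@flag k M s e Fx Y).
Local Notation "z ^x" := (extend (z ord0)) (at level 2, format "z ^x").

Definition bundle_of (z : 'rV[k]_M) : 'rV[k]_g :=
  (bundle_den f z^x)^-1 *: (bundle_num f Fx z^x)^T.

Lemma lift_flag (z : 'rV[k]_M) i : A i (polymap v z) ->
  (forall t, (t < s)%N -> fpair (g - 2) Fx ('X^t * wr z^x) = 0) /\ z^x (n - 1)%N = Y e.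
Proof.
have vE l : (l < M)%N -> extend (polymap v z ord0) l = wronski 0 n be z^x l.
  by move=> lM; rewrite (extend_lt _ lM) mxE wronski_mapE.
move=> [h1 h2 _]; split; last first.
  by rewrite -h2 vE /wronski ?ltnn ?eqxx // add0n; lia.
apply/(killE n_gt1 ng) => t ts; rewrite -[RHS](h1 t ts) big_ord_recr /= /monic_seq ltnn mulr1.
congr (_ + _); last by rewrite addnC.
apply: eq_bigr => j _; have je := ltn_ord j; rewrite je vE; last by lia.
by rewrite /wronski je mulrC.
Qed.

Lemma bundle_solution (z : 'rV[k]_M) : bundle_den f z^x != 0 ->
  (forall t, (t < s)%N -> fpair (g - 2) Fx ('X^t * wr z^x) = 0) ->
  sys z^x *m (bundle_of z)^T = rhs Fx z^x.
Proof.
move=> dz kill; have cop := coprime_bundle_den n_gt1 ng dz.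
have [G eG] := system_solvable n_gt1 ng cop kill.
by rewrite /bundle_of (bundle_numE f eG) linearZ /= trmxK scalerA mulVf // scale1r.
Qed.

Let delta := bundle_den f (generic k M).
Let psi i := bundle_num f (@mpolyC M k \o Fx) (generic k M) i ord0.
Let delta' := \det (rowsub f' (second_mx g n (@mpolyC g k \o Fx) (generic k g))).
Let rec a (i : nat) := extend (fun j => recover f' (@mpolyC g k \o Fx) (generic k g) a j ord0) i.
(** The inverse correspondence: on the flag m1 begins with t^n + Y_e t^(n-1) and m2 with t^(n-1),
    and all lower coefficients are recovered from G. *)
Let psi' (i : 'I_M) : {mpoly k[g]} :=
  if (i < n - 1)%N then rec ('X^n + (Y e)%:MP *: 'X^(n - 1)) i
  else if i == (n - 1)%N :> nat then (Y e)%:MP * delta' else rec 'X^(n - 1) (i - n)%N.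

Let deltaE (z : 'rV_M) : delta.@[z ord0] = bundle_den f z^x.
Proof. by rewrite /delta (map_bundle_den (meval _)) eval_generic. Qed.

Let psiE (z : 'rV_M) : delta.@[z ord0] != 0 ->
  forall i, bundle_of z ord0 i * delta.@[z ord0] = (psi i).@[z ord0].
Proof.
rewrite deltaE => dz i; rewrite mxE mulrAC mulVf // mul1r mxE /psi.
have := map_bundle_num (meval (z ord0)) f (@mpolyC M k \o Fx) (generic k M).
rewrite meval_comp_const eval_generic => <-.
by rewrite mxE.
Qed.

Let delta'E (G : 'rV_g) : delta'.@[G ord0] = \det (rowsub f' (second_mx g n Fx G^x)).
Proof. by rewrite -det_map_mx map_mxsub map_second_mx meval_comp_const eval_generic. Qed.

Let recE (G : 'rV[k]_g) (a : {poly {mpoly k[g]}}) (zs : nat -> k) i : (i < n - 1)%N ->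
  (forall j, (j < N)%N -> sec_val g Fx G^x j (map_poly (meval (G ord0)) a + \poly_(i < n - 1) zs i) = 0) ->
  (rec a i).@[G ord0] = zs i * delta'.@[G ord0].
Proof.
move=> il h; have := recoverE f' h; rewrite -delta'E mulrC.
have := map_recover (meval (G ord0)) f' (@mpolyC g k \o Fx) (generic k g) a.
rewrite meval_comp_const eval_generic => <- /(congr1 (fun w : 'cV_(n - 1) => w (Ordinal il) ord0)).
by rewrite [LHS]mxE [RHS]mxE [X in _ * X]mxE /rec (extend_lt _ il).
Qed.

Let psi'E (z : 'rV_M) i : A i (polymap v z) -> delta.@[z ord0] != 0 ->
  forall j, z ord0 j * delta'.@[bundle_of z ord0] = (psi' j).@[bundle_of z ord0].
Proof.
move=> /lift_flag [kill zY]; rewrite deltaE => dz j.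
have sol := system_sec n_gt1 ng (bundle_solution dz kill).
have eG : extend (fun i => (bundle_of z)^T i ord0) = (bundle_of z)^x.
  by apply/funext => l; rewrite /extend; case: insub => // o; rewrite mxE.
rewrite eG in sol; rewrite -[z ord0 j](extendE (z ord0)) /psi'; have jM := ltn_ord j.
case: ifP => jn.
  rewrite (recE (zs := z^x) jn) // => l lN; have [h _] := sol l lN; rewrite -[RHS]h (pencil1E n_gt1 ng).
  by rewrite zY rmorphD /= map_polyZ /= mevalC !map_polyXn.
case: ifP => [/eqP ->|jn']; first by rewrite mevalM mevalC zY.
have jn2 : (j - n < n - 1)%N by lia.
rewrite (recE (zs := fun i => z^x (n + i)%N) jn2); last first.
  move=> l lN; have [_ h] := sol l lN; rewrite -[RHS]h pencil2E.
  by rewrite map_polyXn.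
by rewrite subnKC //; lia.
Qed.

Variable q : {mpoly k[M2]}.
Hypothesis norm_q : forall x : 'I_M2 -> k, good_den f f' (extend x) = 0 ->
  q.@[fun j => wronski 0 n be (extend x) j] = 0.
Hypothesis hankel_F : \det (hankel Fx s) != 0.
Hypothesis target_F : forall u : nat -> k,
  (forall i, (i < s)%N -> \sum_(j < e.+1) Fx (i + j)%N * u j = 0) ->
  u e = 1 -> (forall l, (s <= l < e)%N -> u l = Y l) -> q.@[fun j => target e u (Y e) Fx j] != 0.

(** It holds for every point over the bottom of the flag, since a zero of [good_den] anywhere in the
    fibre would make the norm q vanish at the image. *)
Let base_point (z : 'rV_M) : A 0%N (polymap v z) -> delta.@[z ord0] != 0 /\ delta'.@[bundle_of z ord0] != 0.
Proof.
move=> Az; have [kill zY] := lift_flag Az; case: Az => h1 h2 h3.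
(* The pencil z together with the first e coefficients of F; by uniqueness of the recurrence the
   ribbon it encodes is F. *)
pose x (j : 'I_M2) := if (j < M0)%N then z^x j else Fx (j - M0)%N.
have xz l : (l < M0)%N -> extend x l = z^x l.
  move=> lM; have lM2 : (l < M2)%N by lia.
  by rewrite (extend_lt _ lM2) /x /= lM.
have xF l : (l < e)%N -> extend x (M0 + l)%N = Fx l.
  move=> le; have lM2 : (M0 + l < M2)%N by lia.
  by rewrite (extend_lt _ lM2) /x /= ltnNge leq_addr /= addKn.
have e1 : c1 (extend x) = c1 z^x by apply: eq_monic_poly => i ib; apply: xz; lia.
have e2 : c2 (extend x) = c2 z^x by apply: eq_monic_poly => i ib; apply: xz; lia.
have ewr : wr (extend x) = wr z^x by rewrite !wrE e1 e2.
have vE l : (l < M)%N -> extend (polymap v z ord0) l = wronski 0 n be z^x l.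
  by move=> lM; rewrite (extend_lt _ lM) mxE wronski_mapE.
have gd : good_den f f' (extend x) != 0.
  pose u := monic_seq e (extend (polymap v z ord0)).
  have ue : u e = 1 by rewrite /u /monic_seq ltnn.
  have uY l : (s <= l < e)%N -> u l = Y l.
    by move=> /andP[sl le]; rewrite /u /monic_seq le h3 // addn0 sl.
  apply: contra_neq (target_F h1 ue uY) => /norm_q e0; rewrite -[RHS]e0.
  apply: meval_eq => j; have jM := ltn_ord j; rewrite /target /wronski; case: ifP => je.
    by rewrite ewr /u /monic_seq je vE /wronski ?je //; lia.
  case: ifP => [_|je']; first by rewrite -zY xz //; lia.
  have -> : nat_of_ord j = (M0 + (j - M0))%N by lia.
  rewrite xF; last by lia.
  by congr (Fx _); lia.
have rib i : (i < g - 2)%N -> ribbon_of g n (extend x) i = Fx i.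
  move=> ig; apply: recurrence_unique.
  - by move=> l le; rewrite xF.
  - by rewrite ewr; apply/(killE n_gt1 ng).
  - by lia.
have edz : bundle_den f (extend x) = bundle_den f z^x.
  by rewrite /bundle_den (eq_system_mx n_gt1 ng xz).
have dz : bundle_den f z^x != 0.
  by apply: contraNneq gd => dz; rewrite /good_den edz dz mul0r.
have sol := bundle_solution dz kill.
have esys := eq_system_mx n_gt1 ng xz; have erhs := eq_system_rhs n_gt1 ng (fun i _ => erefl (Fx i)) xz.
rewrite -esys -erhs in sol.
rewrite deltaE dz delta'E; split=> //.
move: gd; rewrite (good_denE n_gt1 ng f f' sol rib) detZ edz !mulf_eq0 !negb_or => /and3P[_ _].
by rewrite (_ : extend (fun i => (bundle_of z)^T i ord0) = (bundle_of z)^x) //;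
  apply/funext => l; rewrite /extend; case: insub => // o; rewrite mxE.
Qed.

Lemma W1_chain : exists C, irreducible_chain (W1 F n) (4 * n - 2 - g) C.
Proof.
have Me : M = e.+1 by lia.
have se : (s <= e)%N by lia.
have fin := @wronski_finite k 0 n be 0 char0 beal.
have [||||C [chC _ CA]] := @chain_over k M M v fin (e - s) A setT.
- exact: zariski_closedT.
- by move=> i _; split; [exact: flag_closed|exact: flag_irreducible].
- by move=> i ies; apply: flag_lt.
- by move=> y _; have [x <-] := polymap_surj fin y; exists x.
have mem i (z : 'rV_M) : (i <= e - s)%N -> C i z -> A i (polymap v z).
  by move=> ies Cz; have [_ <-] := CA i ies; exists z.
have [[z0 Cz0] _] := (chC.1 0%N (leq0n _)).2.
have [d0 d0'] := base_point (mem 0%N z0 (leq0n _) Cz0).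
have -> : (4 * n - 2 - g = e - s)%N by lia.
eexists; apply: (@transport_chain k M g (W1 F n) bundle_of psi delta psi' delta' (e - s) C z0 chC psiE) => //.
- move=> z Cz; rewrite deltaE => dz; have [kill _] := lift_flag (mem _ _ (leqnn _) Cz).
  by apply: (W1_of_system n_gt1 ng); apply: bundle_solution.
- by move=> z Cz dz; apply: psi'E (mem _ _ (leqnn _) Cz) dz.
Qed.

End ChainInW1.

Theorem corollary2p14 (k : closedFieldType) (char0 : [pchar k] =i pred0)
    (g n : nat) (hn : (2 * n + 1 <= g)%N) (hrho : (g + 2 <= 4 * n)%N) :
  holds_generally (fun F : 'rV[k]_(g - 2) =>
    W1 F n !=set0 -> has_dimension (W1 F n) (4 * n - 2 - g)%N).
Proof.
have n1 : (1 < n)%N by lia.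
have [f [f' [q [q0 qn]]]] := good_norm n1 hn hrho char0.
have [Y [P [P0 PF]]] := generic_ribbon n1 hn hrho q0.
have [F0 F00] := nonvanishing P0.
exists [set F : 'rV_(g - 2) | P.@[F ord0] != 0]; split; last 1 first.
- move=> F /PF [hankF targetF] _; split.
    by apply: (W1_chain n1 hn hrho char0 qn _ targetF); apply: hankF; lia.
  by move=> d [C chC]; apply: chain_length (growth_W1 char0 hn hankF) chC.
- exists [set P]; apply/seteqP; split=> F /=; first by move=> /negP; rewrite negbK => /eqP h _ ->.
  by move=> h; apply/negP; rewrite negbK; apply/eqP; apply: h.
- by exists F0.
Qed.
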